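(* Let $n\ge 2$ and let $t>0$. Consider the projective space $\mathbb{C}P^{2n-1}=Sp(n)/(Sp(n-1)\times U(1))$ endowed with the $Sp(n)$-invariant integrable almost-complex structure $(+,+)$ and the $Sp(n)$-invariant metric $(1,t)$. It is Griffiths semi-positive if and only if $t\ge 1$, and it is dual-Nakano semi-positive if and only if $t\geq 1$. Moreover, it is Griffiths positive if and only if $t>1$, and it is dual-Nakano positive if and only if $t>1$.
   Context: The complexified Lie algebra of $Sp(n)$ has Cartan subalgebra consisting of the matrices $\mathrm{diag}(\Lambda,-\Lambda)$, $\Lambda=\mathrm{diag}(x_1,\dots,x_n)$, and roots $\pm(\lambda_i-\lambda_j)$, $\pm(\lambda_i+\lambda_j)$ ($i\ne j$), $\pm2\lambda_i$, where $\lambda_i(\Lambda)=x_i$. For $M=Sp(n)/(Sp(n-1)\times U(1))$ with reductive decomposition $\mathfrak{sp}(n)=\mathfrak{k}\oplus\mathfrak{m}$ (orthogonal for the Killing form $B$), the roots whose root spaces lie in $\mathfrak{m}^{\mathbb{C}}$ are $R_M=\pm\{\lambda_1-\lambda_j,\ \lambda_1+\lambda_j,\ 2\lambda_1 : j=2,\dots,n\}$. The isotropy representation splits as $\mathfrak{m}=\mathfrak{m}_1\oplus\mathfrak{m}_2$, where $\mathfrak{m}_1^{\mathbb{C}}$ is the sum of the root spaces of $\pm(\lambda_1-\lambda_j),\pm(\lambda_1+\lambda_j)$, $j\ge2$, and $\mathfrak{m}_2^{\mathbb{C}}$ is the sum of those of $\pm2\lambda_1$. The invariant metric $(1,t)$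 is the one given on $\mathfrak{m}\cong T_oM$ by $-B|_{\mathfrak{m}_1}-t\,B|_{\mathfrak{m}_2}$. The structure $(+,+)$ is the invariant almost-complex structure $J$ acting as $\sqrt{-1}$ on the root spaces of $\lambda_1-\lambda_j$, $\lambda_1+\lambda_j$ ($j\ge2$) and $2\lambda_1$, and as $-\sqrt{-1}$ on those of their negatives. On an almost-Hermitian manifold $(M,g,J)$ the Chern connection $\nabla$ is the unique connection with $\nabla g=0$, $\nabla J=0$ and torsion with vanishing $(1,1)$-part. Set $R(X,Y)Z=\nabla_X\nabla_YZ-\nabla_Y\nabla_XZ-\nabla_{[X,Y]}Z$ and $R(X,Y,Z,W)=g(R(X,Y)Z,W)$, extended complex-multilinearly, and $R_{i\overline{j}k\overline{l}}=R(e_i,\overline{e_j},e_k,\overline{e_l})$ for a frame $(e_i)$ of $T^{1,0}M$. - Griffiths positive (semi-positive): at every point, $R(u,\overline{u},v,\overline{v})>0$ ($\ge0$) for all nonzero $u,v\in T^{1,0}M$. - Dual-Nakano positive (semi-positive): at every point, $\sum_{i,j,k,l}R_{i\overline{j}k\overline{l}}\,u^{il}\,\overline{u^{jk}}>0$ ($\ge0$) for every nonzero complex array $(u^{ij})$, viewed as the components of $u=\sum u^{ij}e_i\otimes e_j\in T^{1,0}M\otimes T^{1,0}M$. *)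

(* Defs.v *)
From HB Require Import structures.
From mathcomp Require Import all_boot all_order all_algebra.
From mathcomp Require Import all_classical all_reals all_analysis.
From mathcomp.real_closed Require Import complex.

Set Implicit Arguments.
Unset Strict Implicit.
Unset Printing Implicit Defensive.

Import Order.TTheory GRing.Theory Num.Theory.
Import numFieldNormedType.Exports.

Local Open Scope classical_set_scope.
Local Open Scope ring_scope.

(* Functions, vector fields, metrics and almost-complex structures on a
   submanifold M of a finite-dimensional real normed space V are total
   functions on V; only their values at points of M (and, for tensors, on
   tangent vectors) are meaningful. *)

Section Calculus.
Variables (R : realType) (V W : normedModType R).

(* C^k and C^oo functions; equivalent to the usual definition via partial
   derivatives because V is finite-dimensional. *)
Fixpoint Ck (k : nat) (F : V -> W) : Prop :=
  if k is k'.+1 then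
    (forall p, differentiable F p) /\ (forall v, Ck k' (fun p => 'D_v F p))
  else continuous F.

Definition smooth (F : V -> W) : Prop := forall k, Ck k F.

Variable M : set V.

Definition is_smooth_extension (f F : V -> W) : Prop :=
  smooth F /\ forall p, M p -> F p = f p.

Definition smooth_on (f : V -> W) : Prop := exists F, is_smooth_extension f F.

(* The derivative v(f) of f : M -> W along v in T_pM, computed on a smooth
   extension of f; it does not depend on the extension since v is tangent. *)
Definition mderiv (f : V -> W) (p v : V) : W :=
  'D_v (xget (fun=> 0) [set F | is_smooth_extension f F]) p.

End Calculus.

Section AlmostHermitian.
Variables (R : realType) (V : normedModType R) (M : set V).
Variables (g : V -> V -> V -> R) (J : V -> V -> V).

Definition tangent (p v : V) : Prop :=
  exists c : R -> V,
    [/\ c 0 = p, is_derive (0 : R) (1 : R) c v & \forall s \near (0 : R), M (c s)].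

Definition vfield (X : V -> V) : Prop :=
  smooth_on M X /\ forall p, M p -> tangent p (X p).

Definition eq_on (X Y : V -> V) : Prop := forall p, M p -> X p = Y p.

Definition bracket (X Y : V -> V) : V -> V :=
  fun p => mderiv M Y p (X p) - mderiv M X p (Y p).

Definition fscale (f : V -> R) (X : V -> V) : V -> V := fun p => f p *: X p.

Record is_connection (nabla : (V -> V) -> (V -> V) -> V -> V) : Prop := {
  conn_vfield : forall X Y, vfield X -> vfield Y -> vfield (nabla X Y);
  conn_eq_on : forall X X' Y Y', vfield X -> vfield X' -> vfield Y -> vfield Y' ->
    eq_on X X' -> eq_on Y Y' -> eq_on (nabla X Y) (nabla X' Y');
  conn_addl : forall X X' Y, vfield X -> vfield X' -> vfield Y ->
    eq_on (nabla (X \+ X') Y) (nabla X Y \+ nabla X' Y);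
  conn_scalel : forall f X Y, smooth_on M f -> vfield X -> vfield Y ->
    eq_on (nabla (fscale f X) Y) (fscale f (nabla X Y));
  conn_addr : forall X Y Y', vfield X -> vfield Y -> vfield Y' ->
    eq_on (nabla X (Y \+ Y')) (nabla X Y \+ nabla X Y');
  conn_leibniz : forall f X Y, smooth_on M f -> vfield X -> vfield Y ->
    eq_on (nabla X (fscale f Y))
      (fscale (fun p => mderiv M f p (X p)) Y \+ fscale f (nabla X Y))
}.

Definition torsion (nabla : (V -> V) -> (V -> V) -> V -> V) (X Y : V -> V) : V -> V :=
  fun p => nabla X Y p - nabla Y X p - bracket X Y p.

Definition curvature (nabla : (V -> V) -> (V -> V) -> V -> V) (X Y Z : V -> V) : V -> V :=
  fun p => nabla X (nabla Y Z) p - nabla Y (nabla X Z) p - nabla (bracket X Y) Z p.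

(* Complexified vectors and vector fields: (x, y) stands for x + i y. *)
Definition cfield := ((V -> V) * (V -> V))%type.

Definition cpart (u : cfield) (b : bool) : V -> V := if b then u.2 else u.1.

Definition cconj (u : cfield) : cfield := (u.1, fun p => - u.2 p).

Definition cval (u : cfield) (p : V) : V * V := (u.1 p, u.2 p).

Definition cscale (c : R[i]) (w : V * V) : V * V :=
  (complex.Re c *: w.1 - complex.Im c *: w.2,
   complex.Re c *: w.2 + complex.Im c *: w.1).

(* T^{1,0}_pM, the i-eigenspace of J. *)
Definition T10 (p : V) (w : V * V) : Prop :=
  [/\ tangent p w.1, tangent p w.2, J p w.1 = - w.2 & J p w.2 = w.1].

Definition T10_field (u : cfield) : Prop :=
  [/\ vfield u.1, vfield u.2 & forall p, M p -> T10 p (cval u p)].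

Definition ctorsion (nabla : (V -> V) -> (V -> V) -> V -> V) (u v : cfield) (p : V)
    : V * V :=
  (torsion nabla u.1 v.1 p - torsion nabla u.2 v.2 p,
   torsion nabla u.1 v.2 p + torsion nabla u.2 v.1 p).

Record is_chern (nabla : (V -> V) -> (V -> V) -> V -> V) : Prop := {
  chern_connection : is_connection nabla;
  chern_metric : forall X Y Z, vfield X -> vfield Y -> vfield Z -> forall p, M p ->
    mderiv M (fun q => g q (Y q) (Z q)) p (X p) =
      g p (nabla X Y p) (Z p) + g p (Y p) (nabla X Z p);
  chern_complex : forall X Y, vfield X -> vfield Y ->
    eq_on (nabla X (fun q => J q (Y q))) (fun q => J q (nabla X Y q));
  chern_torsion : forall u v, T10_field u -> T10_field v -> forall p, M p ->
    ctorsion nabla u (cconj v) p = (0, 0)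
}.

(* The Chern connection is unique as an operator on vector fields of M. *)
Definition chern : (V -> V) -> (V -> V) -> V -> V :=
  xget (fun _ _ _ => 0) [set nabla | is_chern nabla].

Definition R4 (X Y Z W : V -> V) (p : V) : R := g p (curvature chern X Y Z p) (W p).

(* Complex-multilinear extension. *)
Definition R4c (x y z w : cfield) (p : V) : R[i] :=
  \sum_(a : bool) \sum_(b : bool) \sum_(c : bool) \sum_(d : bool)
    'i%C ^+ (a + b + c + d) *
      (R4 (cpart x a) (cpart y b) (cpart z c) (cpart w d) p)%:C%C.

(* R4c is tensorial, so its value at p on tangent vectors is read off on
   vector fields extending them. *)
Definition griffiths_positive : Prop :=
  forall p u v, M p -> T10_field u -> T10_field v ->
    cval u p != 0 -> cval v p != 0 -> 0 < R4c u (cconj u) v (cconj v) p.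

Definition griffiths_semipositive : Prop :=
  forall p u v, M p -> T10_field u -> T10_field v ->
    cval u p != 0 -> cval v p != 0 -> 0 <= R4c u (cconj u) v (cconj v) p.

(* (1,0)-fields whose values at p form a complex basis of T^{1,0}_pM. *)
Definition T10_frame_at (p : V) (d : nat) (e : 'I_d -> cfield) : Prop :=
  (forall i, T10_field (e i)) /\
  forall w, T10 p w ->
    exists! c : 'rV[R[i]]_d, w = \sum_(i < d) cscale (c 0 i) (cval (e i) p).

Definition dual_nakano_form (p : V) (d : nat) (e : 'I_d -> cfield) (u : 'M[R[i]]_d)
    : R[i] :=
  \sum_(i < d) \sum_(j < d) \sum_(k < d) \sum_(l < d)
    R4c (e i) (cconj (e j)) (e k) (cconj (e l)) p * u i l * (u j k)^*.

Definition dual_nakano_positive : Prop :=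
  forall p d (e : 'I_d -> cfield), M p -> T10_frame_at p e ->
    forall u : 'M[R[i]]_d, u != 0 -> 0 < dual_nakano_form p e u.

Definition dual_nakano_semipositive : Prop :=
  forall p d (e : 'I_d -> cfield), M p -> T10_frame_at p e ->
    forall u : 'M[R[i]]_d, u != 0 -> 0 <= dual_nakano_form p e u.

End AlmostHermitian.

Section SymplecticProjectiveSpace.
Variables (R : realType) (n : nat).
Local Notation C := R[i].
Local Notation Mat := 'M[C]_(n + n).

Definition lie (X Y : Mat) : Mat := X *m Y - Y *m X.

Definition dagger (X : Mat) : Mat := map_mx Num.conj X^T.

Definition Omega : Mat := block_mx 0 1%:M (- 1%:M) 0.

Definition Sp : set Mat :=
  [set a | dagger a *m a = 1%:M /\ a^T *m Omega *m a = Omega].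

(* sp(2n, C), the complexification of sp(n). *)
Definition sp_complex : {vspace Mat} :=
  lker (linfun (fun X : Mat => X^T *m Omega + Omega *m X)).

Definition sp : set Mat := [set X | X \in sp_complex /\ dagger X = - X].

(* Trace of ad X o ad Y on sp(2n, C); on sp(n) it is the Killing form of the
   real Lie algebra sp(n). *)
Definition killing (X Y : Mat) : C :=
  \sum_(i < \dim sp_complex)
    coord (vbasis sp_complex) i (lie X (lie Y (vbasis sp_complex)`_i)).

Definition cartan (x : 'rV[C]_n) : Mat := block_mx (diag_mx x) 0 0 (- diag_mx x).

(* alpha stands for the weight \sum_i alpha_i lambda_i. *)
Definition root_space (alpha : 'rV[int]_n) : set Mat :=
  [set X | X \in sp_complex /\
    forall x, lie (cartan x) X = (\sum_(i < n) (alpha 0 i)%:~R * x 0 i) *: X].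

Definition root_sum (s : seq 'rV[int]_n) : set Mat :=
  [set X | exists Y : 'rV[int]_n -> Mat,
    (forall alpha, alpha \in s -> root_space alpha (Y alpha)) /\
    X = \sum_(alpha <- s) Y alpha].

(* Indices start at 0: lambda 0 is the usual lambda_1. *)
Definition lambda (j : nat) : 'rV[int]_n := \row_i (i == j :> nat)%:R.

Definition roots1_pos : seq 'rV[int]_n :=
  [seq lambda 0 - lambda j | j <- iota 1 n.-1] ++
  [seq lambda 0 + lambda j | j <- iota 1 n.-1].

Definition roots2_pos : seq 'rV[int]_n := [:: lambda 0 *+ 2].

Definition neg_roots (s : seq 'rV[int]_n) := [seq - alpha | alpha <- s].

Definition m1C : set Mat := root_sum (roots1_pos ++ neg_roots roots1_pos).
Definition m2C : set Mat := root_sum (roots2_pos ++ neg_roots roots2_pos).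
Definition m_pos : set Mat := root_sum (roots1_pos ++ roots2_pos).
Definition m_neg : set Mat := root_sum (neg_roots (roots1_pos ++ roots2_pos)).

(* The component in S of an element of S + S' (S and S' independent). *)
Definition component (S S' : set Mat) (X : Mat) : Mat :=
  xget 0 [set Y | S Y /\ S' (X - Y)].

Definition base_proj : Mat :=
  \matrix_(i, j) ((i == 0%N :> nat) && (j == 0%N :> nat))%:R.

(* The stabilizer of base_proj in Sp(n) is Sp(n-1) x U(1); k is its Lie
   algebra. *)
Definition k_alg : set Mat := [set X | sp X /\ lie X base_proj = 0].

Definition m_alg : set Mat := [set X | sp X /\ forall Y, k_alg Y -> killing X Y = 0].

Definition form_m (t : R) (X Y : Mat) : R :=
  - complex.Re (killing (component m1C m2C X) (component m1C m2C Y))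
  - t * complex.Re (killing (component m2C m1C X) (component m2C m1C Y)).

Definition J_m (X : Mat) : Mat :=
  'i%C *: component m_pos m_neg X - 'i%C *: component m_neg m_pos X.

(* Complex matrices as a real normed space: real and imaginary parts. *)
Definition ambient := ('M[R]_(n + n) * 'M[R]_(n + n))%type.

Definition to_complex (x : ambient) : Mat := \matrix_(i, j) (x.1 i j +i* x.2 i j)%C.

Definition of_complex (X : Mat) : ambient :=
  (map_mx (@complex.Re R) X, map_mx (@complex.Im R) X).

(* The orbit Sp(n) . base_proj; Sp(n) is transitive on lines of C^{2n}, so this
   is the set of rank-one orthogonal projections, i.e. CP^{2n-1}. *)
Definition CP : set ambient :=
  [set p | exists2 a, Sp a & to_complex p = a *m base_proj *m invmx a].

Definition translation (p : ambient) : Mat :=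
  xget 1%:M [set a | Sp a /\ to_complex p = a *m base_proj *m invmx a].

(* The tangent vector at a.o obtained by translating by a the vector of T_oM
   corresponding to X in m, namely the velocity at s = 0 of
   a exp(sX) base_proj exp(-sX) a^-1. *)
Definition translate (a X : Mat) : Mat := a *m lie X base_proj *m invmx a.

Definition to_m (p v : ambient) : Mat :=
  xget 0 [set X | m_alg X /\ to_complex v = translate (translation p) X].

(* form_m and J_m are invariant under the isotropy group, so the following do
   not depend on the chosen translation and are Sp(n)-invariant. *)
Definition CP_metric (t : R) (p v w : ambient) : R :=
  form_m t (to_m p v) (to_m p w).

Definition CP_J (p v : ambient) : ambient :=
  of_complex (translate (translation p) (J_m (to_m p v))).

End SymplecticProjectiveSpace.

(* Main.v *)
Require Import Defs.
From HB Require Import structures.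
From mathcomp Require Import all_boot all_order all_algebra.
From mathcomp Require Import all_classical all_reals all_analysis.
From mathcomp.real_closed Require Import complex.
From mathcomp Require Import ring lra.
From Stdlib Require Ncring Ncring_tac.

Set Implicit Arguments.
Unset Strict Implicit.
Unset Printing Implicit Defensive.

Import Order.TTheory GRing.Theory Num.Theory.
Import numFieldNormedType.Exports.
Local Open Scope classical_set_scope.
Local Open Scope ring_scope.

(** The projective space is realised as the set of the projections [P = a E a^*],
    where [a] lies in Sp(n) and [E] is the projection onto the first coordinate line.
    Let [tau X = - Omega X^T Omega]. Then [Q = tau P] is the projection onto the
    quaternionic partner of the line of [P], so that [P Q = Q P = 0], and every
    invariant object is a polynomial in [P], [Q] and tangent vectors.

    Tangent vectors are the Hermitian [V] with [P V + V P = V] ([tangentP]). The complex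
    structure is [J V = i (P V - V P)] ([CP_JE]), and since the Killing form of sp(2n, C)
    is [2 (n + 1) tr (X Y)] ([killingE]) and the pieces of m are cut out by the
    lambda_1-coordinate of the roots, the metric is
    [4 (n + 1) Re (2 tr (V P W) + (t - 2) tr (Q V P W))] ([CP_metricE]).

    The Chern connection is the ordinary derivative plus [gam0 + k gam1], where [gam0]
    gives the Fubini-Study connection, [gam1] is the tensor
    [Q X' Y P + P Y X' Q] with [X' = tau X], and [k = (t - 2) / t] ([nabla0_chern]).
    It is the only one: the difference of two Chern connections is complex bilinear and
    skew with respect to the metric, hence zero ([chern_unique_at]).

    The curvature of this connection is a polynomial of degree 2 in [k]
    ([curv_compress]). Writing [P = e e^*] and replacing a tangent vector [V] by the
    vector [V e] turns it into inner products and symplectic products of vectors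
    ([hform_curvature]). In coordinates [a], [b], [c], [d] of (1,0)-vectors [x], [y], [z],
    [w] at a point, R(x, conj y, z, conj w) is a positive multiple of the form
      [B (U, W) = tr U conj (tr W) + tr (W^* U) + (t - 2) (W^* U)_NN
                  - k tr ((Omega U) conj (Omega W))]
    at [U = a d^*] and [W = b c^*], where N is the index of the partner of the base line
    ([R4c_curv_form]). Griffiths positivity therefore is positivity of [B (U, U)] on
    tensors of rank one, and dual-Nakano positivity is positivity on all tensors whose
    components along the base line vanish ([griffiths_value], [dual_nakano_value]).

    Put [Y = Omega U]. Its row N vanishes because the row 0 of [U] does. The first
    term of [B (U, U)] is [|tr U|^2]. In the sum of the others each entry of the column N
    of [Y] contributes its squared modulus with coefficient [1 + (t - 2) = t - 1], its
    transposed entry being zero, whereas two transposed entries [y], [z] outside that row and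
    column contribute a positive multiple of [(1 + k) |y - z|^2 + (1 - k) |y + z|^2], with
    [1 + k = 2 (t - 1) / t] and [1 - k = 2 / t]. So the form is nonnegative for [t >= 1] and
    positive definite for [t > 1] ([curv_form_ge0], [curv_form_gt0]). Both bounds are sharp,
    already on tensors of rank one: as [n >= 2] there is an index 1 other than 0 and N, and
    [U = e_1 e_N^*] gives [t - 1] ([B_unit]). *)

(** * Polynomial identities between square matrices *)

Section MatrixRing.
Variables (K : pzRingType) (N : nat).
Local Notation M := 'M[K]_N.
(** Square matrices of any size, including 0, form a ring in the sense of the
    normalisation procedure for noncommutative polynomials. *)
#[export] Instance mx_ring_ops : @Ncring.Ring_ops M 0 1%:M (fun x y => x + y)
  (fun x y => x *m y) (fun x y => x - y) (fun x => - x) (@eq M) := {}.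
#[export] Instance mx_ring : @Ncring.Ring _ _ _ _ _ _ _ _ mx_ring_ops.
Proof.
split; try exact: _; try (by move=> x _ <-); try (by move=> x _ <- y _ <-).
- exact: add0r.
- exact: addrC.
- exact: addrA.
- exact: mul1mx.
- exact: mulmx1.
- exact: mulmxA.
- by move=> x y z; exact: mulmxDl.
- by move=> x y z; exact: mulmxDr.
- exact: subrr.
Qed.
End MatrixRing.
Ltac mx_ring := Ncring_tac.non_commutative_ring.

(** * Smooth functions and derivatives along tangent vectors *)

Section Calculus.
Variables (R : realType) (V : normedModType R).
Implicit Types (W : normedModType R) (p u v : V).

Lemma derive_curve W (f : V -> W) (c : R -> V) (s : R) w :
  differentiable f (c s) -> is_derive s 1 c w ->
  is_derive s 1 (f \o c) ('D_w f (c s)).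
Proof.
move=> df dc; have dc1 : differentiable c s.
  by apply/derivable1_diffP; exact: ex_derive.
have dfc : differentiable (f \o c) s by exact: differentiable_comp.
apply: DeriveDef; first exact/derivable1_diffP.
rewrite !deriveE // diff_comp //=; congr ('d f _ _).
by rewrite -deriveE // derive_val.
Qed.

Lemma smooth_diff W (F : V -> W) p : smooth F -> differentiable F p.
Proof. by case/(_ 1%N). Qed.

Lemma smooth_derivable W (F : V -> W) p v : smooth F -> derivable F p v.
Proof. by move=> /smooth_diff dF; exact: diff_derivable. Qed.

Lemma smooth_continuous W (F : V -> W) : smooth F -> continuous F.
Proof. by move/(_ 0%N). Qed.

Lemma smooth_derive W (F : V -> W) v : smooth F -> smooth (fun p => 'D_v F p).
Proof. by move=> sF k; case: (sF k.+1) => _; exact. Qed.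

Lemma smooth_cst W (w : W) : smooth (fun _ : V => w).
Proof.
move=> k; elim: k w => [|k ih] w; first exact: cst_continuous.
split=> [p|v]; first exact: differentiable_cst.
rewrite (_ : (fun p => _) = (fun _ : V => 0 : W)); first exact: (ih 0).
by apply/funext => p; exact: derive_cst.
Qed.

Lemma CkD W k (F G : V -> W) : Ck k F -> Ck k G -> Ck k (fun p => F p + G p).
Proof.
elim: k F G => [|k ih] F G; first by move=> cF cG p; apply: continuousD; [exact: cF|exact: cG].
move=> [dF DF] [dG DG]; split=> [p|v]; first exact: differentiableD.
rewrite (_ : (fun p => _) = (fun p => 'D_v F p + 'D_v G p)).
  exact: (ih _ _ (DF v) (DG v)).
by apply/funext => p; rewrite deriveD //; exact: diff_derivable.
Qed.

Lemma smoothD W (F G : V -> W) : smooth F -> smooth G -> smooth (fun p => F p + G p).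
Proof. by move=> sF sG k; exact: CkD. Qed.

Lemma smooth_sum W (I : Type) (r : seq I) (P : pred I) (F : I -> V -> W) :
  (forall i, smooth (F i)) -> smooth (fun p => \sum_(i <- r | P i) F i p).
Proof.
move=> sF; elim: r => [|a r ih].
  under eq_fun do rewrite big_nil; exact: smooth_cst.
under eq_fun do rewrite big_cons; case: (P a) => //.
exact: smoothD.
Qed.

Lemma derive_linear W W' (L : {linear W -> W'}) (F : V -> W) p v :
  continuous L -> differentiable F p -> 'D_v (L \o F) p = L ('D_v F p).
Proof.
move=> cL dF; have dL : differentiable L (F p) by exact: linear_differentiable.
rewrite !deriveE //; last exact: differentiable_comp.
by rewrite diff_comp //= diff_lin.
Qed.

Lemma smooth_linear W W' (L : {linear W -> W'}) (F : V -> W) :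
  continuous L -> smooth F -> smooth (fun p => L (F p)).
Proof.
move=> cL sF k; elim: k F sF => [|k ih] F sF.
  by move=> p; apply: continuous_comp; [exact: smooth_continuous|exact: cL].
split=> [p|v].
  apply: differentiable_comp; first exact: smooth_diff.
  exact: linear_differentiable.
rewrite (_ : (fun p => _) = (fun p => L ('D_v F p))).
  by apply: ih; exact: smooth_derive.
by apply/funext => p; rewrite -derive_linear //; exact: smooth_diff.
Qed.

Lemma smoothM (F G : V -> R) : smooth F -> smooth G -> smooth (fun p => F p * G p).
Proof.
move=> sF sG k; elim: k F G sF sG => [|k ih] F G sF sG.
  by move=> p; apply: continuousM; exact: smooth_continuous.
split=> [p|v]; first by apply: differentiableM; exact: smooth_diff.
rewrite (_ : (fun p => _) = (fun p => F p * 'D_v G p + G p * 'D_v F p)).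
  by apply: CkD; apply: ih => //; exact: smooth_derive.
by apply/funext => p; rewrite deriveM //; exact: smooth_derivable.
Qed.

Lemma smoothN (F : V -> R) : smooth F -> smooth (fun p => - F p).
Proof.
move=> sF; rewrite (_ : (fun p => _) = (fun p => (-1) * F p)).
  by apply: smoothM => //; exact: smooth_cst.
by apply/funext => p; rewrite mulN1r.
Qed.

Lemma derive_dirD W (F : V -> W) p u v : smooth F ->
  'D_(u + v) F p = 'D_u F p + 'D_v F p.
Proof. by move=> /smooth_diff dF; rewrite !deriveE // linearD. Qed.

Lemma derive_dirZ W (F : V -> W) p a v : smooth F -> 'D_(a *: v) F p = a *: 'D_v F p.
Proof. by move=> /smooth_diff dF; rewrite !deriveE // linearZ. Qed.

Lemma derive_dir_sum W (F : V -> W) p (I : Type) (r : seq I) (a : I -> V) : smooth F ->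
  'D_(\sum_(i <- r) a i) F p = \sum_(i <- r) 'D_(a i) F p.
Proof.
move=> /smooth_diff dF; rewrite deriveE // linear_sum; apply: eq_bigr => i _.
by rewrite deriveE.
Qed.

Lemma is_derive_line (u p : V) (s : R) : is_derive s 1 (fun x : R => x *: u + p) u.
Proof.
have -> : (fun x : R => x *: u + p) = ( *:%R^~ u : R -> V) \+ cst p by [].
have d1 : is_derive s 1 ( *:%R^~ u : R -> V) u.
  apply: DeriveDef; first exact/derivable1_diffP.
  by rewrite deriveE // diff_val /= scale1r.
have := is_deriveD d1 (is_derive_cst p s 1); rewrite addr0; exact.
Qed.

Lemma derive_along (f : V -> R) (u p : V) (s : R) : smooth f ->
  is_derive s 1 (fun x => f (x *: u + p)) ('D_u f (s *: u + p)).
Proof.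
move=> sf.
have := @derive_curve R^o f (fun x => x *: u + p) s u (smooth_diff _ sf) (is_derive_line _ _ _).
exact.
Qed.

(** The mean value theorem in the direction [u], then in the direction [v]. *)
Lemma second_difference (f : V -> R) (u v p : V) (h : R) : smooth f -> 0 < h ->
  exists c d, [/\ c \in `]0, h[, d \in `]0, h[ &
    f (h *: u + (h *: v + p)) - f (h *: u + p) - (f (h *: v + p) - f p) =
    h * h * 'D_v (fun q => 'D_u f q) (d *: v + (c *: u + p))].
Proof.
move=> sf h0; pose g x := f (x *: u + (h *: v + p)) - f (x *: u + p).
have dg (x : R) : is_derive x (1 : R) g ('D_u f (x *: u + (h *: v + p)) - 'D_u f (x *: u + p)).
  by apply: is_deriveB; exact: derive_along.
have cvder (k dk : R -> R) : (forall x : R, is_derive x (1 : R) k (dk x)) -> {within `[0, h], continuous k}.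
  move=> dk1; apply: continuous_subspaceT => x; apply: differentiable_continuous.
  by apply/derivable1_diffP; have := dk1 x => ?; exact: ex_derive.
have [c ch ec] := MVT h0 (fun x _ => dg x) (cvder _ _ dg).
pose k x := 'D_u f (x *: v + (c *: u + p)).
have dk (x : R) : is_derive x (1 : R) k ('D_v (fun q => 'D_u f q) (x *: v + (c *: u + p))).
  by apply: derive_along; exact: smooth_derive.
have [d dh ed] := MVT h0 (fun x _ => dk x) (cvder _ _ dk).
exists c, d; split => //.
have -> : f (h *: u + (h *: v + p)) - f (h *: u + p) - (f (h *: v + p) - f p) = g h - g 0.
  by rewrite /g scale0r !add0r.
rewrite ec subr0.
have -> : c *: u + (h *: v + p) = h *: v + (c *: u + p) by rewrite addrCA.
by move: ed; rewrite /k scale0r add0r subr0 => ->; ring.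
Qed.

Fact sub_sub_swap (a b c d : R) : a - b - (c - d) = a - c - (b - d).
Proof. by ring. Qed.

Fact dist_half (a b c e : R) : `|a - c| < e / 2 -> `|b - c| < e / 2 -> `|a - b| <= e.
Proof.
move=> ac bc; rewrite -(subrKA c) (le_trans (ler_normD _ _)) // [e]splitr lerD //.
  exact: ltW.
by rewrite distrC ltW.
Qed.

(** Schwarz: both mixed derivatives are limits of the same second difference. *)
Lemma schwarz (f : V -> R) (u v p : V) : smooth f ->
  'D_v (fun q => 'D_u f q) p = 'D_u (fun q => 'D_v f q) p.
Proof.
move=> sf; apply/eqP; rewrite -subr_eq0 -normr_le0; apply/ler_addgt0Pl => e e0.
rewrite addr0.
have close a b : exists2 r, 0 < r & forall c d, `|c| < r -> `|d| < r ->
   `|'D_a (fun q => 'D_b f q) p - 'D_a (fun q => 'D_b f q) (d *: a + (c *: b + p))| < e / 2.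
  have cf : {for p, continuous (fun q => 'D_a (fun q => 'D_b f q) q)}.
    by apply: smooth_continuous; do 2 apply: smooth_derive.
  have /cvgrPdist_lt/(_ (e / 2)) := cf.
  move=> /(_ ltac:(by rewrite divr_gt0))/nbhs_ballP[r /= r0 rP].
  have n0 : 0 < `|a| + `|b| + 1 by rewrite ltr_wpDl ?addr_ge0.
  exists (r / (`|a| + `|b| + 1)); first by rewrite divr_gt0.
  move=> c d cr dr; apply: rP; rewrite -ball_normE /ball_ /=.
  rewrite !addrA [_ + p]addrC opprD addrA subrr sub0r normrN.
  rewrite (le_lt_trans (ler_normD _ _))// !normrZ.
  apply: (@le_lt_trans _ _ (r / (`|a| + `|b| + 1) * (`|a| + `|b|))).
    by rewrite mulrDr lerD // ler_wpM2r // ltW.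
  by rewrite mulrAC ltr_pdivrMr // ltr_pM2l // ltrDl.
have [r1 r10 h1] := close v u; have [r2 r20 h2] := close u v.
pose h := Num.min r1 r2 / 2.
have m0 : 0 < Num.min r1 r2 by rewrite lt_min r10.
have h0 : 0 < h by rewrite divr_gt0.
have hm : h < Num.min r1 r2 by rewrite /h ltr_pdivrMr // ltr_pMr // ltr1n.
have [c [d [ch dh e1]]] := second_difference u v p sf h0.
have [c' [d' [ch' dh' e2]]] := second_difference v u p sf h0.
have bnd x : x \in `]0, h[ -> `|x| < r1 /\ `|x| < r2.
  rewrite in_itv /= => /andP[x0 xh]; rewrite gtr0_norm //.
  by move: hm; rewrite lt_min => /andP[a b]; split; apply: lt_trans a || apply: lt_trans b.
have E : 'D_v (fun q => 'D_u f q) (d *: v + (c *: u + p)) =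
         'D_u (fun q => 'D_v f q) (d' *: u + (c' *: v + p)).
  have hh : h * h != 0 by rewrite mulf_neq0 // gt_eqF.
  apply: (mulfI hh); rewrite -e1 -e2 [h *: u + (h *: v + p)]addrCA.
  exact: sub_sub_swap.
have k1 := h1 c d (bnd c ch).1 (bnd d dh).1; rewrite E in k1.
have k2 := h2 c' d' (bnd c' ch').2 (bnd d' dh').2.
move: k1 k2; exact: dist_half.
Qed.

Section Submanifold.
Variable M : set V.

(** A curve representing the tangent vector stays in [M], where [F] vanishes. *)
Lemma tangent_derive0 W (F : V -> W) p v : (forall q, M q -> F q = 0) ->
  smooth F -> tangent M p v -> 'D_v F p = 0.
Proof.
move=> F0 sF [c [<- dc Mc]].
have [_ <-] := derive_curve (smooth_diff (c 0) sF) dc.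
rewrite -(@derive_cst R _ _ 0 (0 : R) 1); apply: near_eq_derive.
by near=> s; rewrite /= F0 //; near: s.
Unshelve. all: by end_near. Qed.

(** The derivative along a tangent vector sees only the values on [M]: two
    extensions have the same composite with a curve in [M]. *)
Lemma mderivE W (f F : V -> W) p v : is_smooth_extension M f F -> tangent M p v ->
  mderiv M f p v = 'D_v F p.
Proof.
move=> [sF Ff] tv; rewrite /mderiv.
set G := xget _ _.
have [sG Gf] : is_smooth_extension M f G by apply: (@xgetPex _ _ _); exists F.
case: tv => c [<- dc Mc].
have [_ <-] := derive_curve (smooth_diff (c 0) sF) dc.
have [_ <-] := derive_curve (smooth_diff (c 0) sG) dc.
apply: near_eq_derive.
by near=> s; rewrite /= Ff ?Gf //; near: s.
Unshelve. all: by end_near. Qed.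

End Submanifold.
End Calculus.

(** * Complex matrices as functions of a point *)

Section ComplexCalculus.
Variables (R : realType) (V : normedModType R).
Local Notation C := R[i].
Implicit Types (f g : V -> C) (p v : V).

Lemma smooth_scalel (W : normedModType R) (f : V -> R) (w : W) :
  smooth f -> smooth (fun p => f p *: w).
Proof.
move=> sf k; elim: k f sf => [|k ih] f sf.
  by move=> p; apply: differentiable_continuous; apply: differentiableZl; exact: smooth_diff.
split=> [p|v]; first by apply: differentiableZl; exact: smooth_diff.
rewrite (_ : (fun p => _) = (fun p => 'D_v f p *: w)).
  by apply: ih; exact: smooth_derive.
apply/funext => p; rewrite !deriveE ?diffZl //; try exact: smooth_diff.
by apply: differentiableZl; exact: smooth_diff.
Qed.

Definition csmooth f := smooth (fun p => complex.Re (f p)) /\ smooth (fun p => complex.Im (f p)).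

Definition cderive f p v : C :=
  ('D_v (fun q => complex.Re (f q)) p +i* 'D_v (fun q => complex.Im (f q)) p)%C.

Lemma ReM (x y : C) : complex.Re (x * y) =
  complex.Re x * complex.Re y - complex.Im x * complex.Im y.
Proof. by case: x y => [a b] [c d]. Qed.

Lemma ImM (x y : C) : complex.Im (x * y) =
  complex.Re x * complex.Im y + complex.Im x * complex.Re y.
Proof. by case: x y => [a b] [c d]. Qed.

Lemma ReD (x y : C) : complex.Re (x + y) = complex.Re x + complex.Re y.
Proof. by case: x y => [a b] [c d]. Qed.

Lemma ImD (x y : C) : complex.Im (x + y) = complex.Im x + complex.Im y.
Proof. by case: x y => [a b] [c d]. Qed.

Lemma ReJ (x : C) : complex.Re x^* = complex.Re x.
Proof. by case: x. Qed.

Lemma ImJ (x : C) : complex.Im x^* = - complex.Im x.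
Proof. by case: x. Qed.

Lemma csmooth_cst c : csmooth (fun=> c).
Proof. by split; exact: smooth_cst. Qed.

Lemma csmoothD f g : csmooth f -> csmooth g -> csmooth (fun p => f p + g p).
Proof.
move=> [rf jf] [rg jg]; split.
  by under eq_fun do rewrite ReD; exact: smoothD.
by under eq_fun do rewrite ImD; exact: smoothD.
Qed.

Lemma csmoothM f g : csmooth f -> csmooth g -> csmooth (fun p => f p * g p).
Proof.
move=> [rf jf] [rg jg]; split.
  under eq_fun do rewrite ReM.
  by apply: smoothD; [exact: smoothM|apply: smoothN; exact: smoothM].
by under eq_fun do rewrite ImM; apply: smoothD; exact: smoothM.
Qed.

Lemma csmoothJ f : csmooth f -> csmooth (fun p => (f p)^*).
Proof.
move=> [rf jf]; split; first by under eq_fun do rewrite ReJ.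
by under eq_fun do rewrite ImJ; exact: smoothN.
Qed.

Lemma csmooth_sum (I : Type) (r : seq I) (F : I -> V -> C) :
  (forall i, csmooth (F i)) -> csmooth (fun p => \sum_(i <- r) F i p).
Proof.
move=> sF; elim: r => [|a r ih].
  by under eq_fun do rewrite big_nil; exact: csmooth_cst.
by under eq_fun do rewrite big_cons; exact: csmoothD.
Qed.

Lemma cderive_cst c p v : cderive (fun=> c) p v = 0.
Proof. by rewrite /cderive !derive_cst. Qed.

Lemma cderiveD f g p v : csmooth f -> csmooth g ->
  cderive (fun p => f p + g p) p v = cderive f p v + cderive g p v.
Proof.
move=> [rf jf] [rg jg]; rewrite /cderive.
under eq_fun do rewrite ReD; under [in X in (_ +i* X)%C]eq_fun do rewrite ImD.
by rewrite !deriveD //; exact: smooth_derivable.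
Qed.

Lemma cderiveM f g p v : csmooth f -> csmooth g ->
  cderive (fun p => f p * g p) p v = cderive f p v * g p + f p * cderive g p v.
Proof.
move=> [rf jf] [rg jg]; rewrite /cderive.
under eq_fun do rewrite ReM; under [in X in (_ +i* X)%C]eq_fun do rewrite ImM.
have d (h : V -> R) : smooth h -> derivable h p v by exact: smooth_derivable.
have dM (h k : V -> R) : smooth h -> smooth k ->
   'D_v (fun q => h q * k q) p = 'D_v h p * k p + h p * 'D_v k p.
  by move=> sh sk; rewrite (deriveM (d _ sh) (d _ sk)) /GRing.scale /= addrC mulrC.
have dB (h k : V -> R) : smooth h -> smooth k ->
   'D_v (fun q => h q - k q) p = 'D_v h p - 'D_v k p.
  by move=> sh sk; rewrite (deriveB (d _ sh) (d _ sk)).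
have dD (h k : V -> R) : smooth h -> smooth k ->
   'D_v (fun q => h q + k q) p = 'D_v h p + 'D_v k p.
  by move=> sh sk; rewrite (deriveD (d _ sh) (d _ sk)).
rewrite dB ?dD ?dM //; try exact: smoothM.
apply/eqP; rewrite eq_complex ReD ImD !ReM !ImM /=; apply/andP; split; apply/eqP; ring.
Qed.

Lemma cderiveJ f p v : csmooth f -> cderive (fun p => (f p)^*) p v = (cderive f p v)^*.
Proof.
move=> [rf jf]; rewrite /cderive.
under eq_fun do rewrite ReJ; under [in X in (_ +i* X)%C]eq_fun do rewrite ImJ.
by rewrite (deriveN (@smooth_derivable _ _ _ _ p v jf)).
Qed.

Lemma cderive_sum (I : Type) (r : seq I) (F : I -> V -> C) p v :
  (forall i, csmooth (F i)) ->
  cderive (fun p => \sum_(i <- r) F i p) p v = \sum_(i <- r) cderive (F i) p v.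
Proof.
move=> sF; elim: r => [|a r ih].
  by under eq_fun do rewrite big_nil; rewrite cderive_cst big_nil.
under eq_fun do rewrite big_cons.
by rewrite cderiveD ?big_cons ?ih //; exact: csmooth_sum.
Qed.

Section Matrix.
Variables (m k : nat).
Implicit Types F G : V -> 'M[C]_(m, k).

Definition msmooth F := forall i j, csmooth (fun p => F p i j).

Definition mder F p v : 'M[C]_(m, k) := \matrix_(i, j) cderive (fun q => F q i j) p v.

Lemma msmooth_cst A : msmooth (fun=> A).
Proof. by move=> i j; exact: csmooth_cst. Qed.

Lemma mder_cst A p v : mder (fun=> A) p v = 0.
Proof. by apply/matrixP => i j; rewrite !mxE cderive_cst. Qed.

Lemma msmoothD F G : msmooth F -> msmooth G -> msmooth (fun p => F p + G p).
Proof.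
by move=> sF sG i j; under eq_fun do rewrite mxE; exact: csmoothD.
Qed.

Lemma mderD F G p v : msmooth F -> msmooth G ->
  mder (fun p => F p + G p) p v = mder F p v + mder G p v.
Proof.
move=> sF sG; apply/matrixP => i j; rewrite !mxE.
by under eq_fun do rewrite mxE; exact: cderiveD.
Qed.

Lemma msmoothZ (a : C) F : msmooth F -> msmooth (fun p => a *: F p).
Proof.
move=> sF i j; under eq_fun do rewrite mxE; apply: csmoothM => //.
exact: csmooth_cst.
Qed.

Lemma mderZ (a : C) F p v : msmooth F -> mder (fun p => a *: F p) p v = a *: mder F p v.
Proof.
move=> sF; apply/matrixP => i j; rewrite !mxE.
under eq_fun do rewrite mxE; rewrite cderiveM ?cderive_cst ?mul0r ?add0r //.
exact: csmooth_cst.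
Qed.

Lemma msmoothN F : msmooth F -> msmooth (fun p => - F p).
Proof. by under eq_fun do rewrite -scaleN1r; exact: msmoothZ. Qed.

Lemma mderN F p v : msmooth F -> mder (fun p => - F p) p v = - mder F p v.
Proof. by under eq_fun do rewrite -scaleN1r; rewrite -[RHS]scaleN1r; exact: mderZ. Qed.

Lemma msmoothJ F : msmooth F -> msmooth (fun p => map_mx Num.conj (F p)).
Proof. by move=> sF i j; under eq_fun do rewrite mxE; exact: csmoothJ. Qed.

Lemma mderJ F p v : msmooth F ->
  mder (fun p => map_mx Num.conj (F p)) p v = map_mx Num.conj (mder F p v).
Proof.
move=> sF; apply/matrixP => i j; rewrite !mxE.
by under eq_fun do rewrite mxE; exact: cderiveJ.
Qed.

End Matrix.

Lemma msmoothT m k (F : V -> 'M[C]_(m, k)) : msmooth F -> msmooth (fun p => (F p)^T).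
Proof. by move=> sF i j; under eq_fun do rewrite mxE. Qed.

Lemma mderT m k (F : V -> 'M[C]_(m, k)) p v : mder (fun p => (F p)^T) p v = (mder F p v)^T.
Proof.
apply/matrixP => i j; rewrite !mxE; congr cderive.
by apply/funext => q; rewrite mxE.
Qed.

Lemma msmoothM m k l (F : V -> 'M[C]_(m, k)) (G : V -> 'M[C]_(k, l)) :
  msmooth F -> msmooth G -> msmooth (fun p => F p *m G p).
Proof.
move=> sF sG i j; under eq_fun do rewrite mxE.
by apply: csmooth_sum => h; exact: csmoothM.
Qed.

Lemma mderM m k l (F : V -> 'M[C]_(m, k)) (G : V -> 'M[C]_(k, l)) p v :
  msmooth F -> msmooth G ->
  mder (fun p => F p *m G p) p v = mder F p v *m G p + F p *m mder G p v.
Proof.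
move=> sF sG; apply/matrixP => i j; rewrite !mxE.
under eq_fun do rewrite mxE.
rewrite cderive_sum; last by move=> h; exact: csmoothM.
by rewrite -big_split /=; apply: eq_bigr => h _; rewrite cderiveM // !mxE.
Qed.

Lemma csmooth_trace m (F : V -> 'M[C]_m) : msmooth F -> csmooth (fun p => \tr (F p)).
Proof. by move=> sF; apply: csmooth_sum => i; exact: sF. Qed.

Lemma cderive_trace m (F : V -> 'M[C]_m) p v : msmooth F ->
  cderive (fun p => \tr (F p)) p v = \tr (mder F p v).
Proof.
move=> sF; rewrite /mxtrace cderive_sum; last by move=> i; exact: sF.
by apply: eq_bigr => i _; rewrite mxE.
Qed.

End ComplexCalculus.

Section Ambient.
Variables (R : realType) (n : nat).
Local Notation C := R[i].
Local Notation A := (ambient R n).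
Local Notation Mat := 'M[C]_(n + n).

Lemma of_complexK : cancel (@of_complex R n) (@to_complex R n).
Proof. by move=> X; apply/matrixP => i j; rewrite !mxE /=; case: (X i j). Qed.

Lemma to_complexK : cancel (@to_complex R n) (@of_complex R n).
Proof. by move=> [x y]; congr pair; apply/matrixP => i j; rewrite !mxE. Qed.

Lemma to_complexD (x y : A) : to_complex (x + y) = to_complex x + to_complex y.
Proof. by apply/matrixP => i j; rewrite !mxE. Qed.

Lemma to_complexN (x : A) : to_complex (- x) = - to_complex x.
Proof. by apply/matrixP => i j; rewrite !mxE. Qed.

Lemma to_complexB (x y : A) : to_complex (x - y) = to_complex x - to_complex y.
Proof. by rewrite to_complexD to_complexN. Qed.

Lemma to_complex0 : to_complex (0 : A) = 0.
Proof. by apply/matrixP => i j; rewrite !mxE. Qed.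

Lemma to_complexZ (a : R) (x : A) : to_complex (a *: x) = (a%:C)%C *: to_complex x.
Proof.
by apply/matrixP => i j; rewrite !mxE; apply/eqP;
   rewrite eq_complex /= !mul0r subr0 addr0 !eqxx.
Qed.

Lemma to_complex_sum (I : Type) (r : seq I) (x : I -> A) :
  to_complex (\sum_(i <- r) x i) = \sum_(i <- r) to_complex (x i).
Proof.
by elim: r => [|a r ih]; rewrite ?big_nil ?to_complex0 // !big_cons to_complexD ih.
Qed.

Definition re_coord (i j : 'I_(n + n)) (x : A) : R := x.1 i j.
Definition im_coord (i j : 'I_(n + n)) (x : A) : R := x.2 i j.

Lemma re_coord_linear i j : linear (re_coord i j).
Proof. by move=> a x y; rewrite /re_coord !mxE. Qed.
Lemma im_coord_linear i j : linear (im_coord i j).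
Proof. by move=> a x y; rewrite /im_coord !mxE. Qed.
HB.instance Definition _ i j :=
  GRing.isLinear.Build R A R *%R (re_coord i j) (re_coord_linear i j).
HB.instance Definition _ i j :=
  GRing.isLinear.Build R A R *%R (im_coord i j) (im_coord_linear i j).

Lemma re_coord_continuous i j : continuous (re_coord i j).
Proof.
by move=> x; apply: (@continuous_comp _ _ _ fst (fun M : 'M[R]_(n + n) => M i j));
  [exact: cvg_fst|exact: coord_continuous].
Qed.

Lemma im_coord_continuous i j : continuous (im_coord i j).
Proof.
by move=> x; apply: (@continuous_comp _ _ _ snd (fun M : 'M[R]_(n + n) => M i j));
  [exact: cvg_snd|exact: coord_continuous].
Qed.

Lemma ambient_sum (x : A) : x =
  \sum_i \sum_j (re_coord i j x *: ((delta_mx i j, 0) : A)) +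
  \sum_i \sum_j (im_coord i j x *: ((0, delta_mx i j) : A)).
Proof.
apply: (can_inj to_complexK); rewrite to_complexD !to_complex_sum.
under eq_bigr do rewrite to_complex_sum.
under [X in _ + X]eq_bigr do rewrite to_complex_sum.
apply/matrixP => a b; rewrite !mxE !summxE.
have E (y : 'I_(n + n) -> 'I_(n + n) -> C) (f : 'I_(n + n) -> 'I_(n + n) -> Mat) (z : C) :
   (forall i j, f i j a b = y i j *+ ((i == a) && (j == b))) -> y a b = z ->
   \sum_i (\sum_j f i j) a b = z.
  move=> fE <-; rewrite (bigD1 a) //= summxE (bigD1 b) //= fE !eqxx big1 ?big1 ?addr0 //.
    by move=> i /negPf ia; rewrite summxE big1 // => j _; rewrite fE ia mulr0n.
  by move=> i /negPf ia; rewrite fE ia andbF mulr0n.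
rewrite (E (fun i j => (x.1 i j)%:C%C) _ (x.1 a b)%:C%C) //; last first.
  move=> i j; rewrite to_complexZ !mxE /= eq_sym [b == j]eq_sym.
  by case: andP => _; rewrite ?mulr1n ?mulr0n ?mulr1 ?mulr0.
rewrite (E (fun i j => ('i * (x.2 i j)%:C)%C) _ ('i * (x.2 a b)%:C)%C) //; last first.
  move=> i j; rewrite to_complexZ !mxE /= eq_sym [b == j]eq_sym.
  by case: andP => _; rewrite ?mulr1n ?mulr0n ?mulr0 // mulrC.
exact: complexE.
Qed.

Section Fields.
Variable (V : normedModType R).
Implicit Types (Y : V -> A).

Lemma smooth_to_complex Y : smooth Y -> msmooth (fun p => to_complex (Y p)).
Proof.
move=> sY i j; split.
  under eq_fun do rewrite mxE /=.
  exact: (@smooth_linear _ _ _ _ (re_coord i j) _ (@re_coord_continuous i j) sY).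
under eq_fun do rewrite mxE /=.
exact: (@smooth_linear _ _ _ _ (im_coord i j) _ (@im_coord_continuous i j) sY).
Qed.

Lemma to_complex_smooth Y : msmooth (fun p => to_complex (Y p)) -> smooth Y.
Proof.
move=> sY; rewrite (_ : Y = (fun p =>
  \sum_i \sum_j (re_coord i j (Y p) *: ((delta_mx i j, 0) : A)) +
  \sum_i \sum_j (im_coord i j (Y p) *: ((0, delta_mx i j) : A)))); last first.
  by apply/funext => p; exact: ambient_sum.
apply: smoothD; apply: smooth_sum => i; apply: smooth_sum => j;
  apply: smooth_scalel; have [sr si] := sY i j.
  by move: sr; under eq_fun do rewrite mxE /=.
by move: si; under eq_fun do rewrite mxE /=.
Qed.

Lemma smooth_of_complex (F : V -> Mat) : msmooth F -> smooth (fun p => of_complex (F p)).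
Proof.
by move=> sF; apply: to_complex_smooth; under eq_fun do rewrite of_complexK.
Qed.

Lemma mder_to_complex Y p v : smooth Y ->
  mder (fun p => to_complex (Y p)) p v = to_complex ('D_v Y p).
Proof.
move=> sY; apply/matrixP => i j; rewrite !mxE /cderive; congr (_ +i* _)%C.
  under eq_fun do rewrite mxE /=.
  exact: (derive_linear v (@re_coord_continuous i j) (smooth_diff p sY)).
under eq_fun do rewrite mxE /=.
exact: (derive_linear v (@im_coord_continuous i j) (smooth_diff p sY)).
Qed.

End Fields.
End Ambient.

(** * The symplectic anti-involution and the Killing form *)

Section Adjoint.
Variable (R : realType).
Local Notation C := R[i].

Definition adj m k (A : 'M[C]_(m, k)) : 'M[C]_(k, m) := map_mx Num.conj A^T.

Lemma adjK m k (A : 'M[C]_(m, k)) : adj (adj A) = A.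
Proof. by apply/matrixP => i j; rewrite !mxE conjCK. Qed.

Lemma adjM m k l (A : 'M[C]_(m, k)) (B : 'M[C]_(k, l)) : adj (A *m B) = adj B *m adj A.
Proof. by rewrite /adj trmx_mul map_mxM. Qed.

Lemma adjD m k (A B : 'M[C]_(m, k)) : adj (A + B) = adj A + adj B.
Proof. by rewrite /adj linearD /= map_mxD. Qed.

Lemma adjN m k (A : 'M[C]_(m, k)) : adj (- A) = - adj A.
Proof. by rewrite /adj linearN /= map_mxN. Qed.

Lemma adjB m k (A B : 'M[C]_(m, k)) : adj (A - B) = adj A - adj B.
Proof. by rewrite adjD adjN. Qed.

Lemma adjZ m k (c : C) (A : 'M[C]_(m, k)) : adj (c *: A) = c^* *: adj A.
Proof. by rewrite /adj linearZ /= map_mxZ. Qed.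

Lemma adj1 k : adj (1%:M : 'M[C]_k) = 1%:M.
Proof. by rewrite /adj trmx1 map_mx1. Qed.

Lemma adj0 m k : adj (0 : 'M[C]_(m, k)) = 0.
Proof. by rewrite /adj trmx0 map_mx0. Qed.

Lemma tr_adj k (A : 'M[C]_k) : \tr (adj A) = (\tr A)^*.
Proof. by rewrite /adj -map_trmx mxtrace_tr /mxtrace rmorph_sum; apply: eq_bigr => i _; rewrite mxE. Qed.

Lemma adj_sum_eq0 m k (A : 'M[C]_(m, k)) : \tr (adj A *m A) = 0 -> A = 0.
Proof.
rewrite /mxtrace => tr0; apply/matrixP => i j; rewrite mxE.
have pos a b : 0 <= (A b a)^* * A b a by rewrite mulrC -normCK exprn_ge0.
have diag a : (adj A *m A) a a = \sum_b (A b a)^* * A b a.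
  by rewrite mxE; apply: eq_bigr => b _; rewrite !mxE.
have /eqP := tr0; rewrite psumr_eq0; last first.
  by move=> a _; rewrite diag sumr_ge0.
move=> /allP/(_ j (mem_index_enum _))/=; rewrite diag psumr_eq0 //.
move=> /allP/(_ i (mem_index_enum _))/=.
by rewrite mulrC -normCK expf_eq0 normr_eq0 /= => /eqP.
Qed.

End Adjoint.

Section Symplectic.
Variables (R : realType) (n : nat).
Local Notation C := R[i].
Local Notation N := (n + n)%N.
Local Notation Mat := 'M[C]_(n + n).
Local Notation Om := (Omega R n).
Implicit Types X Y Z : Mat.

Lemma Omega2 : Om *m Om = - 1%:M.
Proof.
rewrite /Omega mulmx_block !mul0mx !mulmx0 !mul1mx !mulmx1 !add0r !addr0.
by rewrite [1%:M in RHS](@scalar_mx_block _ n n) opp_block_mx !oppr0.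
Qed.

Lemma trOmega : Om^T = - Om.
Proof. by rewrite /Omega tr_block_mx opp_block_mx !trmx0 !oppr0 linearN /= trmx1 opprK. Qed.

Lemma conjOmega : map_mx Num.conj Om = Om.
Proof. by rewrite /Omega map_block_mx !map_mx0 map_mxN map_mx1. Qed.

Lemma adjOmega : adj Om = - Om.
Proof. by rewrite /adj trOmega map_mxN conjOmega. Qed.

#[local] Opaque Omega.

(** [tau] is the anti-involution whose [-1]-eigenspace is sp(2n, C); on
    projections of the orbit it is the passage to the quaternionic partner. *)
Fact tau_key : unit. Proof. exact: tt. Qed.
Definition tau := locked_with tau_key (fun X : Mat => - (Om *m X^T *m Om)).
Lemma tauE X : tau X = - (Om *m X^T *m Om). Proof. by rewrite /tau unlock. Qed.

Lemma tauD X Y : tau (X + Y) = tau X + tau Y.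
Proof. by rewrite !tauE linearD /= mulmxDr mulmxDl opprD. Qed.

Lemma tauN X : tau (- X) = - tau X.
Proof. by rewrite !tauE linearN /= mulmxN mulNmx. Qed.

Lemma tauB X Y : tau (X - Y) = tau X - tau Y.
Proof. by rewrite tauD tauN. Qed.

Lemma tauZ c X : tau (c *: X) = c *: tau X.
Proof. by rewrite !tauE linearZ /= -scalemxAr -scalemxAl scalerN. Qed.

Lemma tau1 : tau 1%:M = 1%:M.
Proof. by rewrite !tauE trmx1 mulmx1 Omega2 opprK. Qed.

Lemma tauM X Y : tau (X *m Y) = tau Y *m tau X.
Proof.
have E A B : - (Om *m A *m Om) *m - (Om *m B *m Om) = Om *m A *m (Om *m Om) *m B *m Om.
  by rewrite mulNmx mulmxN opprK !mulmxA.
rewrite !tauE trmx_mul E Omega2 mulmxN mulmx1 !mulNmx -!mulmxA.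
by [].
Qed.

Lemma tauK X : tau (tau X) = X.
Proof.
have E : (Om *m X^T *m Om)^T = Om *m X *m Om.
  by rewrite !trmx_mul trmxK trOmega mulmxN !mulNmx mulmxN opprK mulmxA.
rewrite !tauE linearN /= E mulmxN mulNmx opprK !mulmxA Omega2.
by rewrite !mulNmx mul1mx -mulmxA Omega2 mulmxN mulmx1 opprK.
Qed.

Lemma tau_adj X : tau (adj X) = adj (tau X).
Proof.
have E : adj X^T = (adj X)^T by rewrite /adj map_trmx.
by rewrite !tauE adjN !adjM adjOmega E !mulNmx !mulmxN !opprK mulmxA.
Qed.

Lemma tr_tau X : \tr (tau X) = \tr X.
Proof. by rewrite !tauE linearN /= mxtrace_mulC mulmxA Omega2 mulNmx mul1mx linearN opprK /= mxtrace_tr. Qed.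

Let sp_eqn X : Mat := X^T *m Om + Om *m X.
Let sp_eqn_linear : linear sp_eqn.
Proof.
by move=> c X Y; rewrite /sp_eqn linearP /= mulmxDl mulmxDr -scalemxAl -scalemxAr scalerDr addrACA.
Qed.
HB.instance Definition _ := GRing.isLinear.Build C Mat Mat *:%R sp_eqn sp_eqn_linear.

Lemma sp_complexE X : (X \in sp_complex R n) = (tau X == - X).
Proof.
rewrite /sp_complex memv_ker (lfunE sp_eqn) /= /sp_eqn !tauE.
apply/eqP/eqP => [e|/oppr_inj e].
  have : Om *m (X^T *m Om + Om *m X) = 0 by rewrite e mulmx0.
  rewrite mulmxDr !mulmxA Omega2 mulNmx mul1mx => /eqP.
  by rewrite subr_eq0 => /eqP ->.
by rewrite -{2}e !mulmxA Omega2 mulNmx mul1mx mulNmx subrr.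
Qed.

Lemma spP X : X \in sp_complex R n <-> tau X = - X.
Proof. by rewrite sp_complexE; split => /eqP. Qed.

Lemma sp_lie X Y : tau X = - X -> tau Y = - Y -> tau (lie X Y) = - lie X Y.
Proof.
move=> hX hY; rewrite /lie tauB !tauM hX hY !mulmxN !mulNmx !opprK opprB.
by [].
Qed.

(** A trace over a subspace is the trace over the whole space of the
    composite with a projection onto it, which frees it from the basis. *)
Lemma subspace_trace (m k : nat) (U : {vspace 'M[C]_(m, k)})
    (f pr : {linear 'M[C]_(m, k) -> 'M[C]_(m, k)}) :
  (forall A, pr A \in U) -> {in U, forall A, pr A = A} -> {in U, forall A, f A \in U} ->
  \sum_(i < \dim U) coord (vbasis U) i (f (vbasis U)`_i) =
  \sum_a \sum_b f (pr (delta_mx a b)) a b.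
Proof.
move=> prU prid fU.
have bU i : (vbasis U)`_i \in U.
  have [iU|Ui] := ltnP i (size (vbasis U)); first exact: (vbasis_mem (mem_nth 0 iU)).
  by rewrite nth_default ?mem0v.
have expand A : A \in U -> A = \sum_(i < \dim U) coord (vbasis U) i A *: (vbasis U)`_i.
  by move=> AU; exact: coord_vbasis.
transitivity (\sum_(i < \dim U) \sum_a \sum_b
    (f (vbasis U)`_i) a b * coord (vbasis U) i (pr (delta_mx a b))).
  apply: eq_bigr => i _; rewrite -[in LHS](prid _ (fU _ (bU i))).
  rewrite [f _ in LHS]matrix_sum_delta linear_sum linear_sum; apply: eq_bigr => a _.
  by rewrite !linear_sum; apply: eq_bigr => b _; rewrite !linearZ.
rewrite exchange_big; apply: eq_bigr => a _ /=; rewrite exchange_big.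
apply: eq_bigr => b _ /=; rewrite [in RHS](expand _ (prU _)) linear_sum summxE.
by apply: eq_bigr => i _; rewrite linearZ mxE mulrC.
Qed.

Lemma sum_delta_entry (A B : Mat) :
  \sum_a \sum_b (A *m delta_mx a b *m B) a b = \tr A * \tr B.
Proof.
rewrite /mxtrace mulr_suml; apply: eq_bigr => a _; rewrite mulr_sumr.
apply: eq_bigr => b _; rewrite mxE (bigD1 b) //= big1 ?addr0 => [|c cb].
  by rewrite mxE (bigD1 a) //= big1 ?addr0 ?mxE ?eqxx ?mulr1 // => c /negPf ca; rewrite mxE ca mulr0.
rewrite mxE big1 ?mul0r // => d _; rewrite mxE (negPf cb) andbF mulr0 //.
Qed.

Lemma sum_delta_entryT (A B : Mat) :
  \sum_a \sum_b (A *m (delta_mx a b)^T *m B) a b = \tr (A *m B^T).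
Proof.
rewrite /mxtrace; apply: eq_bigr => a _; rewrite mxE; apply: eq_bigr => b _.
rewrite mxE (bigD1 a) //= big1 ?addr0 => [|c ca].
  rewrite mxE (bigD1 b) //= big1 ?addr0 ?mxE ?eqxx ?mulr1 // => c /negPf cb.
  by rewrite !mxE cb andbF mulr0.
by rewrite mxE big1 ?mul0r // => d _; rewrite !mxE (negPf ca) /= mulr0.
Qed.

Definition sp_proj X : Mat := 2^-1 *: (X - tau X).
Lemma sp_proj_linear : linear sp_proj.
Proof.
move=> c X Y; rewrite /sp_proj tauD tauZ opprD addrACA -scalerBr scalerDr.
by rewrite scalerA mulrC -scalerA.
Qed.
HB.instance Definition _ := GRing.isLinear.Build C Mat Mat *:%R sp_proj sp_proj_linear.

Lemma lie_linear X : linear (lie X).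
Proof.
by move=> c Y Z; rewrite /lie mulmxDr mulmxDl -scalemxAr -scalemxAl scalerBr opprD addrACA.
Qed.
HB.instance Definition _ X := GRing.isLinear.Build C Mat Mat *:%R (lie X) (lie_linear X).

Lemma tr_sp X : tau X = - X -> \tr X = 0.
Proof.
move=> hX; have := tr_tau X; rewrite hX linearN /= => /eqP.
by rewrite eq_sym -addr_eq0 -mulr2n mulrn_eq0 /= => /eqP.
Qed.

(** With the projection [X |-> (X - tau X) / 2] onto sp(2n, C), the map [ad X \o ad Y]
    becomes a sum of eight maps of the form [Z |-> A Z B] or [Z |-> A Z^T B], whose
    traces are explicit; products of traces vanish since sp(2n, C) is traceless. *)
Lemma killingE X Y : tau X = - X -> tau Y = - Y ->
  killing X Y = (n.+1.*2)%:R * \tr (X *m Y).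
Proof.
move=> hX hY; rewrite /killing.
rewrite (@subspace_trace _ _ _ (lie X \o lie Y) sp_proj) /=.
- have expand D : lie X (lie Y (sp_proj D)) = 2^-1 *:
      ((X *m Y *m D *m 1%:M - X *m D *m Y - Y *m D *m X + 1%:M *m D *m (Y *m X)) +
       (X *m Y *m Om *m D^T *m Om - X *m Om *m D^T *m (Om *m Y)
        - Y *m Om *m D^T *m (Om *m X) + Om *m D^T *m (Om *m Y *m X))).
    rewrite /sp_proj !linearZ /=; congr (_ *: _).
    rewrite !tauE opprK /lie !mulmx1 !mul1mx.
    mx_ring.
  under eq_bigr do under eq_bigr do rewrite expand mxE.
  under eq_bigr do rewrite -mulr_sumr.
  rewrite -mulr_sumr.
  have lin8 (f1 f2 f3 f4 f5 f6 f7 f8 : 'I_N -> 'I_N -> Mat) :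
    \sum_a \sum_b (f1 a b - f2 a b - f3 a b + f4 a b +
                    (f5 a b - f6 a b - f7 a b + f8 a b)) a b =
    \sum_a \sum_b f1 a b a b - \sum_a \sum_b f2 a b a b - \sum_a \sum_b f3 a b a b
    + \sum_a \sum_b f4 a b a b + (\sum_a \sum_b f5 a b a b - \sum_a \sum_b f6 a b a b
    - \sum_a \sum_b f7 a b a b + \sum_a \sum_b f8 a b a b).
    do 8 rewrite -?sumrB -?big_split /=; apply: eq_bigr => a _ /=.
    do 8 rewrite -?sumrB -?big_split /=; apply: eq_bigr => b _ /=.
    by rewrite !mxE.
  rewrite lin8 !sum_delta_entry !sum_delta_entryT (tr_sp hX) (tr_sp hY).
  have OmTOm Z : Om *m Z^T *m Om = - tau Z by rewrite tauE opprK.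
  have ttr Z W : \tr (Z *m Om *m (Om *m W)^T) = \tr (Z *m tau W).
    rewrite trmx_mul trOmega !mulmxN -!mulmxA [Om *m (_ *m _)]mulmxA OmTOm.
    by rewrite mulmxN opprK.
  have -> : \tr (X *m Y *m Om *m Om^T) = \tr (X *m Y).
    by rewrite trOmega mulmxN -[_ *m Om *m Om]mulmxA Omega2 mulmxN mulmx1 opprK.
  have -> : \tr (Om *m (Om *m Y *m X)^T) = \tr (X *m Y).
    rewrite -[Om *m Y *m X]mulmxA trmx_mul trOmega !mulmxN mulmxA OmTOm opprK tr_tau.
    exact: mxtrace_mulC.
  rewrite !ttr hX hY !mulmxN !linearN /= mxtrace1 [\tr (Y *m X)]mxtrace_mulC.
  rewrite -addnn !natrD -!natr1; move: (\tr _) => T; by field.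
- move=> Z; apply/spP; rewrite /sp_proj tauZ tauB tauK -scalerN opprB //.
- move=> Z /spP hZ; rewrite /sp_proj hZ opprK -mulr2n -[Z *+ 2]scaler_nat scalerA mulVf ?scale1r //.
- by move=> Z /spP hZ; apply/spP; do 2 apply: sp_lie => //.
Qed.

End Symplectic.

(** * Weights and the grading of the isotropy representation *)

Section Roots.
Variables (R : realType) (n : nat) (n0 : (0 < n)%N).
Local Notation C := R[i].
Local Notation N := (n + n)%N.
Local Notation Mat := 'M[C]_(n + n).
Local Notation Om := (Omega R n).
Implicit Types (X Y Z V W : Mat) (a b c : 'I_N) (D : pred int).

Let j0 : 'I_n := Ordinal n0.
(** [i0] and [iN] index the basis vectors of weights lambda_1 and - lambda_1, which
    span the base line and its quaternionic partner. *)
Definition i0 : 'I_N := lshift n j0.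
Definition iN : 'I_N := rshift n j0.

Lemma i0_neq_iN : (i0 == iN) = false.
Proof. by rewrite /i0 /iN eq_lrshift. Qed.

Lemma iN_neq_i0 : (iN == i0) = false.
Proof. by rewrite eq_sym i0_neq_iN. Qed.

(** [Omega] maps the basis vector of index [bar a] to [sgn a] times that of index [a]. *)
Definition bar a : 'I_N := match fintype.split a with inl k => rshift n k | inr k => lshift n k end.
Definition sgn a : C := if fintype.split a is inl _ then 1 else -1.

Lemma bar_lshift k : bar (lshift n k) = rshift n k.
Proof. by rewrite /bar (unsplitK (inl k)). Qed.
Lemma bar_rshift k : bar (rshift n k) = lshift n k.
Proof. by rewrite /bar (unsplitK (inr k)). Qed.
Lemma sgn_lshift k : sgn (lshift n k) = 1.
Proof. by rewrite /sgn (unsplitK (inl k)). Qed.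
Lemma sgn_rshift k : sgn (rshift n k) = -1.
Proof. by rewrite /sgn (unsplitK (inr k)). Qed.

Definition signed_bar := (bar_lshift, bar_rshift, sgn_lshift, sgn_rshift).

Lemma barK : involutive bar.
Proof. by move=> a; case: (split_ordP a) => k ->; rewrite !signed_bar. Qed.

Lemma sgn_bar a : sgn (bar a) = - sgn a.
Proof. by case: (split_ordP a) => k ->; rewrite !signed_bar ?opprK. Qed.

Lemma Omega_entry a b : Om a b = sgn a *+ (b == bar a).
Proof.
case: (split_ordP a) => k ->; case: (split_ordP b) => l ->; rewrite !signed_bar /Omega;
  rewrite ?block_mxEul ?block_mxEur ?block_mxEdl ?block_mxEdr !mxE.
- by rewrite eq_lrshift.
- by rewrite eq_rshift eq_sym.
- by rewrite eq_lshift eq_sym mulNrn.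
- by rewrite eq_rlshift.
Qed.

Lemma tau_entry X a b : tau X a b = sgn a * sgn b * X (bar b) (bar a).
Proof.
rewrite tauE mxE mxE (bigD1 (bar b)) //= big1 ?addr0 => [|c cb].
  rewrite Omega_entry barK eqxx mulr1n sgn_bar mxE (bigD1 (bar a)) //= big1 ?addr0.
    by rewrite Omega_entry eqxx mulr1n mxE mulrN opprK mulrAC.
  by move=> c /negPf ca; rewrite Omega_entry ca mulr0n mul0r.
by rewrite Omega_entry -(inj_eq (inv_inj barK)) barK eq_sym (negPf cb) mulr0n mulr0.
Qed.

(** Weights of the basis vectors of C^2n. The pieces of m are distinguished by the
    lambda_1-coordinate [deg] alone. *)
Definition wt a : 'rV[int]_n := \row_i ((a == lshift n i)%:R - (a == rshift n i)%:R).
Definition deg a : int := wt a 0 j0.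

Lemma degE a : deg a = (a == i0)%:R - (a == iN)%:R.
Proof. by rewrite /deg mxE. Qed.

Lemma wt_lshift k : wt (lshift n k) = lambda n k.
Proof. by apply/rowP => i; rewrite !mxE eq_lshift eq_lrshift subr0 eq_sym. Qed.

Lemma wt_rshift k : wt (rshift n k) = - lambda n k.
Proof. by apply/rowP => i; rewrite !mxE eq_rshift eq_rlshift sub0r eq_sym. Qed.

Lemma deg_bar a : deg (bar a) = - deg a.
Proof.
rewrite /deg; case: (split_ordP a) => k ->; rewrite !signed_bar wt_lshift wt_rshift !mxE //.
by rewrite opprK.
Qed.

Definition gr D X : Mat := \matrix_(a, b) (X a b *+ D (deg a - deg b)).

Lemma gr_tau D X : tau (gr D X) = gr D (tau X).
Proof.
apply/matrixP => a b; rewrite tau_entry mxE [RHS]mxE tau_entry !deg_bar opprK addrC.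
by rewrite mulrnAr.
Qed.

Lemma gr_adj D X : (forall d, D (- d) = D d) -> adj (gr D X) = gr D (adj X).
Proof.
by move=> DN; apply/matrixP => a b; rewrite !mxE rmorphMn /= -DN opprB.
Qed.

Lemma grN D X : gr D (- X) = - gr D X.
Proof. by apply/matrixP => a b; rewrite !mxE mulNrn. Qed.

Lemma gr_gr D D' X : gr D (gr D' X) = gr (fun d => D d && D' d) X.
Proof.
by apply/matrixP => a b; rewrite !mxE; case: (D _); rewrite ?mulr1n ?mulr0n.
Qed.

Lemma gr_id D X : (forall a b, X a b != 0 -> D (deg a - deg b)) <-> gr D X = X.
Proof.
split=> [h|<- a b].
  apply/matrixP => a b; rewrite mxE; have [->|/h ->] := eqVneq (X a b) 0; by rewrite ?mul0rn.
by rewrite mxE; case: (D _); rewrite // mulr0n eqxx.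
Qed.

Lemma gr_eq D D' X : (forall a b, D (deg a - deg b) = D' (deg a - deg b)) -> gr D X = gr D' X.
Proof. by move=> h; apply/matrixP => a b; rewrite !mxE h. Qed.

Lemma gr_split D D' X : (forall d, D d && D' d = false) ->
  gr (fun d => D d || D' d) X = gr D X + gr D' X.
Proof.
move=> dis; apply/matrixP => a b; rewrite !mxE /=; move: (dis (deg a - deg b)).
by case: (D _) => /= [->|_]; rewrite ?addr0 ?add0r.
Qed.

Lemma gr_disjoint D D' X : (forall d, D d && D' d = false) -> gr D (gr D' X) = 0.
Proof. by move=> dis; by rewrite gr_gr; apply/matrixP => a b; rewrite !mxE dis. Qed.

Lemma tr_gr D X Y : \tr (X *m gr D Y) = \tr (gr (fun d => D (- d)) X *m gr D Y).
Proof.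
apply: eq_bigr => a _; rewrite !mxE; apply: eq_bigr => b _; rewrite !mxE opprB.
by case: (D _); rewrite ?mulr1n // !mulr0n !mulr0.
Qed.

Lemma cartan_entry (x : 'rV[C]_n) X a b :
  lie (cartan x) X a b = (\sum_i ((wt a - wt b) 0 i)%:~R * x 0 i) * X a b.
Proof.
have E c : (row_mx x (- x)) 0 c = \sum_i (wt c 0 i)%:~R * x 0 i.
  case: (split_ordP c) => k ->; rewrite ?wt_lshift ?wt_rshift (bigD1 k) //=
    big1 ?addr0 ?row_mxEl ?row_mxEr.
  - by rewrite mxE eqxx mul1r.
  - by move=> i ik; rewrite mxE (negPf ik : (i == k :> nat) = false) mul0r.
  - by rewrite !mxE eqxx mulN1r.
  - by move=> i ik; rewrite !mxE (negPf ik : (i == k :> nat) = false) oppr0 mul0r.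
have -> : cartan x = diag_mx (row_mx x (- x)).
  by rewrite diag_mx_row /cartan; congr block_mx; apply/matrixP => i j; rewrite !mxE mulNrn.
have ld (d : 'rV[C]_N) : lie (diag_mx d) X a b = (d 0 a - d 0 b) * X a b.
  by rewrite /lie mul_diag_mx mul_mx_diag !mxE mulrBl [X a b * _]mulrC.
rewrite ld !E -sumrB; congr (_ * _).
by apply: eq_bigr => i _; rewrite [(wt a - wt b) 0 i]mxE [(- wt b) 0 i]mxE rmorphB mulrBl.
Qed.

(** Matrix entries are joint eigenvectors of the Cartan subalgebra, and the diagonal
    matrix units separate their weights. *)
Lemma root_spaceP (alpha : 'rV[int]_n) X : root_space alpha X <->
  tau X = - X /\ forall a b, X a b != 0 -> wt a - wt b = alpha.
Proof.
rewrite /root_space /=; split=> [[/spP hX e]|[hX e]].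
  split=> // a b Xab; apply/rowP => i.
  have := congr1 (fun M : Mat => M a b) (e (delta_mx 0 i)).
  rewrite cartan_entry [in RHS]mxE => /(mulIf Xab).
  rewrite (bigD1 i) //= big1 ?addr0; last first.
    by move=> j /negPf ji; rewrite [delta_mx _ _ _ _]mxE ji andbF mulr0.
  rewrite (bigD1 i) //= [in X in _ = _ + X]big1 ?addr0; last first.
    by move=> j /negPf ji; rewrite [delta_mx _ _ _ _]mxE ji andbF mulr0.
  by rewrite [delta_mx _ _ _ _]mxE !eqxx !mulr1 => /intr_inj.
split; first exact/spP.
move=> x; apply/matrixP => a b; rewrite cartan_entry [in RHS]mxE.
by have [->|/e ->] := eqVneq (X a b) 0; rewrite ?mulr0.
Qed.

(** The component of [X] on a root keeps the entries of that weight; a root occurring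
    several times in [s] shares its entries among the occurrences. *)
Lemma root_sumP (s : seq 'rV[int]_n) X : root_sum s X <->
  tau X = - X /\ forall a b, X a b != 0 -> wt a - wt b \in s.
Proof.
split=> [[Y [hY ->]]|[hX sX]].
  split.
    have tsum (r : seq 'rV[int]_n) : {subset r <= s} ->
        tau (\sum_(alpha <- r) Y alpha) = - \sum_(alpha <- r) Y alpha.
      elim: r => [|alpha r ih] rs.
        by rewrite big_nil -(subrr (0 : Mat)) tauB !subrr oppr0.
      rewrite big_cons tauD ih => [|x xr]; last by apply: rs; rewrite in_cons xr orbT.
      by have /hY/root_spaceP[-> _] := rs alpha (mem_head _ _); rewrite opprD.
    exact: tsum.
  move=> a b; rewrite summxE => Yab; apply/negPn/negP => wn; move/negP: Yab; apply.
  rewrite big1_seq // => alpha /andP[_ als].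
  have /root_spaceP[_ h] := hY _ als.
  by apply/eqP/negPn/negP => /h e; rewrite e als in wn.
pose Y alpha : Mat := \matrix_(a, b)
  ((count_mem alpha s)%:R^-1 * (X a b *+ (wt a - wt b == alpha))).
exists Y; split.
  move=> alpha als; apply/root_spaceP; split.
    apply/matrixP => a b; rewrite tau_entry !mxE.
    have -> : wt (bar b) - wt (bar a) = wt a - wt b.
      have wb c : wt (bar c) = - wt c.
        by case: (split_ordP c) => k ->; rewrite !signed_bar wt_lshift wt_rshift ?opprK.
      by rewrite !wb opprK addrC.
    rewrite -mulrN -mulNrn.
    have := congr1 (fun M : Mat => M a b) hX; rewrite tau_entry [RHS]mxE => <-.
    by rewrite -mulrnAr [RHS]mulrCA.
  move=> a b; rewrite /Y mxE; case e : (_ == alpha); first by move=> _; apply/eqP.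
  by rewrite mulr0n mulr0 eqxx.
apply/matrixP => a b; rewrite summxE.
have [X0|/sX ws] := eqVneq (X a b) 0.
  by rewrite X0 big1 // => alpha _; rewrite mxE X0 mul0rn mulr0.
under eq_bigr => alpha _ do rewrite mxE.
rewrite (eq_bigr (fun alpha => if alpha == wt a - wt b
   then (count_mem (wt a - wt b) s)%:R^-1 * X a b else 0)); last first.
  by move=> alpha _; rewrite eq_sym; case: eqP => [->|]; rewrite ?mulr0n ?mulr0.
rewrite -big_mkcond /= big_const_seq iter_addr_0 -[RHS]mulr_natl mulrA mulfV ?mul1r //.
by rewrite pnatr_eq0 -lt0n -has_count has_pred1.
Qed.

Lemma mem_neg_roots (s : seq 'rV[int]_n) alpha : (alpha \in neg_roots s) = (- alpha \in s).
Proof. by rewrite -[alpha in LHS]opprK (mem_map oppr_inj). Qed.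

Lemma lambda_j0 k : lambda n k 0 j0 = (k == 0%N)%:R.
Proof. by rewrite mxE eq_sym. Qed.

Lemma wt_roots1 a b : (wt a - wt b \in roots1_pos n) = (deg a - deg b == 1).
Proof.
apply/idP/eqP => [|].
  have -> : deg a - deg b = (wt a - wt b) 0 j0 by rewrite /deg !mxE.
  by rewrite mem_cat => /orP[] /mapP[k]; rewrite mem_iota => /andP[k1 _] ->;
    case: k k1 => // k _; rewrite !mxE.
have small (k : 'I_n) : (k != 0 :> nat)%N -> (k : nat) \in iota 1 n.-1.
  by rewrite -lt0n mem_iota => k0; rewrite k0 add1n prednK //=.
have inD (k : 'I_n) : (k != 0 :> nat)%N -> lambda n 0 + lambda n k \in roots1_pos n.
  by move=> k0; rewrite mem_cat; apply/orP; right; apply: map_f; exact: small.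
have inB (k : 'I_n) : (k != 0 :> nat)%N -> lambda n 0 - lambda n k \in roots1_pos n.
  by move=> k0; rewrite mem_cat; apply/orP; left; apply: map_f; exact: small.
rewrite /deg; case: (split_ordP a) => k ->; case: (split_ordP b) => l ->;
  rewrite ?wt_lshift ?wt_rshift ?[(- lambda _ _) _ _]mxE !lambda_j0 ?opprK.
- by case: eqP => k0; case: eqP => l0 // _; rewrite k0; apply: inB; apply/eqP.
- case: eqP => k0; case: eqP => l0 // _; first by rewrite k0; apply: inD; apply/eqP.
  by rewrite l0 addrC; apply: inD; apply/eqP.
- by case: eqP => k0; case: eqP.
- by case: eqP => k0; case: eqP => l0 // _; rewrite l0 addrC; apply: inB; apply/eqP.
Qed.

Lemma wt_roots2 a b : (wt a - wt b \in roots2_pos n) = (deg a - deg b == 2).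
Proof.
apply/idP/eqP => [|].
  have -> : deg a - deg b = (wt a - wt b) 0 j0 by rewrite /deg !mxE.
  by rewrite inE => /eqP ->; rewrite mulr2n mxE lambda_j0.
rewrite inE /deg mulr2n; case: (split_ordP a) => k ->; case: (split_ordP b) => l ->;
  rewrite ?wt_lshift ?wt_rshift ?[(- lambda _ _) _ _]mxE !lambda_j0 ?opprK;
  case: eqP => k0; case: eqP => l0 //.
by rewrite k0 l0.
Qed.

Definition D1 : pred int := fun d => (d == 1) || (d == -1).
Definition D2 : pred int := fun d => (d == 2) || (d == -2).
Definition Dpos : pred int := fun d => (d == 1) || (d == 2).
Definition Dneg : pred int := fun d => (d == -1) || (d == -2).
Definition Dzero : pred int := fun d => d == 0.

Definition graded (S : set Mat) D := forall X, S X <-> tau X = - X /\ gr D X = X.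

Lemma root_sum_graded s D : (forall a b, (wt a - wt b \in s) = D (deg a - deg b)) ->
  graded (root_sum s) D.
Proof.
move=> sD X; rewrite root_sumP; split=> -[hX h]; split => //.
  by apply/gr_id => a b /h; rewrite sD.
by move=> a b; rewrite sD; exact: (gr_id D X).2.
Qed.

Lemma mem_wt_neg s d a b : (forall a b, (wt a - wt b \in s) = (deg a - deg b == d)) ->
  (wt a - wt b \in neg_roots s) = (deg a - deg b == - d).
Proof. by move=> sd; rewrite mem_neg_roots opprB sd -eqr_oppLR opprB. Qed.

Lemma m1C_graded : graded (@m1C R n) D1.
Proof.
by apply: root_sum_graded => a b; rewrite mem_cat wt_roots1 (mem_wt_neg _ _ wt_roots1).
Qed.

Lemma m2C_graded : graded (@m2C R n) D2.
Proof.
by apply: root_sum_graded => a b; rewrite mem_cat wt_roots2 (mem_wt_neg _ _ wt_roots2).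
Qed.

Lemma m_pos_graded : graded (@m_pos R n) Dpos.
Proof. by apply: root_sum_graded => a b; rewrite mem_cat wt_roots1 wt_roots2. Qed.

Lemma m_neg_graded : graded (@m_neg R n) Dneg.
Proof.
apply: root_sum_graded => a b; rewrite /neg_roots map_cat mem_cat.
by rewrite (mem_wt_neg _ _ wt_roots1) (mem_wt_neg _ _ wt_roots2).
Qed.

(** Graded pieces with disjoint degrees are independent, which forces the choice made
    by [component]. *)
Lemma componentE S S' D D' X : graded S D -> graded S' D' ->
  (forall d, D d && D' d = false) -> tau X = - X -> gr (fun d => D d || D' d) X = X ->
  component S S' X = gr D X.
Proof.
move=> hS hS' dis hX eX; rewrite /component.
have hD : S (gr D X) /\ S' (X - gr D X).
  split.
    apply/hS; rewrite gr_tau hX grN; split => //.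
    by rewrite gr_gr; apply: gr_eq => a b /=; rewrite andbb.
  have -> : X - gr D X = gr D' X by rewrite -{1}eX gr_split // addrC addKr.
  apply/hS'; rewrite gr_tau hX grN; split => //.
  by rewrite gr_gr; apply: gr_eq => a b /=; rewrite andbb.
have [/hS[_ e1] /hS'[_ e2]] := @xgetPex _ 0 [set Y | S Y /\ S' (X - Y)] (ex_intro _ _ hD).
set Y := xget _ _ in e1 e2 *.
have -> : X = Y + (X - Y) by rewrite addrC subrK.
have grD A B : gr D (A + B) = gr D A + gr D B.
  by apply/matrixP => a b; rewrite !mxE mulrnDl.
by rewrite grD e1 -e2 gr_disjoint // addr0.
Qed.

End Roots.

(** * The metric and complex structure at the base point *)

Section Isotropy.
Variables (R : realType) (n : nat) (n0 : (0 < n)%N).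
Local Notation C := R[i].
Local Notation N := (n + n)%N.
Local Notation Mat := 'M[C]_(n + n).
Local Notation i0 := (i0 n0).
Local Notation iN := (iN n0).
Local Notation deg := (deg n0).
Local Notation gr := (gr n0).
Implicit Types (X Y Z V W : Mat) (a b c : 'I_N) (D : pred int).

(** [E0], [F0] and [K0] are the projections onto the parts of C^2n of degree 1, -1
    and 0. *)
Definition E0 : Mat := delta_mx i0 i0.
Definition F0 : Mat := delta_mx iN iN.
Local Notation E := E0.
Local Notation F := F0.

Lemma base_projE : base_proj R n = E.
Proof. by apply/matrixP => a b; rewrite !mxE. Qed.

Lemma bar_i0 a : (bar a == i0) = (a == iN).
Proof. by rewrite -(inj_eq (inv_inj (@barK n))) barK bar_lshift. Qed.

Lemma bar_iN a : (bar a == iN) = (a == i0).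
Proof. by rewrite -(inj_eq (inv_inj (@barK n))) barK bar_rshift. Qed.

Lemma tauE0 : tau E = F.
Proof.
apply/matrixP => a b; rewrite tau_entry !mxE !bar_i0.
case: eqP => [->|_]; case: eqP => [->|_]; rewrite ?mulr0 //.
by rewrite sgn_rshift mulrNN !mul1r.
Qed.

Lemma tauF0 : tau F = E. Proof. by rewrite -tauE0 tauK. Qed.

Lemma adj_delta a : adj (delta_mx a a : Mat) = delta_mx a a.
Proof. by rewrite /adj trmx_delta map_delta_mx. Qed.

Lemma adjE0 : adj E = E. Proof. exact: adj_delta. Qed.
Lemma adjF0 : adj F = F. Proof. exact: adj_delta. Qed.
Lemma mulE0E0 : E *m E = E. Proof. by rewrite mul_delta_mx. Qed.
Lemma mulE0F0 : E *m F = 0. Proof. by rewrite mul_delta_mx_0 // i0_neq_iN. Qed.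
Lemma mulF0E0 : F *m E = 0. Proof. by rewrite mul_delta_mx_0 // iN_neq_i0. Qed.

Lemma mul_delta_l c X a b : (delta_mx c c *m X) a b = X a b *+ (a == c).
Proof.
rewrite mxE (bigD1 c) //= big1 ?addr0 => [|d /negPf dc]; rewrite mxE.
  by rewrite eqxx andbT; case: eqP => [->|]; rewrite ?mul1r ?mul0r.
by rewrite dc andbF mul0r.
Qed.

Lemma mul_delta_r c X a b : (X *m delta_mx c c) a b = X a b *+ (b == c).
Proof.
rewrite mxE (bigD1 c) //= big1 ?addr0 => [|d /negPf dc]; rewrite mxE.
  by rewrite eqxx /=; case: eqP => [->|]; rewrite ?mulr1 ?mulr0.
by rewrite dc mulr0.
Qed.

Lemma add_entry X Y a b : (X + Y) a b = X a b + Y a b. Proof. by rewrite mxE. Qed.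
Lemma opp_entry X a b : (- X) a b = - X a b. Proof. by rewrite mxE. Qed.

Lemma excl a : (a == i0) && (a == iN) = false.
Proof. by case: eqP => [->|]; rewrite ?i0_neq_iN. Qed.

Lemma E0_l X a b : (E *m X) a b = X a b *+ (a == i0). Proof. exact: mul_delta_l. Qed.
Lemma E0_r X a b : (X *m E) a b = X a b *+ (b == i0). Proof. exact: mul_delta_r. Qed.
Lemma F0_l X a b : (F *m X) a b = X a b *+ (a == iN). Proof. exact: mul_delta_l. Qed.
Lemma F0_r X a b : (X *m F) a b = X a b *+ (b == iN). Proof. exact: mul_delta_r. Qed.

Definition entries := (add_entry, opp_entry, E0_l, E0_r, F0_l, F0_r).
#[local] Opaque E0 F0.

Definition K0 : Mat := 1%:M - E - F.
Local Notation K := K0.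

Lemma K0E : K = 1%:M - E - F. Proof. by []. Qed.

Lemma K0_l X a b : (K *m X) a b = X a b *+ ~~ ((a == i0) || (a == iN)).
Proof.
rewrite /K !mulmxBl mul1mx 2!add_entry 2!opp_entry E0_l F0_l; have := excl a.
by case: (a == i0) => /= [->|_]; case: (a == iN);
  rewrite /= ?mulr0n ?mulr1n ?subr0 ?subrr ?sub0r ?oppr0 ?addr0.
Qed.

Lemma K0_r X a b : (X *m K) a b = X a b *+ ~~ ((b == i0) || (b == iN)).
Proof.
rewrite /K !mulmxBr mulmx1 2!add_entry 2!opp_entry E0_r F0_r; have := excl b.
by case: (b == i0) => /= [->|_]; case: (b == iN);
  rewrite /= ?mulr0n ?mulr1n ?subr0 ?subrr ?sub0r ?oppr0 ?addr0.
Qed.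

Lemma tauK0 : tau K = K.
Proof. by rewrite /K !tauB tauE0 tauF0 tau1 addrAC. Qed.
Lemma adjK0 : adj K = K.
Proof. by rewrite /K !adjB adj1 adjE0 adjF0. Qed.
Lemma mulK0E0 : K *m E = 0.
Proof. by rewrite /K !mulmxBl mul1mx mulE0E0 mulF0E0 subrr subr0. Qed.
Lemma mulE0K0 : E *m K = 0.
Proof. by rewrite /K !mulmxBr mulmx1 mulE0E0 mulE0F0 subrr subr0. Qed.
#[local] Opaque K0.

(** Which piece an entry belongs to depends only on how its two indices compare with
    [i0] and [iN]; this turns identities between graded pieces into truth tables. *)
Lemma D_bool a b (p := a == i0) (q := a == iN) (r := b == i0) (s := b == iN) :
  [/\ D1 (deg a - deg b) = (p || q) (+) (r || s),
      D2 (deg a - deg b) = (p && s) || (q && r),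
      Dzero (deg a - deg b) = (p == r) && (q == s),
      Dpos (deg a - deg b) = (p && ~~ r) || (s && ~~ q) &
      Dneg (deg a - deg b) = (r && ~~ p) || (q && ~~ s)].
Proof.
rewrite !degE -/p -/q -/r -/s; have := excl a; have := excl b; rewrite -/p -/q -/r -/s.
by case: p => /=; case: q => /=; case: r => /=; case: s.
Qed.

Ltac bool_entries a b :=
  have := excl a; have := excl b;
  case: (a == i0); case: (a == iN); case: (b == i0); case: (b == iN) => //= _ _;
  rewrite ?mulr1n ?mulr0n ?mul0rn; ring.

Lemma gr1E X : gr D1 X = E *m X *m K + K *m X *m E + F *m X *m K + K *m X *m F.
Proof.
apply/matrixP => a b; rewrite [LHS]mxE; have [-> _ _ _ _] := D_bool a b.
rewrite 3!add_entry !(E0_l, E0_r, F0_l, F0_r, K0_l, K0_r).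
bool_entries a b.
Qed.

Lemma gr2E X : gr D2 X = E *m X *m F + F *m X *m E.
Proof.
apply/matrixP => a b; rewrite [LHS]mxE; have [_ -> _ _ _] := D_bool a b.
rewrite !entries; bool_entries a b.
Qed.

Lemma gr_zero_comm X : lie (gr Dzero X) E = 0.
Proof.
apply/matrixP => a b; rewrite /lie !entries !mxE; have [_ _ -> _ _] := D_bool a b.
bool_entries a b.
Qed.

Lemma gr_pos_E X : gr Dpos X *m E = 0.
Proof.
apply/matrixP => a b; rewrite !entries !mxE; have [_ _ _ -> _] := D_bool a b.
bool_entries a b.
Qed.

Lemma E_gr_neg X : E *m gr Dneg X = 0.
Proof.
apply/matrixP => a b; rewrite !entries !mxE; have [_ _ _ _ ->] := D_bool a b.
bool_entries a b.
Qed.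

Lemma comm_E_zero X : tau X = - X -> lie X E = 0 -> gr Dzero X = X.
Proof.
move=> hX XE; apply/gr_id => a b Xab; have [_ _ -> _ _] := D_bool a b.
have zero c d : (c == i0) != (d == i0) -> X c d = 0.
  move=> cd; have := congr1 (fun M : Mat => M c d) XE; rewrite /lie !entries [RHS]mxE.
  by move: cd; case: (c == i0); case: (d == i0) => //= _ /eqP;
    rewrite ?mulr0n ?mulr1n ?subr0 ?sub0r ?oppr_eq0 => /eqP.
apply/andP; split; first by apply: contraNT Xab => /zero ->.
apply: contraNT Xab; rewrite eq_sym -!bar_i0 => /zero h.
have := congr1 (fun M : Mat => M a b) hX; rewrite tau_entry h mulr0 [RHS]mxE.
by move=> /eqP; rewrite eq_sym oppr_eq0.
Qed.

Lemma gr_add D X Y : gr D (X + Y) = gr D X + gr D Y.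
Proof. by apply/matrixP => a b; rewrite !mxE mulrnDl. Qed.

Lemma tr_gr_sym D X Y : (forall d, D (- d) = D d) -> \tr (gr D X *m gr D Y) = \tr (X *m gr D Y).
Proof. by move=> DN; rewrite [RHS]tr_gr (gr_eq (D' := D)). Qed.

Lemma D1N d : D1 (- d) = D1 d. Proof. by rewrite /D1 !eqr_oppLR opprK orbC. Qed.
Lemma D2N d : D2 (- d) = D2 d. Proof. by rewrite /D2 !eqr_oppLR opprK orbC. Qed.
Lemma DzeroN d : Dzero (- d) = Dzero d. Proof. by rewrite /Dzero oppr_eq0. Qed.

(** The degree-0 part of [X] lies in the isotropy algebra, so orthogonality can be
    tested against it, and the Killing form is definite on it. *)
Lemma m_algP X : m_alg X <-> [/\ tau X = - X, adj X = - X & gr Dzero X = 0].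
Proof.
rewrite /m_alg /=; split=> [[[/spP hX aX] orth]|[hX aX X0]].
  split=> //; set Z := gr Dzero X.
  have hZ : tau Z = - Z by rewrite gr_tau hX grN.
  have aZ : adj Z = - Z by rewrite gr_adj ?[adj X]aX ?grN //; exact: DzeroN.
  have /orth : k_alg Z.
    by split; [split; [exact/spP|exact: aZ]|rewrite base_projE gr_zero_comm].
  rewrite killingE // -tr_gr_sym; last exact: DzeroN.
  move=> /eqP; rewrite mulf_eq0 pnatr_eq0 double_eq0 /= -/Z => /eqP trZ.
  by apply: adj_sum_eq0; rewrite aZ mulNmx linearN /= trZ oppr0.
split; first by split; [exact/spP|exact: aX].
move=> Y [[/spP hY _]]; rewrite base_projE => YE.
rewrite killingE // -(comm_E_zero hY YE) -tr_gr_sym ?X0 ?mul0mx ?mxtrace0 ?mulr0 //.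
exact: DzeroN.
Qed.

Lemma m_alg_gr X : gr Dzero X = 0 ->
  gr (fun d => D1 d || D2 d) X = X /\ gr (fun d => Dpos d || Dneg d) X = X.
Proof.
move=> X0; have h a b : X a b != 0 -> Dzero (deg a - deg b) = false.
  have := congr1 (fun M : Mat => M a b) X0; rewrite !mxE.
  by case: (Dzero _) => // /eqP; rewrite mulr1n => ->.
split; apply/gr_id => a b /h; have [e1 e2 e3 e4 e5] := D_bool a b;
  rewrite ?e1 ?e2 ?e3 ?e4 ?e5; have := excl a; have := excl b;
  by case: (a == i0); case: (a == iN); case: (b == i0); case: (b == iN).
Qed.

Lemma Re_natmul k (z : C) : complex.Re (k%:R * z) = k%:R * complex.Re z.
Proof.
rewrite mulr_natl mulr_natl; elim: k => [|k ih]; first by rewrite !mulr0n.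
by rewrite !mulrS ReD ih.
Qed.

Fact Re_four (a b T T' : C) : complex.Re a = complex.Re b -> a = - (T - T') ->
  complex.Re (a + b + b + a) = - (4 * (complex.Re T - complex.Re T')).
Proof.
move=> ab aT; rewrite !ReD -ab aT.
by case: T T' {ab aT} => [x y] [x' y'] /=; ring.
Qed.

Fact Re_two (a b T : C) : complex.Re a = complex.Re b -> a = - T ->
  complex.Re (a + b) = - (2 * complex.Re T).
Proof. by move=> ab aT; rewrite ReD -ab aT; case: T {ab aT} => x y /=; ring. Qed.

Fact metric_arith (k : nat) (t : R) (S1 S2 T T' : C) :
  complex.Re S1 = - (4 * (complex.Re T - complex.Re T')) ->
  complex.Re S2 = - (2 * complex.Re T') ->
  - complex.Re ((k.*2)%:R * S1) - t * complex.Re ((k.*2)%:R * S2) =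
  4 * k%:R * complex.Re (2 * T + (t - 2)%:C%C * T').
Proof.
move=> h1 h2; rewrite !Re_natmul h1 h2 ReD Re_natmul ReM /= -addnn natrD; ring.
Qed.

(** The pieces m_1 and m_2 of [X] are read off the blocks of the velocity [lie X E]
    between [E] and [K], respectively [E] and [F]. Adjunction and [tau] identify the four
    blocks of m_1, and the two blocks of m_2, so that each trace occurs four times,
    respectively twice. *)
Lemma form_mE (t : R) X Y (V := lie X E) (W := lie Y E) : m_alg X -> m_alg Y ->
  form_m t X Y = 4 * n.+1%:R *
    complex.Re (2 * \tr (V *m E *m W) + (t - 2)%:C%C * \tr (F *m V *m E *m W)).
Proof.
move=> /m_algP[hX aX X0] /m_algP[hY aY Y0].
have dis d : D1 d && D2 d = false by rewrite /D1 /D2; do 2 case: eqP => [->|_] //.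
have dis' d : D2 d && D1 d = false by rewrite andbC.
have [X12 _] := m_alg_gr X0; have [Y12 _] := m_alg_gr Y0.
have sw Z : gr (fun d => D1 d || D2 d) Z = Z -> gr (fun d => D2 d || D1 d) Z = Z.
  by move=> <-; rewrite gr_gr; apply: gr_eq => a b; rewrite orbC andbb.
rewrite /form_m.
rewrite !(componentE (m1C_graded n0) (m2C_graded n0) dis) //.
rewrite !(componentE (m2C_graded n0) (m1C_graded n0) dis') //; try exact: sw.
have hg D Z : tau Z = - Z -> tau (gr D Z) = - gr D Z by move=> hZ; rewrite gr_tau hZ grN.
rewrite !killingE; try exact: hg.
rewrite !tr_gr_sym; [|exact: D2N|exact: D1N].
have t1 : \tr (X *m (F *m Y *m K)) = \tr (X *m (K *m Y *m E)).
  rewrite -tr_tau !tauM hX hY tauK0 tauF0 !(mulmxN, mulNmx) opprK.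
  by rewrite mxtrace_mulC !mulmxA.
have t2 : \tr (X *m (K *m Y *m F)) = \tr (X *m (E *m Y *m K)).
  rewrite -tr_tau !tauM hX hY tauK0 tauF0 !(mulmxN, mulNmx) opprK.
  by rewrite mxtrace_mulC !mulmxA.
have conj (A B : Mat) : adj A = A -> adj B = B ->
    complex.Re (\tr (X *m (A *m Y *m B))) = complex.Re (\tr (X *m (B *m Y *m A))).
  move=> hA hB; rewrite -[LHS]ReJ -tr_adj !adjM aX aY hA hB !(mulmxN, mulNmx) opprK.
  by rewrite mxtrace_mulC !mulmxA.
have EVE : E *m V *m E = 0.
  by rewrite /V /lie mulmxBr mulmxBl !mulmxA mulE0E0 -!mulmxA mulE0E0 subrr.
have vel (A : Mat) : A *m E = 0 -> E *m A = 0 ->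
    \tr (X *m (E *m Y *m A)) = - \tr (A *m V *m E *m W).
  move=> AE EA.
  have -> : A *m V *m E *m W = A *m X *m (E *m E) *m Y *m E
     - A *m X *m (E *m (E *m E)) *m Y - (A *m E) *m X *m E *m W.
    by rewrite /V /W /lie; mx_ring.
  have z1 : \tr (A *m X *m E *m Y *m E) = 0.
    by rewrite mxtrace_mulC !mulmxA EA !mul0mx mxtrace0.
  have z2 : \tr (A *m X *m E *m Y) = \tr (X *m (E *m Y *m A)).
    by rewrite -!mulmxA mxtrace_mulC !mulmxA.
  by rewrite AE !mul0mx subr0 !mulE0E0 linearB /= z1 z2 sub0r opprK.
have trK : \tr (K *m V *m E *m W) = \tr (V *m E *m W) - \tr (F *m V *m E *m W).
  have -> : K *m V *m E *m W = V *m E *m W - (E *m V *m E) *m W - F *m V *m E *m W.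
    by rewrite K0E; mx_ring.
  by rewrite EVE mul0mx subr0 linearB.
have H1 : complex.Re (\tr (X *m gr D1 Y)) =
    - (4 * (complex.Re (\tr (V *m E *m W)) - complex.Re (\tr (F *m V *m E *m W)))).
  have -> : \tr (X *m gr D1 Y) = \tr (X *m (E *m Y *m K)) + \tr (X *m (K *m Y *m E))
       + \tr (X *m (K *m Y *m E)) + \tr (X *m (E *m Y *m K)).
    by rewrite gr1E 3!mulmxDr 3!mxtraceD; congr (_ + _ + _ + _).
  apply: Re_four; first exact: conj adjE0 adjK0.
  by rewrite (vel K mulK0E0 mulE0K0) trK.
have H2 : complex.Re (\tr (X *m gr D2 Y)) = - (2 * complex.Re (\tr (F *m V *m E *m W))).
  rewrite gr2E mulmxDr mxtraceD.
  by apply: Re_two; [exact: conj adjE0 adjF0|exact: vel mulF0E0 mulE0F0].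
exact: metric_arith H1 H2.
Qed.

(** The positive part of [X] is killed by [E] on the right and the negative part by [E]
    on the left, so bracketing twice with [E] tells them apart. *)
Lemma J_mE X (V := lie X E) : m_alg X ->
  lie (J_m X) E = 'i%C *: (E *m V - V *m E).
Proof.
move=> /m_algP[hX aX X0]; rewrite /J_m.
have [_ Xpn] := m_alg_gr X0.
have dis d : Dpos d && Dneg d = false.
  by rewrite /Dpos /Dneg; do 2 case: eqP => [->|_] //.
have dis' d : Dneg d && Dpos d = false by rewrite andbC.
rewrite (componentE (m_pos_graded n0) (m_neg_graded n0) dis) //.
rewrite (componentE (m_neg_graded n0) (m_pos_graded n0) dis') //; last first.
  by rewrite -[X in RHS]Xpn; apply: gr_eq => a b; rewrite orbC.
have lieZ (z : C) (A : Mat) : lie (z *: A) E = z *: lie A E.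
  by rewrite /lie -scalemxAl -scalemxAr -scalerBr.
rewrite /V -scalerBr lieZ; congr (_ *: _).
have XE : X = gr Dpos X + gr Dneg X by rewrite -gr_split ?Xpn.
have PE := gr_pos_E X; have EQ := E_gr_neg X.
move: PE EQ XE; set P := gr _ _; set Q := gr _ _ => PE EQ ->.
have -> : E *m lie (P + Q) E - lie (P + Q) E *m E =
   E *m (P *m E) + (E *m Q) *m E - (E *m E) *m P - E *m (E *m Q)
   - (P *m E) *m E - Q *m (E *m E) + E *m (P *m E) + (E *m Q) *m E.
  by rewrite /lie; mx_ring.
rewrite mulE0E0 PE EQ !(mulmx0, mul0mx, subr0, addr0, sub0r, add0r).
by rewrite /lie mulmxBl mulmxBr PE EQ sub0r subr0 addrC.
Qed.

Lemma skew_tau_sum (A B : Mat) : adj A = - A -> adj B = - B -> tau B = - B ->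
  tau (A - tau A + B) = - (A - tau A + B) /\ adj (A - tau A + B) = - (A - tau A + B).
Proof.
move=> aA aB tB; split.
  by rewrite tauD tauB tauK tB opprD opprB.
by rewrite adjD adjB -tau_adj aA aB tauN !opprD.
Qed.

(** The blocks of [V] between [K] and [E] give a skew-Hermitian [A]; subtracting
    [tau A], which commutes with [E], makes it symplectic. The block between [F] and [E]
    is symplectic by itself. *)
Lemma tangent_lift V : adj V = V -> E *m V + V *m E = V ->
  exists X, [/\ tau X = - X, adj X = - X & lie X E = V].
Proof.
move=> aV hV.
have EVE : E *m V *m E = 0.
  have := congr1 (fun M => E *m M) hV; rewrite mulmxDr !mulmxA mulE0E0 => /eqP.
  by rewrite -subr_eq0 addrC addKr => /eqP.
pose A := K *m V *m E - E *m V *m K; pose B := F *m V *m E - E *m V *m F.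
have FtE : F *m tau V *m E = - (F *m V *m E).
  apply/matrixP => a b; rewrite [LHS]E0_r F0_l [RHS]opp_entry [in RHS]E0_r [in RHS]F0_l tau_entry.
  case: eqP => [->|_]; case: eqP => [->|_]; rewrite ?mulr0n ?mul0rn ?oppr0 //.
  by rewrite !mulr1n !signed_bar mulr1 mulN1r.
have EtF : E *m tau V *m F = - (E *m V *m F).
  apply/matrixP => a b; rewrite [LHS]F0_r E0_l [RHS]opp_entry [in RHS]F0_r [in RHS]E0_l tau_entry.
  case: eqP => [->|_]; case: eqP => [->|_]; rewrite ?mulr0n ?mul0rn ?oppr0 //.
  by rewrite !mulr1n !signed_bar mul1r mulN1r.
have hB : tau B = - B.
  by rewrite /B tauB !tauM tauE0 tauF0 !mulmxA FtE EtF opprB opprK addrC.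
have aA : adj A = - A by rewrite adjB !adjM aV adjE0 adjK0 opprB !mulmxA.
have aB : adj B = - B by rewrite adjB !adjM aV adjE0 adjF0 opprB !mulmxA.
have [h1 h2] := skew_tau_sum aA aB hB.
exists (A - tau A + B); split=> //.
have -> : tau A = F *m tau V *m K - K *m tau V *m F.
  by rewrite /A tauB !tauM tauK0 tauE0 !mulmxA.
have -> : lie (A - (F *m tau V *m K - K *m tau V *m F) + B) E =
    K *m V *m (E *m E) - E *m V *m (K *m E) - F *m tau V *m (K *m E)
    + K *m tau V *m (F *m E) + F *m V *m (E *m E) - E *m V *m (F *m E)
    - (E *m K) *m V *m E + (E *m E) *m V *m K + (E *m F) *m tau V *m K
    - (E *m K) *m tau V *m F - (E *m F) *m V *m E + (E *m E) *m V *m F.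
  by rewrite /lie /A /B; mx_ring.
rewrite mulK0E0 mulE0K0 mulE0E0 mulF0E0 mulE0F0 !(mulmx0, mul0mx, subr0, addr0).
rewrite -[RHS]hV.
have -> : K *m V *m E + F *m V *m E + E *m V *m K + E *m V *m F =
   E *m V + V *m E - E *m V *m E - E *m V *m E by rewrite K0E; mx_ring.
by rewrite EVE !subr0.
Qed.
End Isotropy.

(** * The orbit, its tangent spaces and its invariant tensors *)

Section ProjectiveSpace.
Variables (R : realType) (n : nat) (n0 : (0 < n)%N).
Local Notation C := R[i].
Local Notation N := (n + n)%N.
Local Notation Mat := 'M[C]_(n + n).
Local Notation E := (E0 R n0).
Local Notation F := (F0 R n0).
Implicit Types (X Y Z V W P : Mat) (p v w : ambient R n).

Lemma SpP (a : Mat) : Sp a <-> adj a *m a = 1%:M /\ tau a = adj a.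
Proof.
rewrite /Sp /=; split=> -[ua sa]; split=> //; try exact: ua.
  have ta : tau a *m a = 1%:M.
    by rewrite tauE mulNmx -!mulmxA [a^T *m _]mulmxA sa Omega2 opprK.
  have au : a *m adj a = 1%:M by apply: mulmx1C.
  by rewrite -[tau a]mulmx1 -au mulmxA ta mul1mx.
have : Omega R n *m (tau a *m a) = Omega R n by rewrite sa ua mulmx1.
by rewrite tauE mulNmx mulmxN !mulmxA Omega2 !mulNmx mul1mx opprK.
Qed.

Lemma invmx_unitary (a : Mat) : adj a *m a = 1%:M -> invmx a = adj a.
Proof.
move=> ua; have /mulmx1_unit[_ au] := ua.
by rewrite -[LHS]mul1mx -ua -mulmxA mulmxV // mulmx1.
Qed.

Lemma CPP p : CP p <-> exists a : Mat,
  [/\ adj a *m a = 1%:M, a *m adj a = 1%:M, tau a = adj a & to_complex p = a *m E *m adj a].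
Proof.
rewrite /CP /=; split=> [[a /SpP[ua ta]]|[a [ua _ ta pa]]].
  by rewrite (invmx_unitary ua) (base_projE R n0) => pa; exists a; split=> //; exact: mulmx1C.
by exists a; [exact/SpP|rewrite (invmx_unitary ua) (base_projE R n0)].
Qed.

Lemma translationP p : CP p -> let a := translation p in
  [/\ adj a *m a = 1%:M, a *m adj a = 1%:M, tau a = adj a & to_complex p = a *m E *m adj a].
Proof.
move=> [b Sb pb]; have := @xgetPex _ 1%:M
  [set a | Sp a /\ to_complex p = a *m base_proj R n *m invmx a]
  (ex_intro _ b (conj Sb pb)).
rewrite -/(translation p) => -[/SpP[ua ta]]; rewrite (invmx_unitary ua) (base_projE R n0) => pa.
by split=> //; exact: mulmx1C.
Qed.

Lemma unitary_sandwich (a : Mat) (ua : adj a *m a = 1%:M) X Y :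
  a *m X *m adj a *m (a *m Y *m adj a) = a *m (X *m Y) *m adj a.
Proof. by rewrite !mulmxA -[_ *m adj a *m a]mulmxA ua mulmx1. Qed.

Lemma tau_sandwich (a : Mat) (ta : tau a = adj a) X :
  tau (a *m X *m adj a) = a *m tau X *m adj a.
Proof. by rewrite !tauM ta tau_adj ta adjK mulmxA. Qed.

Lemma CP_facts p (P := to_complex p) : CP p ->
  [/\ adj P = P, P *m P = P, P *m tau P = 0 & tau P *m P = 0].
Proof.
move=> /CPP[a [ua _ ta pa]]; rewrite /P pa; split.
- by rewrite !adjM adjK adjE0 mulmxA.
- by rewrite (unitary_sandwich ua) mulE0E0.
- by rewrite (tau_sandwich ta) (unitary_sandwich ua) tauE0 mulE0F0 mulmx0 mul0mx.
- by rewrite (tau_sandwich ta) (unitary_sandwich ua) tauE0 mulF0E0 mulmx0 mul0mx.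
Qed.

(** The derivative of the equations [P = P^*] and [P P = P]. *)
Definition is_tan P V := adj V = V /\ P *m V + V *m P = V.

Lemma is_tan_conj (a : Mat) V : adj a *m a = 1%:M -> a *m adj a = 1%:M ->
  is_tan (a *m E *m adj a) V -> is_tan E (adj a *m V *m a).
Proof.
move=> ua au [aV hV]; split; first by rewrite !adjM adjK aV mulmxA.
rewrite -[in RHS]hV mulmxDr mulmxDl; congr (_ + _).
  by rewrite !mulmxA ua mul1mx.
by rewrite -!mulmxA ua mulmx1.
Qed.

Lemma to_mP p v : CP p -> is_tan (to_complex p) (to_complex v) ->
  m_alg (to_m p v) /\ to_complex v =
    translation p *m lie (to_m p v) E *m adj (translation p).
Proof.
move=> /translationP /=; set a := translation p => -[ua au ta pa].
rewrite pa => /(is_tan_conj ua au) [aV hV].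
have [X [hX aX XV]] := tangent_lift aV hV.
pose Z := X - gr n0 (@Dzero) X.
have trE Y : translate a Y = a *m lie Y E *m adj a.
  by rewrite /translate (invmx_unitary ua) (base_projE R n0).
have mZ : m_alg Z /\ to_complex v = translate a Z.
  split.
    apply/(m_algP n0); split.
    - by rewrite tauB hX gr_tau hX grN opprD.
    - by rewrite adjB aX gr_adj ?aX ?grN ?opprD //; exact: DzeroN.
    rewrite gr_add grN gr_gr.
    by apply/eqP; rewrite subr_eq0; apply/eqP/gr_eq => c d; rewrite andbb.
  have -> : translate a Z = a *m (lie X E - lie (gr n0 (@Dzero) X) E) *m adj a.
    by rewrite trE /Z /lie; congr (_ *m _ *m _); mx_ring.
  by rewrite gr_zero_comm subr0 XV !mulmxA au mul1mx -mulmxA au mulmx1.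
have := @xgetPex _ 0 [set Y | m_alg Y /\ to_complex v = translate a Y] (ex_intro _ Z mZ).
by move=> [m e]; split; [exact: m|rewrite -trE; exact: e].
Qed.

(** The metric is a polynomial in the projection [P], its quaternionic partner [tau P]
    and the tangent vectors: the translation disappears from the traces. *)
Lemma CP_metricE (t : R) p v w (P := to_complex p) (V := to_complex v) (W := to_complex w) :
  CP p -> is_tan P V -> is_tan P W ->
  CP_metric t p v w = 4 * n.+1%:R *
    complex.Re (2 * \tr (V *m P *m W) + (t - 2)%:C%C * \tr (tau P *m V *m P *m W)).
Proof.
move=> Mp tv tw; have [mX vX] := to_mP Mp tv; have [mY wY] := to_mP Mp tw.
have [ua au ta pa] := translationP Mp.
rewrite /CP_metric (form_mE n0 t mX mY) /V /W /P vX wY pa.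
move: (lie _ _) (lie _ _) => V0 W0; set a := translation p in ua au ta *.
have tr_a Z : \tr (a *m Z *m adj a) = \tr Z by rewrite mxtrace_mulC mulmxA ua mul1mx.
by rewrite (tau_sandwich ta) tauE0 !(unitary_sandwich ua) !tr_a.
Qed.

Lemma CP_JE p v (P := to_complex p) (V := to_complex v) : CP p -> is_tan P V ->
  to_complex (CP_J p v) = 'i%C *: (P *m V - V *m P).
Proof.
move=> Mp tv; have [mX vX] := to_mP Mp tv; have [ua au ta pa] := translationP Mp.
rewrite /CP_J of_complexK /translate (invmx_unitary ua) (base_projE R n0) (J_mE n0 mX).
rewrite /V /P vX pa !(unitary_sandwich ua) -scalemxAr -scalemxAl; congr (_ *: _).
by rewrite mulmxBr mulmxBl.
Qed.

Lemma conjRC (r : R) : (r%:C%C : C)^* = r%:C%C.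
Proof. by apply/eqP; rewrite eq_complex /= oppr0 !eqxx. Qed.

(** Boundedness for [|s| <= 1], which is what a second-order remainder requires. *)
Definition cbounded (f : R -> C) := exists K : R, forall s, `|s| <= 1 ->
  `|complex.Re (f s)| <= K /\ `|complex.Im (f s)| <= K.

Lemma cbounded_cst c : cbounded (fun=> c).
Proof.
exists (`|complex.Re c| + `|complex.Im c|) => s _; split.
  by rewrite lerDl.
by rewrite lerDr.
Qed.

Lemma cbounded_real : cbounded (fun s => s%:C%C).
Proof. by exists 1 => s s1 /=; rewrite normr0. Qed.

Lemma cboundedD f g : cbounded f -> cbounded g -> cbounded (fun s => f s + g s).
Proof.
move=> [K hK] [L hL]; exists (K + L) => s s1; have [a b] := hK s s1; have [c d] := hL s s1.
by rewrite ReD ImD; split; rewrite (le_trans (ler_normD _ _)) // lerD.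
Qed.

Lemma cboundedM f g : cbounded f -> cbounded g -> cbounded (fun s => f s * g s).
Proof.
move=> [K hK] [L hL]; exists (K * L + K * L) => s s1.
have [a b] := hK s s1; have [c d] := hL s s1.
by rewrite ReM ImM; split;
  rewrite (le_trans (ler_normD _ _)) // ?normrN lerD // normrM ler_pM.
Qed.

Lemma cboundedJ f : cbounded f -> cbounded (fun s => (f s)^*).
Proof. by move=> [K hK]; exists K => s /hK; rewrite ReJ ImJ normrN. Qed.

Lemma cbounded_sum (I : Type) (r : seq I) (f : I -> R -> C) :
  (forall i, cbounded (f i)) -> cbounded (fun s => \sum_(i <- r) f i s).
Proof.
move=> bf; elim: r => [|a r ih]; first by under eq_fun do rewrite big_nil; exact: cbounded_cst.
by under eq_fun do rewrite big_cons; exact: cboundedD.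
Qed.

Definition mbounded (f : R -> Mat) := forall i j, cbounded (fun s => f s i j).

Lemma mbounded_cst X : mbounded (fun=> X).
Proof. by move=> i j; exact: cbounded_cst. Qed.

Lemma mboundedD f g : mbounded f -> mbounded g -> mbounded (fun s => f s + g s).
Proof. by move=> bf bg i j; under eq_fun do rewrite mxE; exact: cboundedD. Qed.

Lemma mboundedM f g : mbounded f -> mbounded g -> mbounded (fun s => f s *m g s).
Proof.
by move=> bf bg i j; under eq_fun do rewrite mxE; apply: cbounded_sum => k; exact: cboundedM.
Qed.

Lemma mboundedZ (a : R -> C) f : cbounded a -> mbounded f -> mbounded (fun s => a s *: f s).
Proof. by move=> ba bf i j; under eq_fun do rewrite mxE; exact: cboundedM. Qed.

Lemma mbounded_adj f : mbounded f -> mbounded (fun s => adj (f s)).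
Proof. by move=> bf i j; under eq_fun do rewrite !mxE; exact: cboundedJ. Qed.

(** The rows of a unitary matrix are unit vectors. *)
Lemma mbounded_unitary f : (forall s, f s *m adj (f s) = 1%:M) -> mbounded f.
Proof.
move=> uf i j; exists 1 => s _.
have := congr1 (fun M : Mat => complex.Re (M i i)) (uf s).
rewrite !mxE eqxx /=; have ReS (r : seq 'I_N) (g : 'I_N -> C) :
    complex.Re (\sum_(k <- r) g k) = \sum_(k <- r) complex.Re (g k).
  by elim: r => [|a r ih]; rewrite ?big_nil // !big_cons ReD ih.
rewrite ReS (bigD1 j) //= => e.
have sq k : complex.Re (f s i k * (adj (f s)) k i) =
    complex.Re (f s i k) ^+ 2 + complex.Im (f s i k) ^+ 2.
  by rewrite !mxE; case: (f s i k) => x y /=; ring.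
have e1 : complex.Re (f s i j) ^+ 2 + complex.Im (f s i j) ^+ 2 <= 1.
  rewrite -[X in _ <= X]e sq lerDl sumr_ge0 // => k _.
  by rewrite sq addr_ge0 ?sqr_ge0.
by split; rewrite -(@ler_pXn2r _ 2) ?nnegrE // expr1n real_normK ?num_real //;
  apply: le_trans e1; rewrite ?lerDl ?lerDr sqr_ge0.
Qed.

Lemma ambient_norm_le X (K : R) : 0 <= K ->
  (forall i j, `|complex.Re (X i j)| <= K /\ `|complex.Im (X i j)| <= K) ->
  `|of_complex X| <= K.
Proof.
move=> K0 hX; rewrite prod_normE /= ge_max; apply/andP; split.
  rewrite [leLHS]/Num.Def.normr /= mx_normrE; apply: bigmax_le => //= i _.
  by rewrite mxE; have [] := hX i.1 i.2.
rewrite [leLHS]/Num.Def.normr /= mx_normrE; apply: bigmax_le => //= i _.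
by rewrite mxE; have [] := hX i.1 i.2.
Qed.

Lemma mbounded_derive X V (D : R -> Mat) : mbounded D ->
  is_derive (0 : R) (1 : R) (fun s => of_complex (X + s%:C%C *: V + (s ^+ 2)%:C%C *: D s))
    (of_complex V).
Proof.
move=> bD.
have [K K0 hK] : exists2 K : R, 0 < K & forall s, `|s| <= 1 -> `|of_complex (D s)| <= K.
  have fin i j : {K : R | forall s, `|s| <= 1 ->
      `|complex.Re (D s i j)| <= K /\ `|complex.Im (D s i j)| <= K}.
    exact: cid (bD i j).
  exists (\sum_i \sum_j `|sval (fin i j)| + 1).
    by rewrite ltr_wpDl // sumr_ge0 // => i _; rewrite sumr_ge0.
  move=> s s1; apply: ambient_norm_le.
    by rewrite addr_ge0 // sumr_ge0 // => i _; rewrite sumr_ge0.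
  move=> i j; have [a b] := svalP (fin i j) s s1.
  have le : sval (fin i j) <= \sum_i \sum_j `|sval (fin i j)| + 1.
    rewrite (le_trans (ler_norm _)) // (bigD1 i) //= (bigD1 j) //= -!addrA lerDl.
    rewrite !addr_ge0 // sumr_ge0 // => k _; rewrite sumr_ge0 //.
  by split; apply: le_trans le.
have lim : (fun h : R => h^-1 *: ((fun s => of_complex (X + s%:C%C *: V + (s ^+ 2)%:C%C *: D s))
     (h *: (1 : R) + 0) - of_complex (X + (0 : R)%:C%C *: V + ((0 : R) ^+ 2)%:C%C *: D 0))) @ 0^'
     --> of_complex V.
  apply/cvgrPdist_le => e e0; near=> h.
  have h0 : h != 0 by near: h; exact: nbhs_dnbhs_neq.
  rewrite [h *: (1 : R)]mulr1 addr0 expr0n /= !scale0r !addr0.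
  have -> : of_complex V - h^-1 *: (of_complex (X + h%:C%C *: V + (h ^+ 2)%:C%C *: D h) -
      of_complex X) = - (h *: of_complex (D h)).
    apply: (can_inj (@to_complexK R n)).
    rewrite to_complexN to_complexB !to_complexZ to_complexB !of_complexK.
    rewrite -[X + _ + _]addrA [X + _]addrC addrK scalerDr !scalerA -!rmorphM mulVf // scale1r.
    by rewrite opprD addrA subrr sub0r expr2 mulrA mulVf // mul1r.
  rewrite normrN normrZ.
  have h1 : `|h| <= 1 by near: h; exact: dnbhs0_le.
  rewrite (le_trans (ler_wpM2l _ (hK _ h1))) //.
  rewrite -ler_pdivlMr //; near: h; apply: dnbhs0_le; exact: divr_gt0.
by apply: DeriveDef; [apply/cvg_ex; exists (of_complex V); exact: lim|exact: cvg_lim lim].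
Unshelve.
all: by end_near.
Qed.

(** [L L^*] equals both its adjoint and the opposite of its adjoint. *)
Lemma skew_fixed (L Y : Mat) : adj Y = - Y -> L = L *m Y -> L = 0.
Proof.
move=> aY LY; have e : L *m adj L = L *m Y *m adj L by rewrite -LY.
have s1 : adj (L *m Y *m adj L) = - (L *m Y *m adj L).
  by rewrite !adjM adjK aY mulNmx mulmxN mulmxA.
have LL : L *m adj L = 0.
  have : L *m adj L = - (L *m adj L) by rewrite {2}e -s1 -e adjM adjK.
  by move=> /eqP; rewrite -addr_eq0 -mulr2n -scaler_nat scaler_eq0 pnatr_eq0 => /eqP.
have aL0 : adj L = 0 by apply: adj_sum_eq0; rewrite adjK LL mxtrace0.
by rewrite -[L]adjK aL0 adj0.
Qed.

Lemma skew_unit Y : adj Y = - Y -> 1%:M - Y \in unitmx.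
Proof.
move=> aY; rewrite -row_free_unit -kermx_eq0; apply/eqP.
have := mulmx_ker (1%:M - Y); move: (kermx _) => L.
rewrite mulmxBr mulmx1 => /eqP; rewrite subr_eq0 => /eqP.
exact: skew_fixed.
Qed.

Lemma tauV (U : Mat) : U \in unitmx -> tau (invmx U) = invmx (tau U).
Proof.
move=> Uu; have e : tau (invmx U) *m tau U = 1%:M by rewrite -tauM mulmxV // tau1.
have /mulmx1_unit[_ u] := e.
by rewrite -[LHS]mulmx1 -(mulmxV u) mulmxA e mul1mx.
Qed.

Lemma adjV (U : Mat) : U \in unitmx -> adj (invmx U) = invmx (adj U).
Proof.
move=> Uu; have e : adj (invmx U) *m adj U = 1%:M by rewrite -adjM mulmxV // adj1.
have /mulmx1_unit[_ u] := e.
by rewrite -[LHS]mulmx1 -(mulmxV u) mulmxA e mul1mx.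
Qed.

Lemma invmx_comm (A B : Mat) : A \in unitmx -> B \in unitmx -> A *m B = B *m A ->
  invmx B *m invmx A = invmx A *m invmx B.
Proof.
move=> uA uB AB; have u : A *m B \in unitmx by rewrite unitmx_mul uA uB.
apply: (can_inj (mulKmx u)).
have -> : A *m B *m (invmx B *m invmx A) = 1%:M.
  by rewrite mulmxA -(mulmxA A) (mulmxV uB) mulmx1 (mulmxV uA).
by rewrite AB mulmxA -(mulmxA B) (mulmxV uA) mulmx1 (mulmxV uB).
Qed.

Fact sum_perm (U : zmodType) (a b c d e : U) : a + b + (c - d) + e = a + b + (e + c - d).
Proof. by rewrite -!addrA; congr (_ + (_ + _)); rewrite addrA addrC. Qed.

Lemma conj_expand (z w : C) (X P B Bs Cs : Mat) : w = z * z ->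
  Cs = 1%:M - z *: X + w *: Bs ->
  (1%:M + z *: X + w *: B) *m P *m Cs =
  P + z *: (X *m P - P *m X) + w *: (B *m P *m Cs + (1%:M + z *: X) *m P *m Bs - X *m P *m X).
Proof.
move=> wz eC; set Z := z *: X.
have e1 (G : Mat) : (1%:M + Z) *m P *m (1%:M - Z + G) =
    P + (Z *m P - P *m Z) + ((1%:M + Z) *m P *m G - Z *m P *m Z) by mx_ring.
have e2 (L G : Mat) : (1%:M + Z + L) *m P *m G = (1%:M + Z) *m P *m G + L *m P *m G.
  by mx_ring.
have h1 : w *: B *m P *m Cs = w *: (B *m P *m Cs) by rewrite -!scalemxAl.
have h2 : (1%:M + Z) *m P *m (w *: Bs) = w *: ((1%:M + Z) *m P *m Bs) by rewrite -scalemxAr.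
have h3 : Z *m P - P *m Z = z *: (X *m P - P *m X).
  by rewrite /Z -scalemxAl -scalemxAr -scalerBr.
have h4 : Z *m P *m Z = w *: (X *m P *m X).
  by rewrite /Z -!scalemxAl -scalemxAr scalerA -wz.
rewrite e2 h1 {1}eC e1 h2 h3 h4 [w *: (_ - _)]scalerBr [w *: (_ + _)]scalerDr.
exact: sum_perm.
Qed.

(** A rational substitute for the exponential, mapping sp(n) to Sp(n) with an explicit
    second-order remainder. *)
Definition cayley Y : Mat := invmx (1%:M - Y) *m (1%:M + Y).

Lemma cayleyP Y : adj Y = - Y -> tau Y = - Y ->
  [/\ adj (cayley Y) *m cayley Y = 1%:M, tau (cayley Y) = adj (cayley Y) &
      cayley Y = 1%:M + Y *+ 2 + Y *m Y *m (1%:M + cayley Y)].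
Proof.
move=> aY tY; have Uu := skew_unit aY.
have Wu : 1%:M + Y \in unitmx.
  by have := @skew_unit (- Y); rewrite adjN aY opprK; apply.
have UW : (1%:M - Y) *m (1%:M + Y) = (1%:M + Y) *m (1%:M - Y) by mx_ring.
have aC : adj (cayley Y) = (1%:M - Y) *m invmx (1%:M + Y).
  by rewrite /cayley adjM adjV // adjB adjD adj1 aY opprK.
split.
- have -> : adj (cayley Y) *m cayley Y = (1%:M - Y) *m (invmx (1%:M + Y) *m
      invmx (1%:M - Y)) *m (1%:M + Y) by rewrite aC !mulmxA.
  have -> : invmx (1%:M + Y) *m invmx (1%:M - Y) = invmx (1%:M - Y) *m invmx (1%:M + Y).
    exact: invmx_comm UW.
  by rewrite mulmxA mulmxV // mul1mx mulVmx.
- by rewrite aC /cayley tauM tauV // tauB tauD tau1 tY opprK.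
have e : cayley Y = 1%:M + Y + Y *m cayley Y.
  apply/eqP; rewrite -subr_eq; apply/eqP.
  by rewrite -[X in X - _]mul1mx -mulmxBl /cayley mulmxA mulmxV // mul1mx.
have -> : 1%:M + Y *+ 2 + Y *m Y *m (1%:M + cayley Y) =
   1%:M + Y + Y *m (1%:M + Y + Y *m cayley Y) by rewrite mulr2n; mx_ring.
by rewrite -!e.
Qed.

(** The curve conjugates [P] by the Cayley transform of [(s / 2) X], where [X] lifts the
    tangent vector; it agrees to first order with conjugation by [exp (s X)]. *)
Lemma tangent_curve p (v : ambient R n) : CP p -> is_tan (to_complex p) (to_complex v) ->
  tangent (@CP R n) p v.
Proof.
move=> Mp; have /CPP[a [ua au ta pa]] := Mp.
rewrite pa => /(is_tan_conj ua au) [aV hV].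
have [X0 [hX aX XV]] := tangent_lift aV hV.
pose X := a *m X0 *m adj a.
have aX' : adj X = - X by rewrite /X !adjM adjK aX mulNmx mulmxN mulmxA.
have tX' : tau X = - X by rewrite /X (tau_sandwich ta) hX mulmxN mulNmx.
pose Y (s : R) := (s / 2)%:C%C *: X.
have aY s : adj (Y s) = - Y s.
  by rewrite /Y adjZ aX' scalerN conjRC.
have tY s : tau (Y s) = - Y s by rewrite /Y tauZ tX' scalerN.
pose c s := of_complex (cayley (Y s) *m to_complex p *m adj (cayley (Y s))).
have uC s := let: And3 h _ _ := cayleyP (aY s) (tY s) in h.
have tC s := let: And3 _ h _ := cayleyP (aY s) (tY s) in h.
have eC s := let: And3 _ _ h := cayleyP (aY s) (tY s) in h.
have Y2 s : Y s *+ 2 = s%:C%C *: X.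
  rewrite /Y -scaler_nat scalerA; congr (_ *: _).
  by rewrite mulrC -(rmorph_nat (real_complex R)) -rmorphM divfK.
have YY s : Y s *m Y s = (s ^+ 2)%:C%C *: ((4^-1)%:C%C *: (X *m X)).
  rewrite /Y -scalemxAl -scalemxAr !scalerA -!rmorphM; congr (_%:C%C *: _).
  by field.
pose B s := (4^-1)%:C%C *: (X *m X *m (1%:M + cayley (Y s))).
have CB s : cayley (Y s) = 1%:M + s%:C%C *: X + (s ^+ 2)%:C%C *: B s.
  by rewrite {1}eC Y2 YY -!scalemxAl.
have bC : mbounded (fun s => cayley (Y s)).
  by apply: mbounded_unitary => s; apply: mulmx1C.
have bB : mbounded B.
  apply: mboundedZ; first exact: cbounded_cst.
  apply: mboundedM; first exact: mbounded_cst.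
  by apply: mboundedD => //; exact: mbounded_cst.
set P := to_complex p.
pose D s := B s *m P *m adj (cayley (Y s)) + (1%:M + s%:C%C *: X) *m P *m adj (B s)
            - X *m P *m X.
have cE s : cayley (Y s) *m P *m adj (cayley (Y s)) =
    P + s%:C%C *: (X *m P - P *m X) + (s ^+ 2)%:C%C *: D s.
  have aCB : adj (cayley (Y s)) = 1%:M - s%:C%C *: X + (s ^+ 2)%:C%C *: adj (B s).
    by rewrite {1}CB !adjD adj1 !adjZ aX' scalerN !conjRC.
  rewrite {1}CB; apply: conj_expand => //.
  by rewrite -rmorphM expr2.
have bD : mbounded D.
  have bN f : mbounded f -> mbounded (fun s => - f s).
    move=> bf; under eq_fun do rewrite -scaleN1r.
    by apply: mboundedZ => //; exact: cbounded_cst.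
  apply: mboundedD; last by apply: bN; exact: mbounded_cst.
  apply: mboundedD.
    apply: mboundedM; last exact: mbounded_adj.
    by apply: mboundedM => //; exact: mbounded_cst.
  apply: mboundedM; last exact: mbounded_adj.
  apply: mboundedM; last exact: mbounded_cst.
  apply: mboundedD; first exact: mbounded_cst.
  by apply: mboundedZ; [exact: cbounded_real|exact: mbounded_cst].
have XPv : X *m P - P *m X = to_complex v.
  rewrite /X /P pa !(unitary_sandwich ua).
  have -> : a *m (X0 *m E) *m adj a - a *m (E *m X0) *m adj a = a *m lie X0 E *m adj a.
    by rewrite /lie mulmxBr mulmxBl.
  by rewrite XV !mulmxA au mul1mx -mulmxA au mulmx1.
exists c; split.
- by rewrite /c cE expr0n /= !scale0r !addr0 to_complexK.
- rewrite (_ : c = fun s => of_complex (P + s%:C%C *: (X *m P - P *m X) + (s ^+ 2)%:C%C *: D s)).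
    by have := mbounded_derive P (X *m P - P *m X) bD; rewrite XPv to_complexK.
  by apply/funext => s; rewrite /c cE.
- near=> s; apply/CPP; exists (cayley (Y s) *m a); split.
  + by rewrite adjM mulmxA -[_ *m adj _ *m _]mulmxA uC mulmx1.
  + by rewrite adjM mulmxA -[_ *m a *m _]mulmxA au mulmx1; apply: mulmx1C.
  + by rewrite tauM ta tC adjM.
  + by rewrite /c of_complexK pa !adjM !mulmxA.
Unshelve.
all: by end_near.
Qed.

End ProjectiveSpace.

(** * Derivatives of vector fields on the ambient space *)

Section AmbientCalculus.
Variables (R : realType) (n : nat).
Local Notation C := R[i].
Local Notation A := (ambient R n).
Local Notation N := (n + n)%N.
Implicit Types (p u v w : A).

Definition coord (k : bool * ('I_N * 'I_N)) (x : A) : R :=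
  if k.1 then re_coord k.2.1 k.2.2 x else im_coord k.2.1 k.2.2 x.

Lemma coord_linear k : linear (coord k).
Proof. by move=> a x y; rewrite /coord; case: k.1; rewrite linearP. Qed.
HB.instance Definition _ k := GRing.isLinear.Build R A R *%R (coord k) (coord_linear k).

Lemma coord_continuous k : continuous (coord k).
Proof.
by case: k => -[] [i j]; [exact: (@re_coord_continuous _ _ i j)|exact: (@im_coord_continuous _ _ i j)].
Qed.

Definition basis (k : bool * ('I_N * 'I_N)) : A :=
  if k.1 then (delta_mx k.2.1 k.2.2, 0) else (0, delta_mx k.2.1 k.2.2).

Lemma coord_sum x : x = \sum_k coord k x *: basis k.
Proof.
rewrite [LHS]ambient_sum -(pair_bigA _ (fun z ij => coord (z, ij) x *: basis (z, ij))) /=.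
rewrite big_bool /=; congr (_ + _).
  by rewrite -(pair_bigA _ (fun i j => coord (true, (i, j)) x *: basis (true, (i, j)))).
by rewrite -(pair_bigA _ (fun i j => coord (false, (i, j)) x *: basis (false, (i, j)))).
Qed.

Lemma coord_eq x y : (forall k, coord k x = coord k y) -> x = y.
Proof. by move=> e; rewrite [x]coord_sum [y]coord_sum; apply: eq_bigr => k _; rewrite e. Qed.

Lemma smooth_coord (X : A -> A) k : smooth X -> smooth (fun p => coord k (X p)).
Proof. by move=> sX; exact: (smooth_linear (@coord_continuous k) sX). Qed.

Lemma derive_coord (X : A -> A) k p v : smooth X ->
  'D_v (fun q => coord k (X q)) p = coord k ('D_v X p).
Proof. by move=> sX; exact: (derive_linear v (@coord_continuous k) (smooth_diff p sX)). Qed.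

Lemma coord_smooth (X : A -> A) : (forall k, smooth (fun p => coord k (X p))) -> smooth X.
Proof.
move=> sX; rewrite (_ : X = fun p => \sum_k coord k (X p) *: basis k).
  by apply: smooth_sum => k; exact: smooth_scalel.
by apply/funext => p; exact: coord_sum.
Qed.

Lemma derive_field_sum (f : A -> R) (X : A -> A) : smooth f ->
  (fun q => 'D_(X q) f q) = (fun q => \sum_k coord k (X q) * 'D_(basis k) f q).
Proof.
move=> sf; apply/funext => q; rewrite {1}[X q]coord_sum derive_dir_sum //.
by apply: eq_bigr => k _; rewrite derive_dirZ.
Qed.

Lemma smooth_derive_field_real (f : A -> R) (X : A -> A) : smooth f -> smooth X ->
  smooth (fun q => 'D_(X q) f q).
Proof.
move=> sf sX; rewrite derive_field_sum //; apply: smooth_sum => k.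
by apply: smoothM; [exact: smooth_coord|exact: smooth_derive].
Qed.

Lemma derive_sumR (I : Type) (r : seq I) (F : I -> A -> R) p v : (forall i, smooth (F i)) ->
  'D_v (fun q => \sum_(i <- r) F i q) p = \sum_(i <- r) 'D_v (F i) p.
Proof.
move=> sF; elim: r => [|a r ih].
  by under eq_fun do rewrite big_nil; rewrite derive_cst big_nil.
under eq_fun do rewrite big_cons.
have d (G : A -> R) : smooth G -> derivable G p v by exact: smooth_derivable.
rewrite (deriveD (d _ (sF a)) (d _ (smooth_sum _ _ sF))) ih big_cons //.
Qed.

Lemma derive_mul (f g : A -> R) p v : smooth f -> smooth g ->
  'D_v (fun q => f q * g q) p = 'D_v f p * g p + f p * 'D_v g p.
Proof.
move=> sf sg; have d (h : A -> R) : smooth h -> derivable h p v by exact: smooth_derivable.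
by rewrite (deriveM (d _ sf) (d _ sg)) /GRing.scale /= addrC mulrC.
Qed.

Lemma derive_field_real (f : A -> R) (X : A -> A) p v : smooth f -> smooth X ->
  'D_v (fun q => 'D_(X q) f q) p = 'D_('D_v X p) f p + 'D_v (fun q => 'D_(X p) f q) p.
Proof.
move=> sf sX.
have e1 := congr1 (fun G => 'D_v G p) (derive_field_sum X sf).
have e2 := congr1 (fun G => 'D_v G p) (derive_field_sum (fun=> X p) sf).
have e3 := congr1 (fun G => G p) (derive_field_sum (fun=> 'D_v X p) sf).
apply: (etrans e1); rewrite -[X in _ = _ + X]/((fun G => 'D_v G p) _) [X in _ = _ + X]e2.
rewrite [X in _ = X + _]e3 /=.
rewrite derive_sumR; last first.
  by move=> k; apply: smoothM; [exact: smooth_coord|exact: smooth_derive].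
rewrite derive_sumR; last first.
  by move=> k; apply: smoothM; [exact: smooth_cst|exact: smooth_derive].
rewrite -big_split /=; apply: eq_bigr => k _.
rewrite derive_mul; [|exact: smooth_coord|exact: smooth_derive].
rewrite derive_mul; [|exact: smooth_cst|exact: smooth_derive].
by rewrite derive_coord // (derive_cst (coord k (X p))) mul0r add0r.
Qed.

Section FieldDerivative.
Variables (Y X : A -> A) (sY : smooth Y) (sX : smooth X).

Lemma coord_derive_field k :
  (fun q => coord k ('D_(X q) Y q)) = (fun q => 'D_(X q) (fun r => coord k (Y r)) q).
Proof. by apply/funext => q; rewrite derive_coord. Qed.

Lemma smooth_derive_field : smooth (fun q => 'D_(X q) Y q).
Proof.
apply: coord_smooth => k; rewrite coord_derive_field.
by apply: smooth_derive_field_real => //; exact: smooth_coord.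
Qed.

End FieldDerivative.

Lemma coord_derive2 (Y : A -> A) k p v u : smooth Y ->
  coord k ('D_v (fun q => 'D_u Y q) p) = 'D_v (fun q => 'D_u (fun r => coord k (Y r)) q) p.
Proof.
move=> sY; apply: (etrans (esym (@derive_coord _ k p v (smooth_derive u sY)))).
by congr ('D_v _ p); apply/funext => q; rewrite derive_coord.
Qed.

(** Expanding the direction [X q] in a fixed basis separates the derivative of the
    direction from the second derivative of [Y]. *)
Lemma derive_field (Y X : A -> A) p v : smooth Y -> smooth X ->
  'D_v (fun q => 'D_(X q) Y q) p = 'D_('D_v X p) Y p + 'D_v (fun q => 'D_(X p) Y q) p.
Proof.
move=> sY sX; apply: coord_eq => k.
have h1 : coord k ('D_('D_v X p) Y p) = 'D_('D_v X p) (fun r => coord k (Y r)) p.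
  by apply: esym; exact: derive_coord.
have h2 := coord_derive2 k p v (X p) sY.
have h3 := @derive_coord _ k p v (smooth_derive_field sY sX).
apply: (etrans (esym h3)); apply: (etrans _ (esym (linearD (coord k) _ _))).
apply: (etrans _ (esym (f_equal2 +%R h1 h2))).
have e := congr1 (fun G => 'D_v G p) (coord_derive_field X sY k).
by apply: (etrans e); apply: derive_field_real => //; exact: smooth_coord.
Qed.

Lemma schwarz_field (Y : A -> A) p u v : smooth Y ->
  'D_v (fun q => 'D_u Y q) p = 'D_u (fun q => 'D_v Y q) p.
Proof.
move=> sY; apply: coord_eq => k.
have h1 := coord_derive2 k p v u sY; have h2 := coord_derive2 k p u v sY.
by apply: (etrans h1); apply: (etrans _ (esym h2)); apply: schwarz; exact: smooth_coord.
Qed.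

Lemma smooth_scale (f : A -> R) (X : A -> A) : smooth f -> smooth X -> smooth (fun q => f q *: X q).
Proof.
move=> sf sX; apply: coord_smooth => k; under eq_fun do rewrite linearZ /=.
by apply: smoothM => //; exact: smooth_coord.
Qed.

Lemma derive_scale (f : A -> R) (X : A -> A) p v : smooth f -> smooth X ->
  'D_v (fun q => f q *: X q) p = 'D_v f p *: X p + f p *: 'D_v X p.
Proof.
move=> sf sX; apply: coord_eq => k; rewrite -derive_coord; last exact: smooth_scale.
under eq_fun do rewrite linearZ /=.
by rewrite derive_mul ?derive_coord ?linearD ?linearZ //; exact: smooth_coord.
Qed.

End AmbientCalculus.

(** * Algebra of odd matrices at a projection *)

Fact gam_key : unit. Proof. exact: tt. Qed.

Section OddAlgebra.
Variables (K : comNzRingType) (N : nat).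
Local Notation M := 'M[K]_N.
Implicit Types (P Q X Y Z V W : M).

(** Tangent vectors at a projection [P] are the odd elements for the
    involution [2P - 1]. *)
Definition odd P X := P *m X + X *m P = X.

Section Odd.
Variables (P : M) (PP : P *m P = P).

Lemma odd_r X : odd P X -> X *m P = X - P *m X.
Proof. by move=> oX; rewrite -{2}oX [P *m X + _]addrC addrK. Qed.

Lemma odd_rA X W : odd P X -> W *m X *m P = W *m X - W *m P *m X.
Proof. by move=> oX; rewrite -mulmxA (odd_r oX) mulmxBr mulmxA. Qed.

Lemma odd_PXP X : odd P X -> P *m X *m P = 0.
Proof. by move=> oX; rewrite (odd_rA P oX) PP subrr. Qed.

Lemma odd_odd X Y : odd P X -> odd P Y -> X *m Y *m P = P *m X *m Y.
Proof.
by move=> oX oY; rewrite (odd_rA X oY) (odd_r oX) mulmxBl opprB addrC subrK.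
Qed.

Lemma tr_odd W V : odd P V -> P *m W *m P = W *m P -> \tr (W *m P *m V) = 0.
Proof.
move=> oV eW; rewrite -eW -!mulmxA mxtrace_mulC !mulmxA.
have -> : W *m P *m V *m P = W *m (P *m V *m P) by rewrite !mulmxA.
by rewrite odd_PXP // mulmx0 mxtrace0.
Qed.

Variables (Q : M) (QQ : Q *m Q = Q) (PQ : P *m Q = 0) (QP : Q *m P = 0).

(** [gam0] is the correction that keeps derivatives of tangent fields tangent, that is,
    the Fubini-Study connection. [gam1], where [X'] stands for [tau X], takes tangent values
    and accounts for the part of the metric that involves [Q]. *)
Definition gam0 := locked_with gam_key
  (fun X Y => (P + P - 1%:M) *m (X *m Y + Y *m X)).
Definition gam1 := locked_with gam_key
  (fun X' Y => Q *m X' *m Y *m P + P *m Y *m X' *m Q).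
Lemma gam0E X Y : gam0 X Y = (P + P - 1%:M) *m (X *m Y + Y *m X).
Proof. by rewrite /gam0 unlock. Qed.
Lemma gam1E X' Y : gam1 X' Y = Q *m X' *m Y *m P + P *m Y *m X' *m Q.
Proof. by rewrite /gam1 unlock. Qed.

Lemma gam1_odd X' Y : odd P (gam1 X' Y).
Proof.
rewrite /odd !gam1E.
have -> : P *m (Q *m X' *m Y *m P + P *m Y *m X' *m Q) +
   (Q *m X' *m Y *m P + P *m Y *m X' *m Q) *m P =
   (P *m Q) *m X' *m Y *m P + (P *m P) *m Y *m X' *m Q + Q *m X' *m Y *m (P *m P)
   + P *m Y *m X' *m (Q *m P) by mx_ring.
by rewrite PQ QP PP !mul0mx !mulmx0 add0r addr0 addrC.
Qed.

Lemma even_gam0 X Y : odd P X -> odd P Y -> gam0 X Y *m P = P *m gam0 X Y /\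
   P *m gam0 X Y = P *m (X *m Y + Y *m X).
Proof.
move=> oX oY; have e : (X *m Y + Y *m X) *m P = P *m (X *m Y + Y *m X).
  by rewrite mulmxDl mulmxDr !mulmxA (odd_odd oX oY) (odd_odd oY oX).
have h : P *m gam0 X Y = P *m (X *m Y + Y *m X).
  rewrite !gam0E mulmxA; congr (_ *m _).
  by rewrite mulmxBr mulmxDr PP mulmx1 addrK.
split=> //; rewrite h !gam0E -mulmxA e mulmxA.
by congr (_ *m _); rewrite mulmxBl mulmxDl PP mul1mx addrK.
Qed.

(** [Z] is the ordinary derivative of a tangent field [Y] along [X]: the hypothesis is the
    derivative of [odd P Y], which determines the even part of [Z], and [gam0] removes it. *)
Lemma odd_covariant X Y Z : odd P X -> odd P Y ->
  X *m Y + P *m Z + (Z *m P + Y *m X) = Z -> odd P (Z + gam0 X Y).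
Proof.
move=> oX oY hZ; have [e1 e2] := even_gam0 oX oY.
rewrite /odd mulmxDl mulmxDr e1 e2.
have -> : gam0 X Y = P *m (X *m Y + Y *m X) + P *m (X *m Y + Y *m X) - (X *m Y + Y *m X).
  by rewrite !gam0E; mx_ring.
rewrite -[X in _ = X + _]hZ; mx_ring.
Qed.

Lemma gam0_J X Y : odd P X -> odd P Y ->
  X *m Y - Y *m X + gam0 X (P *m Y - Y *m P) = P *m gam0 X Y - gam0 X Y *m P.
Proof.
move=> oX oY; have [-> _] := even_gam0 oX oY; rewrite subrr.
have -> : gam0 X (P *m Y - Y *m P) = (P + P - 1%:M) *m ((X *m P) *m Y - X *m Y *m P +
    P *m Y *m X - (Y *m P) *m X) by rewrite !gam0E; mx_ring.
rewrite (odd_odd oX oY) (odd_r oX) (odd_r oY).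
have -> : X *m Y - Y *m X + (P + P - 1%:M) *m ((X - P *m X) *m Y - P *m X *m Y +
   P *m Y *m X - (Y - P *m Y) *m X) = (P - P *m P) *m (X *m Y) *+ 4 - (P - P *m P) *m (Y *m X) *+ 4.
  by rewrite !mulrS; mx_ring.
by rewrite PP subrr !mul0mx !mul0rn subrr.
Qed.

Lemma gam1_J X' Y : odd P Y ->
  gam1 X' (P *m Y - Y *m P) = P *m gam1 X' Y - gam1 X' Y *m P.
Proof.
move=> oY; have PYP := odd_PXP oY.
have -> : gam1 X' (P *m Y - Y *m P) = Q *m X' *m (P *m Y *m P) - Q *m X' *m Y *m (P *m P)
   + (P *m P) *m Y *m X' *m Q - (P *m Y *m P) *m X' *m Q by rewrite !gam1E; mx_ring.
have -> : P *m gam1 X' Y - gam1 X' Y *m P = (P *m Q) *m X' *m Y *m P + (P *m P) *m Y *m X' *m Q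
   - Q *m X' *m Y *m (P *m P) - P *m Y *m X' *m (Q *m P) by rewrite !gam1E; mx_ring.
by rewrite PYP PP PQ QP !mul0mx !mulmx0 sub0r subr0 add0r subr0 addrC.
Qed.

(** [gam1] is complex bilinear for the complex structures [i[P, -]] and
    [-i[Q, -]]; this kills the (1,1)-part of the torsion. *)
Lemma gam1_bilin X' Y : odd Q X' -> odd P Y ->
  gam1 (X' *m Q - Q *m X') Y = gam1 X' (P *m Y - Y *m P).
Proof.
move=> oX oY.
have PYP := odd_PXP oY.
have QXQ : Q *m X' *m Q = 0.
  have := congr1 (fun A => Q *m A) oX; rewrite mulmxDr !mulmxA QQ => /eqP.
  by rewrite -subr_eq0 addrC addKr => /eqP.
have -> : gam1 (X' *m Q - Q *m X') Y = (Q *m X' *m Q) *m Y *m P - (Q *m Q) *m X' *m Y *m P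
   + P *m Y *m X' *m (Q *m Q) - P *m Y *m (Q *m X' *m Q) by rewrite !gam1E; mx_ring.
have -> : gam1 X' (P *m Y - Y *m P) = Q *m X' *m (P *m Y *m P) - Q *m X' *m Y *m (P *m P)
   + (P *m P) *m Y *m X' *m Q - (P *m Y *m P) *m X' *m Q by rewrite !gam1E; mx_ring.
by rewrite PYP PP QQ QXQ !mul0mx !mulmx0 !sub0r !subr0.
Qed.

(** A product of an odd matrix with one commuting with [P] has trace zero. *)
Lemma metric_gam0 S X Y Z : odd P X -> odd P Y -> odd P Z -> S *m P = P *m S ->
  [/\ \tr (S *m Y *m X *m Z) = 0, \tr (S *m gam0 X Y *m P *m Z) = 0 &
      \tr (S *m Y *m P *m gam0 X Z) = 0].
Proof.
move=> oX oY oZ SP.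
have ev W V : odd P V -> W *m P = P *m W -> \tr (W *m V) = 0.
  move=> oV WP; have z : \tr (W *m P *m V) = 0.
    by apply: tr_odd => //; rewrite -WP -mulmxA PP.
  rewrite -[V in LHS]oV mulmxDr mxtraceD mulmxA z add0r mulmxA mxtrace_mulC mulmxA.
  by rewrite -WP.
have [e1 e2] := even_gam0 oX oY; have [e3 e4] := even_gam0 oX oZ.
split.
- apply: ev => //; rewrite -!mulmxA [Y *m (X *m P)]mulmxA (odd_odd oY oX).
  by rewrite !mulmxA SP.
- move: (gam0 X Y) e1 => G e1; apply: ev => //.
  have SGP : S *m G *m P = P *m (S *m G) by rewrite -mulmxA e1 !mulmxA SP.
  by rewrite SGP -mulmxA SGP.
- move: (gam0 X Z) e3 => G e3; rewrite -!mulmxA mxtrace_mulC -mulmxA mxtrace_mulC.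
  apply: ev => //; rewrite -!mulmxA SP [G *m (P *m S)]mulmxA e3 !mulmxA PP //.
Qed.

Section Curvature.
Variables (X Y Z X' Y' : M).
Hypotheses (oX : odd P X) (oY : odd P Y) (oZ : odd P Z).
Hypotheses (oX' : odd Q X') (oY' : odd Q Y').

(** Derivatives of [gam0] and [gam1] in the base point, [A] and [A'] being the variations
    of [P] and [Q]. *)
Definition dgam0 (A B D : M) := (A + A) *m (B *m D + D *m B).
Definition dgam1 (A A' B' D : M) :=
  A' *m B' *m D *m P + Q *m B' *m D *m A + (A *m D *m B' *m Q + P *m D *m B' *m A').

(** The curvature is a polynomial of degree 2 in the coefficient of [gam1]. Its constant
    term is the double bracket of a symmetric space. *)
Lemma curv_order0 :
  dgam0 X Y Z + gam0 X (gam0 Y Z) - (dgam0 Y X Z + gam0 Y (gam0 X Z)) =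
  (X *m Y - Y *m X) *m Z - Z *m (X *m Y - Y *m X).
Proof.
have key (A B : M) : odd P A -> odd P B ->
    dgam0 A B Z + gam0 A (gam0 B Z) = A *m (B *m Z + Z *m B) + (B *m Z + Z *m B) *m A.
  move=> oA oB; have -> : dgam0 A B Z + gam0 A (gam0 B Z) =
    (A + A) *m (B *m Z + Z *m B) + (P + P - 1%:M) *m
      ((A *m P) *m (B *m Z + Z *m B) *+ 2 - A *m (B *m Z + Z *m B)
       + (P + P - 1%:M) *m (B *m Z + Z *m B) *m A).
    by rewrite /dgam0 !gam0E mulr2n; mx_ring.
  rewrite (odd_r oA); set m := B *m Z + Z *m B.
  have -> : (A + A) *m m + (P + P - 1%:M) *m ((A - P *m A) *m m *+ 2 - A *m m
       + (P + P - 1%:M) *m m *m A) =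
    A *m m + m *m A + (P - P *m P) *m A *m m *+ 4 - (P - P *m P) *m m *m A *+ 4.
    by rewrite !mulrS; mx_ring.
  by rewrite PP subrr !mul0mx !mul0rn addr0 subr0.
rewrite !key //; mx_ring.
Qed.

(** Curvature operators are odd, hence determined by the block below the diagonal, and
    the quadratic term has no such block. *)
Lemma curv_order2 : (1%:M - P) *m gam1 X' (gam1 Y' Z) *m P = 0.
Proof.
have QXQ : Q *m X' *m Q = 0.
  have := congr1 (fun A => Q *m A) oX'; rewrite mulmxDr !mulmxA QQ => /eqP.
  by rewrite -subr_eq0 addrC addKr => /eqP.
have -> : (1%:M - P) *m gam1 X' (gam1 Y' Z) *m P =
    (1%:M - P) *m ((Q *m X' *m Q) *m Y' *m Z *m P *m P *m P
                   + Q *m X' *m P *m Z *m Y' *m (Q *m P) *m P)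
    + (P - P *m P) *m gam1 Y' Z *m X' *m Q *m P by rewrite !gam1E; mx_ring.
by rewrite QXQ QP PP subrr !(mul0mx, mulmx0, addr0).
Qed.

Lemma curv_order1 : (1%:M - P) *m (dgam1 X X' Y' Z + gam0 X (gam1 Y' Z) + gam1 X' (gam0 Y Z)
   - (dgam1 Y Y' X' Z + gam0 Y (gam1 X' Z) + gam1 Y' (gam0 X Z))) *m P =
   (1%:M - P) *m ((X' *m Y' - Y' *m X') *m Z + Q *m (X' *m Y - Y' *m X) *m Z) *m P.
Proof.
have P1 : (1%:M - P) *m P = 0 by rewrite mulmxBl mul1mx PP subrr.
have g0 (A B' : M) : odd P A -> (1%:M - P) *m gam0 A (gam1 B' Z) *m P = 0.
  move=> oA; have AQ : (1%:M - P) *m A *m Q = 0.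
    have AQ0 : A *m Q = P *m A *m Q.
      by rewrite -{1}oA mulmxDl -[A *m P *m Q]mulmxA PQ mulmx0 addr0.
    by rewrite -mulmxA AQ0 !mulmxA P1 !mul0mx.
  have -> : (1%:M - P) *m gam0 A (gam1 B' Z) *m P =
     (((1%:M - P) *m P) *+ 2 - 1%:M + P) *m (A *m gam1 B' Z + gam1 B' Z *m A) *m P.
    by rewrite !gam0E mulr2n; mx_ring.
  rewrite P1 mul0rn sub0r.
  have -> : (- 1%:M + P) *m (A *m gam1 B' Z + gam1 B' Z *m A) *m P =
     - ((1%:M - P) *m A *m Q) *m B' *m Z *m P *m P - (1%:M - P) *m A *m P *m Z *m B' *m (Q *m P)
     - (1%:M - P) *m Q *m B' *m Z *m (P *m A *m P) - ((1%:M - P) *m P) *m Z *m B' *m Q *m A *m P.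
    by rewrite !gam1E; mx_ring.
  by rewrite AQ QP (odd_PXP oA) P1 !(mul0mx, mulmx0, oppr0, addr0, subr0).
have g1 (A' B : M) : odd P B ->
    (1%:M - P) *m gam1 A' (gam0 B Z) *m P = (1%:M - P) *m Q *m A' *m (B *m Z + Z *m B) *m P.
  move=> oB; have [e1 e2] := even_gam0 oB oZ.
  have -> : (1%:M - P) *m gam1 A' (gam0 B Z) *m P =
     (1%:M - P) *m Q *m A' *m (gam0 B Z *m P) *m P
     + ((1%:M - P) *m P) *m gam0 B Z *m A' *m Q *m P by rewrite !gam1E; mx_ring.
  rewrite P1 !mul0mx addr0 e1 e2.
  have -> : P *m (B *m Z + Z *m B) = (B *m Z + Z *m B) *m P.
    by rewrite mulmxDl mulmxDr !mulmxA (odd_odd oB oZ) (odd_odd oZ oB).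
  by rewrite -!mulmxA PP.
have key (A B A' B' : M) : odd P A -> odd P B ->
    (1%:M - P) *m (dgam1 A A' B' Z + gam0 A (gam1 B' Z) + gam1 A' (gam0 B Z)) *m P =
    (1%:M - P) *m (A' *m B' *m Z + Q *m B' *m Z *m A + Q *m A' *m (B *m Z + Z *m B)) *m P.
  move=> oA oB.
  have -> : (1%:M - P) *m (dgam1 A A' B' Z + gam0 A (gam1 B' Z) + gam1 A' (gam0 B Z)) *m P =
     (1%:M - P) *m A' *m B' *m Z *m (P *m P) + (1%:M - P) *m Q *m B' *m Z *m A *m P
     + (1%:M - P) *m A *m Z *m B' *m (Q *m P) + ((1%:M - P) *m P) *m Z *m B' *m A' *m P
     + (1%:M - P) *m gam0 A (gam1 B' Z) *m P + (1%:M - P) *m gam1 A' (gam0 B Z) *m P.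
    by rewrite /dgam1; mx_ring.
  by rewrite (g0 _ _ oA) (g1 _ _ oB) PP QP P1 !(mul0mx, mulmx0, addr0); mx_ring.
by rewrite mulmxBr mulmxBl (key _ _ _ _ oX oY) (key _ _ _ _ oY oX); mx_ring.
Qed.

End Curvature.
End Odd.
End OddAlgebra.

(** * The Christoffel form of the Chern connection *)

Section GamBilinear.
Variables (K : comNzRingType) (N : nat).
Local Notation M := 'M[K]_N.
Implicit Types (P Q X Y Z V W : M).

Lemma gam0Dl P X Y Z : gam0 P (X + Y) Z = gam0 P X Z + gam0 P Y Z.
Proof. by rewrite !gam0E; mx_ring. Qed.
Lemma gam0Dr P X Y Z : gam0 P X (Y + Z) = gam0 P X Y + gam0 P X Z.
Proof. by rewrite !gam0E; mx_ring. Qed.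
Lemma gam0Zl P c X Y : gam0 P (c *: X) Y = c *: gam0 P X Y.
Proof. by rewrite !gam0E -scalemxAl -!scalemxAr -scalerDr -scalemxAr. Qed.
Lemma gam0Zr P c X Y : gam0 P X (c *: Y) = c *: gam0 P X Y.
Proof. by rewrite !gam0E -scalemxAl -!scalemxAr -scalerDr -scalemxAr. Qed.
Lemma gam1Dl P Q X Y Z : gam1 P Q (X + Y) Z = gam1 P Q X Z + gam1 P Q Y Z.
Proof. by rewrite !gam1E; mx_ring. Qed.
Lemma gam1Dr P Q X Y Z : gam1 P Q X (Y + Z) = gam1 P Q X Y + gam1 P Q X Z.
Proof. by rewrite !gam1E; mx_ring. Qed.
Lemma gam1Zl P Q c X Y : gam1 P Q (c *: X) Y = c *: gam1 P Q X Y.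
Proof. by rewrite !gam1E -!(scalemxAl, scalemxAr) scalerDr. Qed.
Lemma gam1Zr P Q c X Y : gam1 P Q X (c *: Y) = c *: gam1 P Q X Y.
Proof. by rewrite !gam1E -!scalemxAr -!scalemxAl scalerDr. Qed.

Lemma gam1_leibniz P Q X Y (P' Q' X' Y' : M) :
  Q' *m X *m Y *m P + Q *m X' *m Y *m P + Q *m X *m Y' *m P + Q *m X *m Y *m P' +
  (P' *m Y *m X *m Q + P *m Y' *m X *m Q + P *m Y *m X' *m Q + P *m Y *m X *m Q') =
  dgam1 P Q P' Q' X Y + gam1 P Q X' Y + gam1 P Q X Y'.
Proof. by rewrite /dgam1 !gam1E; mx_ring. Qed.

End GamBilinear.

Section Christoffel.
Variables (R : realType) (n : nat) (n0 : (0 < n)%N) (t : R).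
Local Notation C := R[i].
Local Notation A := (ambient R n).
Local Notation Mat := 'M[C]_(n + n).
Local Notation tc := (@to_complex R n).
Local Notation CPn := (@CP R n).
Implicit Types (P X Y Z V W : Mat) (p v w : A).

(** The coefficient of [gam1] for which the metric is parallel. *)
Definition kap : C := ((t - 2) / t)%:C%C.

(** The Christoffel form of the Chern connection: [gam0] is that of the
    Fubini-Study metric, [kap *: gam1] the correction due to the metric ratio. *)
Definition Gam := locked_with gam_key
  (fun P X Y => gam0 P X Y + kap *: gam1 P (tau P) (tau X) Y).
Lemma GamE P X Y : Gam P X Y = gam0 P X Y + kap *: gam1 P (tau P) (tau X) Y.
Proof. by rewrite /Gam unlock. Qed.

Definition J_mx := locked_with gam_key (fun P X : Mat => 'i%C *: (P *m X - X *m P)).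
Lemma J_mxE P X : J_mx P X = 'i%C *: (P *m X - X *m P).
Proof. by rewrite /J_mx unlock. Qed.
Lemma J_mxDr P X Y : J_mx P (X + Y) = J_mx P X + J_mx P Y.
Proof. by rewrite !J_mxE -scalerDr; congr (_ *: _); rewrite mulmxDr mulmxDl opprD addrACA. Qed.

Lemma GamDl P X Y Z : Gam P (X + Y) Z = Gam P X Z + Gam P Y Z.
Proof. by rewrite !GamE gam0Dl tauD gam1Dl scalerDr addrACA. Qed.
Lemma GamDr P X Y Z : Gam P X (Y + Z) = Gam P X Y + Gam P X Z.
Proof. by rewrite !GamE gam0Dr gam1Dr scalerDr addrACA. Qed.
Lemma GamZl P c X Y : Gam P (c *: X) Y = c *: Gam P X Y.
Proof. by rewrite !GamE gam0Zl tauZ gam1Zl [RHS]scalerDr; congr (_ + _); rewrite !scalerA mulrC. Qed.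
Lemma GamZr P c X Y : Gam P X (c *: Y) = c *: Gam P X Y.
Proof. by rewrite !GamE gam0Zr gam1Zr [RHS]scalerDr; congr (_ + _); rewrite !scalerA mulrC. Qed.

Lemma odd_tau P X : odd P X -> odd (tau P) (tau X).
Proof. by rewrite /odd => oX; rewrite -!tauM -tauD addrC oX. Qed.

Lemma adj_gam1 P Q X Y : adj P = P -> adj Q = Q -> adj X = X -> adj Y = Y ->
  adj (gam1 P Q X Y) = gam1 P Q X Y.
Proof. by move=> aP aQ aX aY; rewrite !gam1E adjD !adjM aP aQ aX aY !mulmxA addrC. Qed.

Lemma adj_gam0 P X Y : P *m P = P -> adj P = P -> is_tan P X -> is_tan P Y ->
  adj (gam0 P X Y) = gam0 P X Y.
Proof.
move=> PP aP [aX oX] [aY oY].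
have -> : adj (gam0 P X Y) = (X *m Y + Y *m X) *m (P + P - 1%:M).
  by rewrite !gam0E adjM adjB !adjD !adjM adj1 aP aX aY addrC.
have e : (X *m Y + Y *m X) *m P = P *m (X *m Y + Y *m X).
  by rewrite mulmxDl mulmxDr !mulmxA (odd_odd (oX : odd P X) (oY : odd P Y)) (odd_odd (oY : odd P Y) (oX : odd P X)).
by rewrite mulmxBr mulmxDr e mulmx1 !gam0E mulmxBl mulmxDl mul1mx.
Qed.

Lemma adj_Gam P X Y : P *m P = P -> adj P = P -> is_tan P X -> is_tan P Y ->
  adj (Gam P X Y) = Gam P X Y.
Proof.
move=> PP aP tX tY; have e0 := adj_gam0 PP aP tX tY.
case: tX => aX _; case: tY => aY _.
have aQ : adj (tau P) = tau P by rewrite -tau_adj; congr tau.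
have aX' : adj (tau X) = tau X by rewrite -tau_adj; congr tau.
have e1 := adj_gam1 aP aQ aX' aY.
have kc : kap^* = kap := conjRC _.
by rewrite !GamE adjD e0 adjZ e1 kc.
Qed.

Fact sum_six (U : lmodType C) (k : C) (a b c a' b' c' : U) :
  a + b + c + k *: (a' + b' + c') = a + k *: a' + (b + k *: b') + (c + k *: c').
Proof. by rewrite !scalerDr (addrACA (a + b)) (addrACA a). Qed.

Section Calculus.
Variable (V : normedModType R).
Implicit Types (F G H : V -> Mat).

Lemma msmooth_tau F : msmooth F -> msmooth (fun q => tau (F q)).
Proof.
move=> sF; under eq_fun do rewrite tauE.
apply: msmoothN; apply: msmoothM; last exact: msmooth_cst.
by apply: msmoothM; [exact: msmooth_cst|exact: msmoothT].
Qed.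

Lemma mder_tau F q (v : V) : msmooth F -> mder (fun q => tau (F q)) q v = tau (mder F q v).
Proof.
move=> sF; have s1 : msmooth (fun q => Omega R n *m (F q)^T).
  by apply: msmoothM; [exact: msmooth_cst|exact: msmoothT].
have s2 : msmooth (fun q => Omega R n *m (F q)^T *m Omega R n).
  by apply: msmoothM => //; exact: msmooth_cst.
rewrite tauE; under eq_fun do rewrite tauE.
rewrite mderN // mderM //; last exact: msmooth_cst.
rewrite mderM; [|exact: msmooth_cst|exact: msmoothT].
by rewrite !mder_cst mul0mx add0r mulmx0 addr0 mderT.
Qed.

Lemma msmooth_adj F : msmooth F -> msmooth (fun q => adj (F q)).
Proof. by move=> sF; apply: msmoothJ; exact: msmoothT. Qed.

Lemma mder_adj F q (v : V) : msmooth F -> mder (fun q => adj (F q)) q v = adj (mder F q v).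
Proof. by move=> sF; rewrite /adj mderJ ?mderT //; exact: msmoothT. Qed.

Lemma msmoothB F G : msmooth F -> msmooth G -> msmooth (fun q => F q - G q).
Proof. by move=> sF sG; apply: msmoothD => //; exact: msmoothN. Qed.

Lemma mderB F G q (v : V) : msmooth F -> msmooth G ->
  mder (fun q => F q - G q) q v = mder F q v - mder G q v.
Proof. by move=> sF sG; rewrite mderD ?mderN //; exact: msmoothN. Qed.

Lemma msmooth_gam0 F G H : msmooth F -> msmooth G -> msmooth H ->
  msmooth (fun q => gam0 (F q) (G q) (H q)).
Proof.
move=> sF sG sH; under eq_fun do rewrite gam0E.
apply: msmoothM; last by apply: msmoothD; exact: msmoothM.
by apply: msmoothB; [exact: msmoothD|exact: msmooth_cst].
Qed.

Lemma mder_gam0 F G H q (v : V) : msmooth F -> msmooth G -> msmooth H ->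
  mder (fun q => gam0 (F q) (G q) (H q)) q v =
  dgam0 (mder F q v) (G q) (H q) + gam0 (F q) (mder G q v) (H q)
  + gam0 (F q) (G q) (mder H q v).
Proof.
move=> sF sG sH; rewrite !gam0E; under eq_fun do rewrite gam0E.
rewrite mderM; last by apply: msmoothD; exact: msmoothM.
  rewrite mderB ?mderD //; try (by apply: msmoothM); try exact: msmooth_cst;
    try exact: msmoothD.
  rewrite !mderM // mder_cst subr0 /dgam0.
  move: (mder F q v) (mder G q v) (mder H q v) => dF dG dH.
  by mx_ring.
by apply: msmoothB; [exact: msmoothD|exact: msmooth_cst].
Qed.

Lemma msmooth_gam1 F F' G H : msmooth F -> msmooth F' -> msmooth G -> msmooth H ->
  msmooth (fun q => gam1 (F q) (F' q) (G q) (H q)).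
Proof.
by move=> sF sF' sG sH; under eq_fun do rewrite gam1E; apply: msmoothD; do 3 apply: msmoothM => //.
Qed.

Lemma mder_gam1 F F' G H q (v : V) : msmooth F -> msmooth F' -> msmooth G -> msmooth H ->
  mder (fun q => gam1 (F q) (F' q) (G q) (H q)) q v =
  dgam1 (F q) (F' q) (mder F q v) (mder F' q v) (G q) (H q)
  + gam1 (F q) (F' q) (mder G q v) (H q) + gam1 (F q) (F' q) (G q) (mder H q v).
Proof.
move=> sF sF' sG sH.
have m2 (F1 F2 : V -> Mat) : msmooth F1 -> msmooth F2 -> msmooth (fun q => F1 q *m F2 q).
  by move=> s1 s2; exact: msmoothM.
have m3 (F1 F2 F3 : V -> Mat) : msmooth F1 -> msmooth F2 -> msmooth F3 ->
    msmooth (fun q => F1 q *m F2 q *m F3 q).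
  by move=> s1 s2 s3; apply: msmoothM => //; exact: msmoothM.
have m4 (F1 F2 F3 F4 : V -> Mat) : msmooth F1 -> msmooth F2 -> msmooth F3 -> msmooth F4 ->
    mder (fun q => F1 q *m F2 q *m F3 q *m F4 q) q v =
    mder F1 q v *m F2 q *m F3 q *m F4 q + F1 q *m mder F2 q v *m F3 q *m F4 q +
    F1 q *m F2 q *m mder F3 q v *m F4 q + F1 q *m F2 q *m F3 q *m mder F4 q v.
  move=> s1 s2 s3 s4; rewrite mderM //; last exact: m3.
  rewrite mderM //; last exact: m2.
  by rewrite mderM // !mulmxDl.
under eq_fun do rewrite gam1E.
rewrite mderD; [|by apply: msmoothM => //; exact: m3|by apply: msmoothM => //; exact: m3].
rewrite !m4 //.
exact: gam1_leibniz.
Qed.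

Lemma msmooth_J F G : msmooth F -> msmooth G -> msmooth (fun q => J_mx (F q) (G q)).
Proof.
move=> sF sG; under eq_fun do rewrite J_mxE.
by apply: msmoothZ; apply: msmoothB; exact: msmoothM.
Qed.

Lemma mder_J F G q (v : V) : msmooth F -> msmooth G ->
  mder (fun q => J_mx (F q) (G q)) q v = J_mx (mder F q v) (G q) + J_mx (F q) (mder G q v).
Proof.
move=> sF sG; rewrite !J_mxE; under eq_fun do rewrite J_mxE.
have m (F1 F2 : V -> Mat) : msmooth F1 -> msmooth F2 -> msmooth (fun q => F1 q *m F2 q).
  by move=> s1 s2; exact: msmoothM.
rewrite mderZ; last by apply: msmoothB; exact: m.
rewrite mderB ?mderM //; try exact: m.
by rewrite -scalerDr; congr (_ *: _); rewrite [X in _ - X]addrC opprD addrACA.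
Qed.

Definition dGam P X Y Z := dgam0 X Y Z + kap *: dgam1 P (tau P) X (tau X) (tau Y) Z.

Lemma msmooth_Gam F G H : msmooth F -> msmooth G -> msmooth H ->
  msmooth (fun q => Gam (F q) (G q) (H q)).
Proof.
move=> sF sG sH; under eq_fun do rewrite GamE.
apply: msmoothD; first exact: msmooth_gam0.
by apply: msmoothZ; apply: msmooth_gam1 => //; exact: msmooth_tau.
Qed.

Lemma mder_Gam F G H q (v : V) : msmooth F -> msmooth G -> msmooth H ->
  mder (fun q => Gam (F q) (G q) (H q)) q v =
  dGam (F q) (mder F q v) (G q) (H q) + Gam (F q) (mder G q v) (H q)
  + Gam (F q) (G q) (mder H q v).
Proof.
move=> sF sG sH.
have s1 : msmooth (fun q => gam1 (F q) (tau (F q)) (tau (G q)) (H q)).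
  by apply: msmooth_gam1 => //; exact: msmooth_tau.
rewrite !GamE; under eq_fun do rewrite GamE.
rewrite mderD; [|exact: msmooth_gam0|exact: msmoothZ].
rewrite mderZ // mder_gam0 // mder_gam1 ?mder_tau //; try exact: msmooth_tau.
exact: sum_six.
Qed.

End Calculus.

Lemma smooth_id : smooth (@id A).
Proof.
case=> [|k]; first by move=> p; exact: cvg_id.
split=> [p|v]; first by [].
have e : (fun p : A => 'D_v (@id A) p) = (fun _ : A => v).
  by apply/funext => p; exact: derive_id.
have := @smooth_cst R A A v k; by rewrite -e.
Qed.

Lemma msmooth_tc : msmooth (fun q : A => tc q).
Proof. exact: smooth_to_complex smooth_id. Qed.

Lemma mder_tc p v : mder (fun q : A => tc q) p v = tc v.
Proof. by rewrite (mder_to_complex p v smooth_id) derive_id. Qed.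

(** Allows the equations of [CPn] to be differentiated. *)
Lemma mder_vanish (F : A -> Mat) p v : (forall q, CPn q -> F q = 0) -> msmooth F ->
  tangent CPn p v -> mder F p v = 0.
Proof.
move=> F0 sF tv; have sF' := smooth_of_complex sF.
have := @tangent_derive0 _ _ CPn _ _ p v _ sF' tv.
have e : (fun q => tc (of_complex (F q))) = F by apply/funext => q; rewrite of_complexK.
move=> /(_ _)/(congr1 tc); rewrite -mder_to_complex // e to_complex0; apply.
by move=> q Mq; rewrite F0 //; apply: (can_inj (@to_complexK R n)); rewrite of_complexK to_complex0.
Qed.

(** Tangent vectors satisfy the derivatives of the equations of [CPn]; conversely the
    curves constructed from Cayley transforms realise every solution. *)
Lemma tangentP p v : CPn p -> tangent CPn p v <-> is_tan (tc p) (tc v).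
Proof.
move=> Mp; split; last exact: (tangent_curve n0).
move=> tv; split.
  have := @mder_vanish (fun q => adj (tc q) - tc q) p v _ _ tv.
  rewrite mderB ?mder_adj ?mder_tc; try exact: msmooth_tc; last by apply: msmooth_adj; exact: msmooth_tc.
  move=> h; apply/eqP; rewrite -subr_eq0; apply/eqP; apply: h.
    by move=> q /(CP_facts n0)[-> _ _ _]; rewrite subrr.
  by apply: msmoothB; [apply: msmooth_adj|]; exact: msmooth_tc.
have sPP : msmooth (fun q : A => tc q *m tc q) by apply: msmoothM; exact: msmooth_tc.
have := @mder_vanish (fun q => tc q *m tc q - tc q) p v _ _ tv.
rewrite mderB ?mderM ?mder_tc //; try exact: msmooth_tc.
move=> h; apply/eqP; rewrite addrC -subr_eq0; apply/eqP; apply: h.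
  by move=> q /(CP_facts n0)[_ -> _ _]; rewrite subrr.
by apply: msmoothB => //; exact: msmooth_tc.
Qed.

(** The derivative along [v] of the equations satisfied by tangent fields. *)
Lemma derive_vfield (Y F : A -> A) p v : vfield CPn Y -> is_smooth_extension CPn Y F ->
  CPn p -> tangent CPn p v ->
  let Z := tc ('D_v F p) in
  adj Z = Z /\ tc v *m tc (Y p) + tc p *m Z + (Z *m tc p + tc (Y p) *m tc v) = Z.
Proof.
move=> [_ tY] [sF FY] Mp tv /=; have sF' := smooth_to_complex sF; have stc := msmooth_tc.
have FYt q : CPn q -> is_tan (tc q) (tc (F q)).
  by move=> Mq; rewrite FY //; apply/tangentP => //; exact: tY.
have sm1 : msmooth (fun q => tc q *m tc (F q)) by exact: msmoothM.
have sm2 : msmooth (fun q => tc (F q) *m tc q) by exact: msmoothM.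
have sm3 : msmooth (fun q => tc q *m tc (F q) + tc (F q) *m tc q) by exact: msmoothD.
have sm4 := msmooth_adj sF'.
have h1 := @mder_vanish (fun q => adj (tc (F q)) - tc (F q)) p v _ (msmoothB sm4 sF') tv.
have h2 := @mder_vanish (fun q => tc q *m tc (F q) + tc (F q) *m tc q - tc (F q)) p v _
  (msmoothB sm3 sF') tv.
move: h1 h2; rewrite !mderB // mderD // !mderM // mder_adj // mder_tc mder_to_complex //.
rewrite FY // => h1 h2; split; apply/eqP; rewrite -subr_eq0; apply/eqP.
  by apply: h1 => q /FYt[-> _]; rewrite subrr.
by apply: h2 => q /FYt[_ ->]; rewrite subrr.
Qed.

End Christoffel.

(** * The candidate connection *)

Section OddSum.
Variables (K : comNzRingType) (N : nat).
Implicit Types (P X Y : 'M[K]_N).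
Lemma oddD P X Y : odd P X -> odd P Y -> odd P (X + Y).
Proof. by rewrite /odd mulmxDr mulmxDl addrACA => -> ->. Qed.
Lemma oddZ P k X : odd P X -> odd P (k *: X).
Proof. by rewrite /odd -scalemxAr -scalemxAl -scalerDr => ->. Qed.
End OddSum.
Section Connection.
Variables (R : realType) (n : nat) (n0 : (0 < n)%N) (t : R).
Local Notation C := R[i].
Local Notation A := (ambient R n).
Local Notation Mat := 'M[C]_(n + n).
Local Notation tc := (@to_complex R n).
Local Notation CPn := (@CP R n).
Local Notation Gam := (Gam t).
Implicit Types (P S T : Mat) (p v w : A) (X Y Z : A -> A) (f : A -> R).

Lemma ext_eq (W : normedModType R) (F G H : A -> W) : (forall q, CPn q -> F q = G q) ->
  is_smooth_extension CPn F H -> is_smooth_extension CPn G H.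
Proof. by move=> FG [sH HF]; split=> // p Mp; rewrite HF ?FG. Qed.

Lemma vfield_ext X : vfield CPn X -> exists F, is_smooth_extension CPn X F.
Proof. by case. Qed.

Lemma vfield_tan X p : vfield CPn X -> CPn p -> is_tan (tc p) (tc (X p)).
Proof. by move=> [_ tX] Mp; apply/(tangentP n0 (X p) Mp); exact: tX. Qed.

Lemma vfieldP X F : is_smooth_extension CPn X F ->
  (forall p, CPn p -> is_tan (tc p) (tc (X p))) -> vfield CPn X.
Proof. by move=> XF tX; split; [exists F|move=> p Mp; apply/(tangentP n0 (X p) Mp); exact: tX]. Qed.

Fact nabla0_key : unit. Proof. exact: tt. Qed.
Definition nabla0 := locked_with nabla0_key
  (fun X Y p => mderiv CPn Y p (X p) + of_complex (Gam (tc p) (tc (X p)) (tc (Y p)))).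
Lemma nabla0E X Y p : nabla0 X Y p =
  mderiv CPn Y p (X p) + of_complex (Gam (tc p) (tc (X p)) (tc (Y p))).
Proof. by rewrite /nabla0 unlock. Qed.

Lemma vfieldD X Y : vfield CPn X -> vfield CPn Y -> vfield CPn (X \+ Y).
Proof.
move=> vX vY; have [F [sF FX]] := vfield_ext vX; have [G [sG GY]] := vfield_ext vY.
apply: (@vfieldP _ (fun p => F p + G p)).
  by split; [exact: smoothD|move=> p Mp /=; rewrite FX ?GY].
move=> p Mp /=; have [aX oX] := vfield_tan vX Mp; have [aY oY] := vfield_tan vY Mp.
rewrite to_complexD; split; first by rewrite adjD aX aY.
by rewrite mulmxDr mulmxDl addrACA oX oY.
Qed.

Lemma vfieldZ f X : smooth_on CPn f -> vfield CPn X -> vfield CPn (fscale f X).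
Proof.
move=> [h [sh hf]] vX; have [F [sF FX]] := vfield_ext vX.
apply: (@vfieldP _ (fun p => h p *: F p)).
  by split; [exact: smooth_scale|move=> p Mp; rewrite /fscale hf ?FX].
move=> p Mp; have [aX oX] := vfield_tan vX Mp.
rewrite /fscale to_complexZ; split; first by rewrite adjZ conjRC aX.
by rewrite -scalemxAr -scalemxAl -scalerDr oX.
Qed.

Lemma ext_nabla0 X Y F G : vfield CPn X -> vfield CPn Y ->
  is_smooth_extension CPn X F -> is_smooth_extension CPn Y G ->
  is_smooth_extension CPn (nabla0 X Y)
    (fun q => 'D_(F q) G q + of_complex (Gam (tc q) (tc (F q)) (tc (G q)))).
Proof.
move=> vX vY [sF FX] eG; have [sG GY] := eG; split.
  apply: smoothD; first exact: smooth_derive_field.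
  apply: smooth_of_complex; apply: msmooth_Gam; [exact: msmooth_tc| |];
    exact: smooth_to_complex.
move=> p Mp; rewrite nabla0E (mderivE eG); first by rewrite FX ?GY.
by case: vX => _; apply.
Qed.

Lemma nabla0_tc X Y G p : vfield CPn X -> is_smooth_extension CPn Y G -> CPn p ->
  tc (nabla0 X Y p) = tc ('D_(X p) G p) + Gam (tc p) (tc (X p)) (tc (Y p)).
Proof.
move=> [_ tX] eG Mp; rewrite nabla0E to_complexD of_complexK (mderivE eG) //.
exact: tX.
Qed.

Lemma odd_Gam P S T (Z : Mat) : P *m P = P -> P *m tau P = 0 -> tau P *m P = 0 -> odd P S -> odd P T ->
  S *m T + P *m Z + (Z *m P + T *m S) = Z -> odd P (Z + Gam P S T).
Proof.
move=> PP PQ QP oS oT hZ.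
have h1 := odd_covariant PP oS oT hZ.
have h2 := gam1_odd PP PQ QP (tau S) T.
by rewrite !GamE addrA; apply: oddD => //; apply: oddZ.
Qed.

Lemma nabla0_vfield X Y : vfield CPn X -> vfield CPn Y -> vfield CPn (nabla0 X Y).
Proof.
move=> vX vY; have [F eF] := vfield_ext vX; have [G eG] := vfield_ext vY.
apply: (vfieldP (ext_nabla0 vX vY eF eG)) => p Mp.
have tX := vfield_tan vX Mp; have tY := vfield_tan vY Mp.
have [aP PP PQ QP] := CP_facts n0 Mp.
have [aZ hZ] := derive_vfield n0 vY eG Mp (vX.2 p Mp).
rewrite (nabla0_tc vX eG Mp); split; first by rewrite adjD aZ adj_Gam.
by apply: odd_Gam => //; [case: tX|case: tY].
Qed.

Lemma nabla0_connection : is_connection CPn nabla0.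
Proof.
split.
- exact: nabla0_vfield.
- move=> X X' Y Y' vX vX' vY vY' eX eY p Mp.
  have [G eG] := vfield_ext vY; have eG' := ext_eq eY eG.
  apply: (can_inj (@to_complexK R n)).
  apply: (etrans (nabla0_tc vX eG Mp)); apply: (etrans _ (esym (nabla0_tc vX' eG' Mp))).
  by rewrite (eX p Mp) (eY p Mp).
- move=> X X' Y vX vX' vY p Mp.
  have [G eG] := vfield_ext vY; have [sG _] := eG.
  apply: (can_inj (@to_complexK R n)); rewrite /= to_complexD.
  rewrite (nabla0_tc (vfieldD vX vX') eG Mp) (nabla0_tc vX eG Mp) (nabla0_tc vX' eG Mp) /=.
  by rewrite (derive_dirD _ _ _ sG) !to_complexD GamDl addrACA.
- move=> f X Y sf vX vY p Mp.
  have [G eG] := vfield_ext vY; have [sG _] := eG.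
  apply: (can_inj (@to_complexK R n)).
  rewrite (nabla0_tc (vfieldZ sf vX) eG Mp) {3}/fscale [RHS]to_complexZ (nabla0_tc vX eG Mp).
  by rewrite /fscale (derive_dirZ _ _ _ sG) !to_complexZ GamZl scalerDr.
- move=> X Y Y' vX vY vY' p Mp.
  have [G [sG GY]] := vfield_ext vY; have [G' [sG' GY']] := vfield_ext vY'.
  have eS : is_smooth_extension CPn (Y \+ Y') (fun q => G q + G' q).
    by split; [exact: smoothD|move=> q Mq /=; rewrite GY ?GY'].
  apply: (can_inj (@to_complexK R n)); rewrite /= to_complexD.
  rewrite (nabla0_tc vX eS Mp) (nabla0_tc vX (conj sG GY) Mp) (nabla0_tc vX (conj sG' GY') Mp) /=.
  have -> : 'D_(X p) (fun q => G q + G' q) p = 'D_(X p) G p + 'D_(X p) G' p.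
    by apply: deriveD; exact: smooth_derivable.
  by rewrite !to_complexD GamDr addrACA.
move=> f X Y [h [sh hf]] vX vY p Mp.
have [G [sG GY]] := vfield_ext vY.
have eS : is_smooth_extension CPn (fscale f Y) (fun q => h q *: G q).
  by split; [exact: smooth_scale|move=> q Mq; rewrite /fscale hf ?GY].
apply: (can_inj (@to_complexK R n)); rewrite /= to_complexD.
have r : tc (fscale f (nabla0 X Y) p) = (f p)%:C%C *: (tc ('D_(X p) G p) +
    Gam (tc p) (tc (X p)) (tc (Y p))).
  by rewrite /fscale to_complexZ; congr (_ *: _); exact: (nabla0_tc vX (conj sG GY) Mp).
have l : tc ('D_(X p) (fun q => h q *: G q) p) =
    (mderiv CPn f p (X p))%:C%C *: tc (Y p) + (f p)%:C%C *: tc ('D_(X p) G p).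
  rewrite (mderivE (conj sh hf) (vX.2 p Mp)) -(hf p Mp) -(GY p Mp).
  by rewrite (derive_scale p (X p) sh sG) to_complexD !to_complexZ.
apply: (etrans (nabla0_tc vX eS Mp)); rewrite l r /fscale !to_complexZ GamZr scalerDr addrA.
by [].
Qed.

Local Notation Jn := (@CP_J R n).

Lemma vfield_J_ext Y G : vfield CPn Y -> is_smooth_extension CPn Y G ->
  is_smooth_extension CPn (fun q => Jn q (Y q)) (fun q => of_complex (J_mx (tc q) (tc (G q)))).
Proof.
move=> vY [sG GY]; split.
  apply: smooth_of_complex; apply: msmooth_J; [exact: msmooth_tc|exact: smooth_to_complex].
move=> p Mp; apply: (can_inj (@to_complexK R n)).
by rewrite of_complexK J_mxE GY // (CP_JE n0 Mp (vfield_tan vY Mp)).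
Qed.

Lemma conj_i : ('i%C : C)^* = - 'i%C.
Proof. by apply/eqP; rewrite eq_complex /= oppr0 !eqxx. Qed.

Lemma is_tan_J P S : P *m P = P -> adj P = P -> is_tan P S -> is_tan P (J_mx P S).
Proof.
move=> PP aP [aS oS]; split.
  by rewrite !J_mxE adjZ adjB !adjM aP aS conj_i scaleNr -scalerN opprB.
rewrite !J_mxE -scalemxAr -scalemxAl -scalerDr; congr (_ *: _).
have -> : P *m (P *m S - S *m P) + (P *m S - S *m P) *m P =
  (P *m P) *m S - S *m (P *m P) by mx_ring.
by rewrite PP.
Qed.

Lemma vfield_J Y : vfield CPn Y -> vfield CPn (fun q => Jn q (Y q)).
Proof.
move=> vY; have [G eG] := vfield_ext vY; apply: (vfieldP (vfield_J_ext vY eG)) => p Mp.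
have [aP PP _ _] := CP_facts n0 Mp; have tY := vfield_tan vY Mp.
by rewrite (CP_JE n0 Mp tY) -J_mxE; exact: is_tan_J.
Qed.

Lemma Gam_J P S T : P *m P = P -> P *m tau P = 0 -> tau P *m P = 0 -> odd P S -> odd P T ->
  'i%C *: (S *m T - T *m S) + Gam P S (J_mx P T) = J_mx P (Gam P S T).
Proof.
move=> PP PQ QP oS oT.
have h1 := gam0_J PP oS oT; have h2 := gam1_J PP PQ QP (tau S) oT.
rewrite !J_mxE GamZr -scalerDr; congr (_ *: _).
rewrite !GamE addrA h1 h2; move: (gam0 P S T) (gam1 _ _ _ _) => g0 g1.
rewrite scalerBr [_ *: (P *m g1)]scalemxAr [_ *: (g1 *m P)]scalemxAl.
by move: (_ *: g1) => G; mx_ring.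
Qed.

Lemma nabla0_complex X Y : vfield CPn X -> vfield CPn Y ->
  eq_on CPn (nabla0 X (fun q => Jn q (Y q))) (fun q => Jn q (nabla0 X Y q)).
Proof.
move=> vX vY p Mp; have [G eG] := vfield_ext vY; have [sG GY] := eG.
have tX := vfield_tan vX Mp; have tY := vfield_tan vY Mp.
have [aP PP PQ QP] := CP_facts n0 Mp.
have tN := vfield_tan (nabla0_vfield vX vY) Mp.
have JE v : is_tan (tc p) (tc v) -> tc (Jn p v) = J_mx (tc p) (tc v).
  by move=> tv; rewrite (CP_JE n0 Mp tv) J_mxE.
apply: (can_inj (@to_complexK R n)).
have lhs := etrans (nabla0_tc vX (vfield_J_ext vY eG) Mp)
  (congr1 (fun W => _ + Gam _ _ W) (JE _ tY)).
have rhs := etrans (JE _ tN) (congr1 (J_mx (tc p)) (nabla0_tc vX eG Mp)).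
apply: (etrans lhs); apply: (etrans _ (esym rhs)).
have sG' := smooth_to_complex sG; have stc := @msmooth_tc R n.
have sJ := msmooth_J stc sG'.
have dJ := mder_to_complex p (X p) (smooth_of_complex sJ).
have e : (fun q => tc (of_complex (J_mx (tc q) (tc (G q))))) = (fun q => J_mx (tc q) (tc (G q))).
  by apply/funext => q; rewrite of_complexK.
rewrite -dJ e mder_J // mder_tc mder_to_complex // GY // J_mxDr.
rewrite -(Gam_J PP PQ QP tX.2 tY.2) -J_mxE [RHS]addrA; congr (_ + _).
exact: addrC.
Qed.

End Connection.

(** * The candidate connection is the Chern connection *)

Fact zmod_cancel (V : zmodType) (a b c d : V) : a + c - (b + d) - (a - b) = c - d.
Proof. by apply/eqP; rewrite subr_eq addrACA -opprD (addrC c) (addrC d). Qed.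

Section MetricAlgebra.
Variables (K : comNzRingType) (N : nat).
Implicit Types (P Q X Y Z V W : 'M[K]_N).

Lemma mxtraceB V W : \tr (V - W) = \tr V - \tr W. Proof. exact: linearB. Qed.
Lemma mxtraceN V : \tr (- V) = - \tr V. Proof. exact: linearN. Qed.

(** The complex-valued form whose real part is the metric up to a constant factor, with
    [s] standing for [t - 2]. *)
Definition hform := locked_with gam_key (fun (s : K) P Q V W =>
  2 * \tr (V *m P *m W) + s * \tr (Q *m V *m P *m W)).
Lemma hformE s P Q V W : hform s P Q V W =
  2 * \tr (V *m P *m W) + s * \tr (Q *m V *m P *m W).
Proof. by rewrite /hform unlock. Qed.

Lemma hform_leibniz s P Q G H P1 Q1 G1 H1 :
  2 * \tr ((G1 *m P + G *m P1) *m H + G *m P *m H1) +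
  s * \tr (((Q1 *m G + Q *m G1) *m P + Q *m G *m P1) *m H + Q *m G *m P *m H1) =
  2 * \tr (G *m P1 *m H) + s * (\tr (Q1 *m G *m P *m H) + \tr (Q *m G *m P1 *m H)) +
  (hform s P Q G1 H + hform s P Q G H1).
Proof. by rewrite !hformE !(mulmxDl, mxtraceD); ring. Qed.

Lemma hformDl s P Q V V' W : hform s P Q (V + V') W = hform s P Q V W + hform s P Q V' W.
Proof. by rewrite !hformE mulmxDr !mulmxDl !mxtraceD; ring. Qed.
Lemma hformDr s P Q V W W' : hform s P Q V (W + W') = hform s P Q V W + hform s P Q V W'.
Proof. by rewrite !hformE !mulmxDr !mxtraceD; ring. Qed.
Lemma hformZl s P Q k V W : hform s P Q (k *: V) W = k * hform s P Q V W.
Proof. by rewrite !hformE -!scalemxAr -!scalemxAl !mxtraceZ; ring. Qed.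
Lemma hformZr s P Q k V W : hform s P Q V (k *: W) = k * hform s P Q V W.
Proof. by rewrite !hformE -!scalemxAr !mxtraceZ; ring. Qed.

(** Compatibility with the metric. The left-hand side is what the variation of [P] and
    [Q] contributes to the derivative of [hform]. On the right [gam0] contributes nothing,
    by parity, and the equation on [k] balances the terms in [gam1]. *)
Lemma hform_gam s k P Q X X' Y Z : P *m P = P -> Q *m Q = Q -> P *m Q = 0 -> Q *m P = 0 ->
  odd P X -> odd Q X' -> odd P Y -> odd P Z -> k * (2 + s) = s ->
  2 * \tr (Y *m X *m Z) + s * (\tr (X' *m Y *m P *m Z) + \tr (Q *m Y *m X *m Z)) =
  hform s P Q (gam0 P X Y + k *: gam1 P Q X' Y) Z + hform s P Q Y (gam0 P X Z + k *: gam1 P Q X' Z).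
Proof.
move=> PP QQ PQ QP oX oX' oY oZ ks.
have Q1 : 1%:M *m P = P *m 1%:M by rewrite mul1mx mulmx1.
have QPQ : Q *m P = P *m Q by rewrite PQ.
have [a1 a2 a3] := metric_gam0 PP oX oY oZ Q1.
have [b1 b2 b3] := metric_gam0 PP oX oY oZ QPQ.
rewrite !mul1mx in a1 a2 a3.
rewrite a1 b1 hformDl hformDr hformZl hformZr !hformE a2 a3 b2 b3.
have c1 : gam1 P Q X' Y *m P = Q *m X' *m Y *m P.
  have -> : gam1 P Q X' Y *m P = Q *m X' *m Y *m (P *m P) + P *m Y *m X' *m (Q *m P).
    by rewrite gam1E; mx_ring.
  by rewrite PP QP mulmx0 addr0.
have c2 : P *m gam1 P Q X' Z = P *m Z *m X' *m Q.
  have -> : P *m gam1 P Q X' Z = (P *m Q) *m X' *m Z *m P + (P *m P) *m Z *m X' *m Q.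
    by rewrite gam1E; mx_ring.
  by rewrite PP PQ !mul0mx add0r.
have d1 : \tr (gam1 P Q X' Y *m P *m Z) = \tr (Q *m X' *m Y *m P *m Z) by rewrite c1.
have d2 : \tr (Q *m gam1 P Q X' Y *m P *m Z) = \tr (Q *m X' *m Y *m P *m Z).
  by rewrite -[Q *m _ *m P]mulmxA c1 !mulmxA QQ.
have d3 : \tr (Y *m P *m gam1 P Q X' Z) = \tr (X' *m Q *m Y *m P *m Z).
  by rewrite -mulmxA c2 mulmxA mxtrace_mulC !mulmxA mxtrace_mulC !mulmxA.
have d4 : \tr (Q *m Y *m P *m gam1 P Q X' Z) = \tr (X' *m Q *m Y *m P *m Z).
  rewrite -[_ *m P *m _]mulmxA c2 mulmxA mxtrace_mulC !mulmxA QQ mxtrace_mulC !mulmxA.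
  by rewrite mxtrace_mulC !mulmxA mxtrace_mulC !mulmxA.
rewrite d1 d2 d3 d4.
have -> : \tr (X' *m Y *m P *m Z) = \tr (Q *m X' *m Y *m P *m Z) + \tr (X' *m Q *m Y *m P *m Z).
  by rewrite -mxtraceD -!mulmxDl oX'.
by move: ks; set a := \tr _; set b := \tr _ => ks; rewrite -[in LHS]ks; ring.
Qed.

Lemma J_sq P V : P *m P = P -> odd P V ->
  P *m (P *m V - V *m P) - (P *m V - V *m P) *m P = V.
Proof.
move=> PP oV; have PVP := odd_PXP PP oV.
have -> : P *m (P *m V - V *m P) - (P *m V - V *m P) *m P =
  (P *m P) *m V + V *m (P *m P) - (P *m V *m P) - (P *m V *m P) by mx_ring.
by rewrite PVP PP !subr0.
Qed.

Lemma hform_Jl s P Q V W : P *m P = P -> odd P V -> Q *m P = 0 ->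
  hform s P Q (P *m V - V *m P) W = - hform s P Q V W.
Proof.
move=> PP oV QP; have PVP := odd_PXP PP oV; rewrite !hformE.
have -> : (P *m V - V *m P) *m P *m W = P *m V *m P *m W - V *m (P *m P) *m W by mx_ring.
have -> : Q *m (P *m V - V *m P) *m P *m W = (Q *m P) *m V *m P *m W - Q *m V *m (P *m P) *m W
  by mx_ring.
by rewrite PVP QP PP !mul0mx !sub0r !mxtraceN !mulrN opprD.
Qed.

Lemma hform_Jr s P Q V W : P *m P = P -> odd P V -> Q *m P = 0 -> P *m Q = 0 ->
  hform s P Q V (P *m W - W *m P) = hform s P Q V W.
Proof.
move=> PP oV QP PQ; have PVP := odd_PXP PP oV; rewrite !hformE.
have z S : P *m S = S *m P -> \tr (S *m V *m P *m W *m P) = 0.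
  move=> PS; rewrite mxtrace_mulC !mulmxA PS -[_ *m P *m V]mulmxA -[_ *m (P *m V) *m P]mulmxA.
  by rewrite PVP mulmx0 mul0mx mxtrace0.
have z1 := z 1%:M; rewrite mulmx1 !mul1mx in z1; have zQ := z Q; rewrite PQ QP in zQ.
have -> : V *m P *m (P *m W - W *m P) = V *m (P *m P) *m W - V *m P *m W *m P by mx_ring.
have -> : Q *m V *m P *m (P *m W - W *m P) = Q *m V *m (P *m P) *m W - Q *m V *m P *m W *m P
  by mx_ring.
by rewrite PP !mxtraceB zQ // z1 // !subr0.
Qed.

Lemma gam1_J_swap c P Q X' Y : P *m P = P -> Q *m Q = Q -> P *m Q = 0 -> Q *m P = 0 ->
  odd Q X' -> odd P Y ->
  gam1 P Q (c *: (X' *m Q - Q *m X')) Y = gam1 P Q X' (c *: (P *m Y - Y *m P)).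
Proof.
by move=> PP QQ PQ QP oX oY; rewrite gam1Zl gam1Zr gam1_bilin.
Qed.

Definition tform := locked_with gam_key (fun (k : K) P Q X' Y' X Y =>
  k *: (gam1 P Q X' Y - gam1 P Q Y' X)).
Lemma tformE k P Q X' Y' X Y :
  tform k P Q X' Y' X Y = k *: (gam1 P Q X' Y - gam1 P Q Y' X).
Proof. by rewrite /tform unlock. Qed.

Lemma tformNr k P Q X' Y' X Y : tform k P Q X' (- Y') X (- Y) = - tform k P Q X' Y' X Y.
Proof. by rewrite !tformE -scalerN; congr (_ *: _); rewrite !gam1E; mx_ring. Qed.

Lemma tformNl k P Q X' Y' X Y : tform k P Q (- X') Y' (- X) Y = - tform k P Q X' Y' X Y.
Proof. by rewrite !tformE -scalerN; congr (_ *: _); rewrite !gam1E; mx_ring. Qed.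

Lemma tform_swap k c P Q X' Y' X Y : P *m P = P -> Q *m Q = Q -> P *m Q = 0 -> Q *m P = 0 ->
  odd P X -> odd P Y -> odd Q X' -> odd Q Y' ->
  tform k P Q (c *: (X' *m Q - Q *m X')) Y' (c *: (P *m X - X *m P)) Y =
  tform k P Q X' (c *: (Y' *m Q - Q *m Y')) X (c *: (P *m Y - Y *m P)).
Proof.
move=> PP QQ PQ QP oX oY oX' oY'; rewrite !tformE (gam1_J_swap c PP QQ PQ QP oX' oY).
by rewrite -(gam1_J_swap c PP QQ PQ QP oY' oX).
Qed.

End MetricAlgebra.

Section HformDerivative.
Variables (R : realType) (V : normedModType R) (m : nat).
Implicit Types (P Q G H : V -> 'M[R[i]]_m).

Lemma derive_scaler (c : R) (p v : V) (f : V -> R) : smooth f ->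
  'D_v (fun q => c * f q) p = c * 'D_v f p.
Proof. by move=> sf; rewrite deriveMl //; exact: smooth_derivable. Qed.

Lemma cderive_scale (c : R[i]) (p v : V) (f : V -> R[i]) : csmooth f ->
  cderive (fun q => c * f q) p v = c * cderive f p v.
Proof. by move=> sf; rewrite cderiveM ?cderive_cst ?mul0r ?add0r //; exact: csmooth_cst. Qed.

Lemma cderive_hform s (p v : V) P Q G H :
  msmooth P -> msmooth Q -> msmooth G -> msmooth H ->
  csmooth (fun q => hform s (P q) (Q q) (G q) (H q)) /\
  cderive (fun q => hform s (P q) (Q q) (G q) (H q)) p v =
  2 * \tr (G p *m mder P p v *m H p) +
    s * (\tr (mder Q p v *m G p *m P p *m H p) + \tr (Q p *m G p *m mder P p v *m H p)) +
  (hform s (P p) (Q p) (mder G p v) (H p) + hform s (P p) (Q p) (G p) (mder H p v)).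
Proof.
move=> sP sQ sG sH.
have s1 := msmoothM sG sP; have s2 := msmoothM s1 sH.
have s3 := msmoothM sQ sG; have s4 := msmoothM s3 sP; have s5 := msmoothM s4 sH.
have t2 := csmooth_trace s2; have t5 := csmooth_trace s5.
have c2 := csmoothM (csmooth_cst V 2) t2; have c5 := csmoothM (csmooth_cst V s) t5.
under eq_fun do rewrite hformE.
split; first exact: (csmoothD c2 c5).
rewrite (cderiveD p v c2 c5) !cderive_scale // !cderive_trace // !mderM //.
exact: hform_leibniz.
Qed.

End HformDerivative.

Section Chern.
Variables (R : realType) (n : nat) (n0 : (0 < n)%N) (t : R) (ht : 0 < t).
Local Notation C := R[i].
Local Notation A := (ambient R n).
Local Notation Mat := 'M[C]_(n + n).
Local Notation tc := (@to_complex R n).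
Local Notation CPn := (@CP R n).
Local Notation Gam := (Gam t).
Local Notation nabla0 := (@nabla0 R n t).
Local Notation Jn := (@CP_J R n).
Local Notation gn := (@CP_metric R n t).
Local Notation h P := (hform (t - 2)%:C%C P (tau P)).
Implicit Types (P S T : Mat) (p v w : A) (X Y Z : A -> A) (f : A -> R).

Lemma metricE p v w : CPn p -> is_tan (tc p) (tc v) -> is_tan (tc p) (tc w) ->
  gn p v w = 4 * n.+1%:R * complex.Re (h (tc p) (tc v) (tc w)).
Proof. by move=> Mp tv tw; rewrite (CP_metricE n0 t Mp tv tw) hformE. Qed.

Lemma tau_facts p : CPn p -> let P := tc p in
  [/\ P *m P = P, tau P *m tau P = tau P, P *m tau P = 0, tau P *m P = 0 & adj P = P].
Proof. by move=> /(CP_facts n0)[aP PP PQ QP]; split=> //; rewrite -tauM PP. Qed.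

Lemma kap_eq : kap t * (2 + (t - 2)%:C%C) = (t - 2)%:C%C.
Proof.
have -> : 2 + (t - 2)%:C%C = t%:C%C :> C.
  by rewrite -(rmorph_nat (real_complex R)) -rmorphD addrC subrK.
by rewrite /kap -rmorphM divfK // gt_eqF.
Qed.

Lemma nabla0_metric X Y Z : vfield CPn X -> vfield CPn Y -> vfield CPn Z -> forall p, CPn p ->
  mderiv CPn (fun q => gn q (Y q) (Z q)) p (X p) =
  gn p (nabla0 X Y p) (Z p) + gn p (Y p) (nabla0 X Z p).
Proof.
move=> vX vY vZ p Mp.
have [G [sG GY]] := vfield_ext vY; have [H [sH HZ]] := vfield_ext vZ.
have tX := vfield_tan n0 vX Mp; have tY := vfield_tan n0 vY Mp; have tZ := vfield_tan n0 vZ Mp.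
have tNY := vfield_tan n0 (nabla0_vfield n0 t vX vY) Mp.
have tNZ := vfield_tan n0 (nabla0_vfield n0 t vX vZ) Mp.
have [PP QQ PQ QP aP] := tau_facts Mp.
have sG' := smooth_to_complex sG; have sH' := smooth_to_complex sH; have stc := @msmooth_tc R n.
have [ch dh] := cderive_hform (t - 2)%:C%C p (X p) stc (msmooth_tau stc) sG' sH'.
have [rh _] := ch.
have sext : is_smooth_extension CPn (fun q => gn q (Y q) (Z q)) (fun q => (4 * n.+1%:R) *
    complex.Re (h (tc q) (tc (G q)) (tc (H q)))).
  split=> [|q Mq]; first by exact: (@smoothM R _ _ _ (@smooth_cst R _ R _) rh).
  by rewrite GY // HZ // metricE //; exact: vfield_tan.
have tvX := vX.2 p Mp.
apply: (etrans (mderivE sext tvX)).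
apply: (etrans (derive_scaler (4 * n.+1%:R) p (X p) rh)).
rewrite (metricE Mp tNY tZ) (metricE Mp tY tNZ) -mulrDr -ReD; congr (_ * _).
apply: (etrans (congr1 (@complex.Re R) dh)); congr complex.Re.
have eX := mder_tc p (X p).
have eQ := mder_tau p (X p) stc; rewrite eX in eQ.
rewrite eQ eX (mder_to_complex p (X p) sG) (mder_to_complex p (X p) sH) (GY p Mp) (HZ p Mp).
rewrite (nabla0_tc t vX (conj sG GY) Mp) (nabla0_tc t vX (conj sH HZ) Mp).
have key := hform_gam PP QQ PQ QP tX.2 (odd_tau tX.2) tY.2 tZ.2 kap_eq.
rewrite -!GamE in key.
by rewrite key hformDl hformDr [RHS]addrACA addrC.
Qed.

(** [gam0] is symmetric, so only [gam1] contributes to the torsion. *)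
Lemma nabla0_torsion X Y p : tc (torsion CPn nabla0 X Y p) =
  kap t *: (gam1 (tc p) (tau (tc p)) (tau (tc (X p))) (tc (Y p)) -
            gam1 (tc p) (tau (tc p)) (tau (tc (Y p))) (tc (X p))).
Proof.
rewrite /torsion /bracket !nabla0E.
set a := mderiv _ Y p _; set b := mderiv _ X p _; set c := of_complex _; set d := of_complex _.
have -> : a + c - (b + d) - (a - b) = c - d.
  exact: zmod_cancel.
rewrite to_complexB !of_complexK !GamE scalerBr opprD addrACA.
have -> : gam0 (tc p) (tc (X p)) (tc (Y p)) = gam0 (tc p) (tc (Y p)) (tc (X p)).
  by rewrite !gam0E [X in _ *m X]addrC.
by rewrite subrr add0r.
Qed.

Lemma tau_J P S : tau (J_mx P S) = 'i%C *: (tau S *m tau P - tau P *m tau S).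
Proof. by rewrite J_mxE tauZ tauB !tauM. Qed.

Lemma JE p v : CPn p -> is_tan (tc p) (tc v) -> tc (Jn p v) = J_mx (tc p) (tc v).
Proof. by move=> Mp tv; rewrite (CP_JE n0 Mp tv) J_mxE. Qed.

Lemma J_mx_sq P S : P *m P = P -> odd P S -> J_mx P (J_mx P S) = - S.
Proof.
move=> PP oS; rewrite !J_mxE -scalemxAr -scalemxAl -scalerBr scalerA J_sq //.
by rewrite -expr2 sqr_i scaleN1r.
Qed.

Lemma J_mxN P S : J_mx P (- S) = - J_mx P S.
Proof. by rewrite !J_mxE mulmxN mulNmx -opprD scalerN. Qed.

Section TorsionForm.
Variables (p : A) (Mp : CPn p).
Notation tf S T := (tform (kap t) (tc p) (tau (tc p)) (tau S) (tau T) S T).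

Lemma tf_swap S T : odd (tc p) S -> odd (tc p) T ->
  tf (J_mx (tc p) S) T = tf S (J_mx (tc p) T).
Proof.
move=> oS oT; have [PP QQ PQ QP _] := tau_facts Mp.
have key := tform_swap (kap t) 'i%C PP QQ PQ QP oS oT (odd_tau oS) (odd_tau oT).
by rewrite !tau_J !(J_mxE (tc p)).
Qed.

Lemma tf_Nl S T : tf (- S) T = - tf S T.
Proof.
apply: (etrans (congr1 (fun s => tform (kap t) (tc p) (tau (tc p)) s (tau T) (- S) T) (tauN S))).
exact: tformNl.
Qed.

Lemma tf_JJ S T : odd (tc p) S -> is_tan (tc p) T ->
  tf (J_mx (tc p) S) (J_mx (tc p) T) = - tf S T.
Proof.
move=> oS tT; have [PP _ _ _ aP] := tau_facts Mp.
have oJ : odd (tc p) (J_mx (tc p) T) by have [] := is_tan_J PP aP tT.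
apply: (etrans (tf_swap oS oJ)); rewrite (J_mx_sq PP tT.2) tauN.
exact: tformNr.
Qed.
End TorsionForm.

(** If [u = X - i J X] and [v = Y - i J Y], the components of the torsion of [u] and the
    conjugate of [v] vanish because the torsion takes the same value on [(J X, Y)] and
    [(X, J Y)]. *)
Lemma nabla0_chern_torsion (u v : cfield A) : T10_field CPn Jn u -> T10_field CPn Jn v ->
  forall p, CPn p -> ctorsion CPn nabla0 u (cconj v) p = (0, 0).
Proof.
move=> [u1 u2 Tu] [v1 v2 Tv] p Mp.
have [PP QQ PQ QP aP] := tau_facts Mp.
have tu1 := vfield_tan n0 u1 Mp; have tv1 := vfield_tan n0 v1 Mp.
have [_ _ Ju _] := Tu p Mp; have [_ _ Jv _] := Tv p Mp.
have U2 : tc (u.2 p) = - J_mx (tc p) (tc (u.1 p)).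
  by rewrite -(JE Mp tu1) [Jn _ _]Ju to_complexN opprK.
have V2 : tc (- v.2 p) = J_mx (tc p) (tc (v.1 p)).
  by rewrite -(JE Mp tv1) [Jn _ _]Jv.
have T X Y S W : tc (X p) = S -> tc (Y p) = W -> tc (torsion CPn nabla0 X Y p) =
    tform (kap t) (tc p) (tau (tc p)) (tau S) (tau W) S W.
  by move=> <- <-; rewrite tformE; exact: nabla0_torsion.
have inj := can_inj (@to_complexK R n).
have a0 : torsion CPn nabla0 u.2 (fun q => - v.2 q) p = torsion CPn nabla0 u.1 v.1 p.
  apply: inj; apply: (etrans (T _ _ _ _ U2 V2)).
  apply: (etrans (tf_Nl p _ _)); rewrite (tf_JJ Mp tu1.2 tv1) opprK.
  by apply: esym; exact: T.
have b0 : torsion CPn nabla0 u.1 (fun q => - v.2 q) p = - torsion CPn nabla0 u.2 v.1 p.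
  apply: inj; apply: (etrans (T _ _ _ _ erefl V2)).
  apply: (etrans (esym (tf_swap Mp tu1.2 tv1.2))); apply: esym.
  apply: (etrans (to_complexN _)); apply: canLR (@opprK _) _; apply: (etrans (T _ _ _ _ U2 erefl)).
  exact: tf_Nl.
by rewrite /ctorsion /cconj /= a0 b0 subrr addNr.
Qed.

Lemma nabla0_chern : is_chern CPn gn Jn nabla0.
Proof.
split.
- exact: nabla0_connection.
- exact: nabla0_metric.
- exact: nabla0_complex.
- exact: nabla0_chern_torsion.
Qed.

End Chern.

(** * Uniqueness of the Chern connection *)

Section Zmodule.
Variable (V : zmodType).
Implicit Types a b c d : V.
Fact subr_eq_cross a b c d : a - b = c - d -> (a - c) - (b - d) = 0.
Proof. by move=> e; rewrite opprD addrACA -opprD e subrr. Qed.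
Fact addr_eq_cross a b c d : a + b = c + d -> (a - c) + (b - d) = 0.
Proof. by move=> e; rewrite addrACA -opprD e subrr. Qed.
Fact cross_eq_add a b c d : (a - b) + (c - d) = 0 -> a + c = b + d.
Proof. by move=> /eqP; rewrite addrACA -opprD subr_eq0 => /eqP. Qed.
Fact subr_swap a b c : a - (a - b + c) = - (c - b).
Proof. by rewrite -addrA opprD addrA subrr sub0r addrC. Qed.
End Zmodule.

Section ChernUnique.
Variables (R : realType) (V : normedModType R) (M : set V).
Variables (g : V -> V -> V -> R) (J : V -> V -> V).
Hypothesis vfD : forall X Y, vfield M X -> vfield M Y -> vfield M (X \+ Y).
Hypothesis vfZ : forall f X, smooth_on M f -> vfield M X -> vfield M (fscale f X).
Hypothesis vfJ : forall X, vfield M X -> vfield M (fun q => J q (X q)).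
Hypothesis tB : forall p a b, M p -> tangent M p a -> tangent M p b -> tangent M p (a - b).
Hypothesis gC : forall p a b, M p -> tangent M p a -> tangent M p b -> g p a b = g p b a.
Hypothesis gB : forall p a b c, M p -> tangent M p a -> tangent M p b -> tangent M p c ->
  g p (a - b) c = g p a c - g p b c.
Hypothesis gJ : forall p a b, M p -> tangent M p a -> tangent M p b ->
  g p (J p a) (J p b) = g p a b.
Hypothesis g0 : forall p a, M p -> tangent M p a -> g p a a = 0 -> a = 0.
Hypothesis JB : forall p a b, M p -> tangent M p a -> tangent M p b ->
  J p (a - b) = J p a - J p b.
Hypothesis JJ : forall p a, M p -> tangent M p a -> J p (J p a) = - a.
Hypothesis Jt : forall p a, M p -> tangent M p a -> tangent M p (J p a).

Let opp (X : V -> V) := fscale (fun=> -1) X.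
Let smooth_cst_on (c : R) : smooth_on M (fun=> c).
Proof. by exists (fun=> c); split=> //; exact: smooth_cst. Qed.
Let vfN X : vfield M X -> vfield M (opp X). Proof. exact: vfZ. Qed.
Let oppE X p : opp X p = - X p. Proof. exact: scaleN1r. Qed.

Lemma connection_oppl N X Y p : is_connection M N -> vfield M X -> vfield M Y -> M p ->
  N (opp X) Y p = - N X Y p.
Proof. by move=> cN vX vY Mp; rewrite (conn_scalel cN) // oppE. Qed.

Lemma connection_oppr N X Y p : is_connection M N -> vfield M X -> vfield M Y -> M p ->
  N X (opp Y) p = - N X Y p.
Proof.
move=> cN vX vY Mp; rewrite (conn_leibniz cN) //= {2}/fscale scaleN1r /fscale.
have e : is_smooth_extension M (fun=> -1 : R) (fun=> -1) by split=> //; exact: smooth_cst.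
by rewrite (mderivE e (vX.2 p Mp)) derive_cst scale0r add0r.
Qed.

Section Difference.
Variables N N' : (V -> V) -> (V -> V) -> V -> V.
Hypotheses (cN : is_chern M g J N) (cN' : is_chern M g J N').
Let kN := chern_connection cN.
Let kN' := chern_connection cN'.
Variables (p : V) (Mp : M p).
Let D X Y := N X Y p - N' X Y p.
Let jf X := fun q => J q (X q).

Let tN X Y : vfield M X -> vfield M Y -> tangent M p (N X Y p).
Proof. by move=> vX vY; case: (conn_vfield kN vX vY) => _; exact. Qed.
Let tN' X Y : vfield M X -> vfield M Y -> tangent M p (N' X Y p).
Proof. by move=> vX vY; case: (conn_vfield kN' vX vY) => _; exact. Qed.
Let tD X Y : vfield M X -> vfield M Y -> tangent M p (D X Y).
Proof. by move=> vX vY; apply: tB => //; [exact: tN|exact: tN']. Qed.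

Let D_J X Y : vfield M X -> vfield M Y -> D X (jf Y) = J p (D X Y).
Proof.
move=> vX vY; rewrite /D (chern_complex cN vX vY Mp) (chern_complex cN' vX vY Mp).
by rewrite JB //; [exact: tN|exact: tN'].
Qed.

Let D_skew X Y Z : vfield M X -> vfield M Y -> vfield M Z ->
  g p (D X Y) (Z p) = - g p (D X Z) (Y p).
Proof.
move=> vX vY vZ; have tY := vY.2 p Mp; have tZ := vZ.2 p Mp.
have := chern_metric cN vX vY vZ Mp; rewrite (chern_metric cN' vX vY vZ Mp).
rewrite /D !gB //; try (exact: tN); try (exact: tN').
rewrite (gC Mp tY (tN vX vZ)) (gC Mp tY (tN' vX vZ)).
by move=> /eqP; rewrite eq_sym -subr_eq0 opprD addrACA addr_eq0 => /eqP.
Qed.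

Let T10_pair X : vfield M X -> T10_field M J (jf X, X).
Proof.
move=> vX; split=> /=; [exact: vfJ|exact: vX|move=> q Mq].
have tX := vX.2 q Mq.
by split; rewrite /cval /=; [exact: Jt|exact: tX|rewrite JJ|].
Qed.

Let T X Y := D X Y - D Y X.

Let torsionB X Y : torsion M N X Y p - torsion M N' X Y p = T X Y.
Proof.
rewrite /torsion /T /D; set b := bracket _ _ _ _.
by rewrite [X in _ + X = _]opprD opprK addrACA addNr addr0 opprD addrACA -opprD.
Qed.

Let cconj2 Y : (cconj (jf Y, Y)).2 = opp Y.
Proof. by apply/funext => q; rewrite oppE. Qed.

Let D_opp X Y : vfield M X -> vfield M Y -> (D (opp X) Y = - D X Y) * (D X (opp Y) = - D X Y).
Proof.
by move=> vX vY; rewrite /D !connection_oppl // !connection_oppr // -opprB opprK addrC.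
Qed.

Let D_torsion X Y : vfield M X -> vfield M Y ->
  T (jf X) (jf Y) + T X Y = 0 /\ T X (jf Y) = T (jf X) Y.
Proof.
move=> vX vY; have jX := vfJ vX; have jY := vfJ vY; have oY := vfN vY.
have := chern_torsion cN (T10_pair vX) (T10_pair vY) Mp.
rewrite -(chern_torsion cN' (T10_pair vX) (T10_pair vY) Mp) /ctorsion cconj2 /= => -[e1 e2].
have TN S : vfield M S -> T S (opp Y) = - T S Y.
  by move=> vS; rewrite /T (D_opp vS vY).2 (D_opp vY vS).1 [RHS]opprD.
split.
  by have := subr_eq_cross e1; rewrite !torsionB TN // opprK.
have := addr_eq_cross e2; rewrite !torsionB TN // addrC => /eqP.
by rewrite subr_eq0 => /eqP.
Qed.

Let D_jf X Y : vfield M X -> vfield M Y -> D (jf X) Y = J p (D X Y).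
Proof.
move=> vX vY; have jX := vfJ vX; have jY := vfJ vY.
have [e1 e2] := D_torsion vX vY.
(* [P] is the deviation from complex linearity in the first slot; the torsion condition makes it
   both symmetric and skew-symmetric. *)
set P := D (jf X) Y - J p (D X Y); set P' := D (jf Y) X - J p (D Y X).
have skew : P = - P'.
  move: e2; rewrite /T !D_J // /P /P' => /(canRL (subrK _)) ->.
  exact: subr_swap.
have sym : J p P = J p P'.
  have JP S U : vfield M S -> vfield M U ->
      J p (D (jf S) U - J p (D S U)) = J p (D (jf S) U) + D S U.
    move=> vS vU; rewrite (JB Mp (tD (vfJ vS) vU) (Jt Mp (tD vS vU))).
    by rewrite (JJ Mp (tD vS vU)) opprK.
  rewrite /P /P' !JP //; move: e1; rewrite /T (D_J jX vY) (D_J jY vX).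
  exact: cross_eq_add.
have tP : tangent M p P by apply: tB => //; [exact: tD|apply: Jt => //; exact: tD].
have tP' : tangent M p P' by apply: tB => //; [exact: tD|apply: Jt => //; exact: tD].
have symP : P = P' by apply: oppr_inj; rewrite -(JJ Mp tP) -(JJ Mp tP') sym.
have P0 : P = 0.
  have : P *+ 2 = 0 by rewrite mulr2n {2}symP skew addNr.
  by move/eqP; rewrite -scaler_nat scaler_eq0 pnatr_eq0 /= => /eqP.
by apply/eqP; rewrite -subr_eq0; apply/eqP.
Qed.

(** The difference [D] of two Chern connections is complex linear in both arguments and
    skew with respect to the metric. Moving [J] from one argument to the other gives
    [g (J D(X, Y)) Z = - g (J D(X, Y)) Z], and [Z] can be taken equal to [J D(X, Y)]. *)
Lemma chern_unique_at X Y : vfield M X -> vfield M Y -> N X Y p = N' X Y p.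
Proof.
move=> vX vY; have jX := vfJ vX.
have skewJ a b : tangent M p a -> tangent M p b -> g p (J p a) b = - g p a (J p b).
  move=> ta tb; have tJa := Jt Mp ta; have tJb := Jt Mp tb.
  have t0 : tangent M p 0 by rewrite -(subrr a); exact: tB.
  have g00 c : tangent M p c -> g p 0 c = 0.
    by move=> tc; rewrite -(subrr a) gB // subrr.
  rewrite -(gJ Mp tJa tb) JJ // -[- a]sub0r gB // g00 // sub0r //.
have key Z : vfield M Z -> g p (J p (D X Y)) (Z p) = 0.
  move=> vZ; have jZ := vfJ vZ; have tZ := vZ.2 p Mp; have tY := vY.2 p Mp.
  have e1 : g p (J p (D X Y)) (Z p) = g p (J p (D X Z)) (Y p).
    by rewrite (skewJ _ _ (tD vX vY) tZ) -[J p (Z p)]/(jf Z p) (D_skew vX vY jZ) opprK D_J.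
  have e2 := D_skew jX vY vZ; rewrite !D_jf // in e2.
  have : g p (J p (D X Y)) (Z p) *+ 2 = 0 by rewrite mulr2n {1}e2 e1 addNr.
  by move/eqP; rewrite mulrn_eq0 /= => /eqP.
have vD : vfield M (N X Y \+ opp (N' X Y)).
  by apply: vfD; [exact: (conn_vfield kN)|apply: vfN; exact: (conn_vfield kN')].
have := key _ (vfJ vD); rewrite /= oppE -/(D X Y) gJ //; try exact: tD.
by move/(g0 Mp (tD vX vY))/eqP; rewrite subr_eq0 => /eqP.
Qed.

End Difference.

Lemma chernE N X Y : is_chern M g J N -> vfield M X -> vfield M Y ->
  eq_on M (chern M g J X Y) (N X Y).
Proof.
move=> cN vX vY p Mp; apply: chern_unique_at => //.
by rewrite /chern; case: xgetP => [N' _ //|/(_ N)].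
Qed.

End ChernUnique.

Fact pos_comb_ge0 (K : numDomainType) (t a b : K) : 0 < t -> 0 <= a -> 0 <= b ->
  0 <= 2 * a + t * b.
Proof. by move=> /ltW t0 a0 b0; rewrite addr_ge0 ?mulr_ge0 ?ler0n. Qed.

Fact pos_comb_eq0 (K : numDomainType) (t a b : K) : 0 < t -> 0 <= a -> 0 <= b ->
  2 * a + t * b = 0 -> a = 0 /\ b = 0.
Proof.
move=> t0 a0 b0 /eqP; rewrite paddr_eq0 ?mulr_ge0 ?ler0n ?(ltW t0) //.
by rewrite !mulf_eq0 pnatr_eq0 (gt_eqF t0) => /andP[/eqP -> /eqP ->].
Qed.

Fact regroup (K : comNzRingType) (t x y : K) : 2 * x + (t - 2) * y = 2 * (x - y) + t * y.
Proof. by ring. Qed.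

Section Compression.
Variables (K : comNzRingType) (N : nat).
Implicit Types (P Q V W : 'M[K]_N).

Lemma idem_compl Q : Q *m Q = Q -> (1%:M - Q) *m (1%:M - Q) = 1%:M - Q.
Proof. by move=> QQ; rewrite mulmxBl mulmxBr !mulmxBr !mulmx1 !mul1mx QQ subrr subr0. Qed.

Lemma mulmx_split V Q : V = V *m Q + V *m (1%:M - Q).
Proof. by rewrite mulmxBr mulmx1 addrC subrK. Qed.

Lemma tr_square_compress P S V : P *m P = P -> S *m S = S ->
  \tr (S *m (V *m P) *m (P *m V *m S)) = \tr (S *m V *m P *m V).
Proof.
move=> PP SS; rewrite mxtrace_mulC.
have -> : P *m V *m S *m (S *m (V *m P)) = P *m V *m (S *m S) *m V *m P by mx_ring.
by rewrite SS -!mulmxA mxtrace_mulC -!mulmxA PP mxtrace_mulC -!mulmxA mxtrace_mulC -!mulmxA.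
Qed.

Lemma tr_compl P Q V : \tr ((1%:M - Q) *m V *m P *m V) =
  \tr (V *m P *m V) - \tr (Q *m V *m P *m V).
Proof. by rewrite !mulmxBl mul1mx mxtraceB. Qed.

Lemma hformBl s P Q V V' W : hform s P Q (V - V') W = hform s P Q V W - hform s P Q V' W.
Proof. by rewrite -scaleN1r hformDl hformZl mulN1r. Qed.

Lemma hform_conj_transpose s P Q V W :
  2 * \tr (W *m (P *m V)) + s * \tr (W *m (P *m (V *m Q))) = hform s P Q W V.
Proof. by rewrite hformE !mulmxA (mxtrace_mulC _ Q) !mulmxA. Qed.
End Compression.

Section ChernOfCP.
Variables (R : realType) (n : nat) (n0 : (0 < n)%N) (t : R) (ht : 0 < t).
Local Notation C := R[i].
Local Notation A := (ambient R n).
Local Notation Mat := 'M[C]_(n + n).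
Local Notation tc := (@to_complex R n).
Local Notation CPn := (@CP R n).
Local Notation nabla0 := (@nabla0 R n t).
Local Notation Jn := (@CP_J R n).
Local Notation gn := (@CP_metric R n t).
Local Notation h P := (hform (t - 2)%:C%C P (tau P)).
Implicit Types (P Q S T V W : Mat) (p v w : A) (X Y Z : A -> A) (f : A -> R).

Lemma is_tanB P V W : is_tan P V -> is_tan P W -> is_tan P (V - W).
Proof.
move=> [aV oV] [aW oW]; split; first by rewrite adjB aV aW.
by rewrite mulmxBr mulmxBl addrACA -opprD oV oW.
Qed.

Lemma ReB (x y : C) : complex.Re (x - y) = complex.Re x - complex.Re y.
Proof. exact: raddfB. Qed.

Lemma hform_adj s P Q V W : adj P = P -> adj Q = Q -> adj V = V -> adj W = W ->
  (hform s%:C%C P Q V W)^* = hform s%:C%C P Q W V.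
Proof.
move=> aP aQ aV aW; rewrite -[RHS]hform_conj_transpose [in LHS]hformE rmorphD !rmorphM.
by rewrite rmorph_nat /= conjRC -!tr_adj !adjM aP aQ aV aW.
Qed.

Lemma trM_ge0 k m (B : 'M[C]_(k, m)) : 0 <= \tr (adj B *m B).
Proof.
rewrite /mxtrace; apply: sumr_ge0 => i _; rewrite mxE; apply: sumr_ge0 => j _.
by rewrite !mxE mulrC -normCK exprn_ge0.
Qed.

Lemma Re_eq0 (z : C) : 0 <= z -> complex.Re z = 0 -> z = 0.
Proof. by case: z => a b; rewrite lecE /= => /andP[/eqP -> _] ->. Qed.

(** The two traces are the squared norms of [P V] and [P V Q], so that the form equals
    [2 |P V (1 - Q)|^2 + t |P V Q|^2]. *)
Lemma hform_definite P Q V : adj P = P -> adj Q = Q -> P *m P = P -> Q *m Q = Q ->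
  is_tan P V -> complex.Re (hform (t - 2)%:C%C P Q V V) = 0 -> V = 0.
Proof.
move=> aP aQ PP QQ [aV oV].
have [oQ oQQ] : adj (1%:M - Q) = 1%:M - Q /\ (1%:M - Q) *m (1%:M - Q) = 1%:M - Q.
  by split; [rewrite adjB adj1 aQ|exact: idem_compl].
have e S : adj S = S -> S *m S = S ->
    \tr (S *m V *m P *m V) = \tr (adj (P *m V *m S) *m (P *m V *m S)).
  by move=> aS SS; rewrite !adjM aP aV aS; apply/esym; exact: tr_square_compress.
have x0 := trM_ge0 (P *m V *m Q); have y0 := trM_ge0 (P *m V *m (1%:M - Q)).
have hx := e _ aQ QQ; have hy := e _ oQ oQQ; rewrite -{}hx in x0; rewrite -{}hy in y0.
have -> : hform (t - 2)%:C%C P Q V V =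
    2 * \tr ((1%:M - Q) *m V *m P *m V) + t%:C%C * \tr (Q *m V *m P *m V).
  apply: (etrans (hformE _ _ _ _ _)); rewrite tr_compl rmorphB /= rmorph_nat.
  exact: regroup.
have tC : 0 < t%:C%C :> C by rewrite ltcR.
move=> /(Re_eq0 (pos_comb_ge0 tC y0 x0)) /(pos_comb_eq0 tC y0 x0)[y1 x1].
rewrite e // in y1; rewrite e // in x1.
have y2 := adj_sum_eq0 y1; have x2 := adj_sum_eq0 x1.
have PV : P *m V = 0 by rewrite (mulmx_split (P *m V) Q) x2 y2 addr0.
by rewrite -oV PV add0r -aV -[in LHS]aP -adjM PV adj0.
Qed.

Lemma J_mxB P V W : J_mx P (V - W) = J_mx P V - J_mx P W.
Proof. by rewrite J_mxDr J_mxN. Qed.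

Lemma metric_tcE p v w V W : CPn p -> tc v = V -> tc w = W ->
  is_tan (tc p) V -> is_tan (tc p) W -> gn p v w = 4 * n.+1%:R * complex.Re (h (tc p) V W).
Proof. by move=> Mp <- <-; exact: metricE. Qed.

Lemma CP_chernE X Y : vfield CPn X -> vfield CPn Y ->
  eq_on CPn (chern CPn gn Jn X Y) (nabla0 X Y).
Proof.
apply: chernE; last exact: (nabla0_chern n0 ht).
- exact: (vfieldD n0).
- exact: (vfieldZ n0).
- exact: (vfield_J n0).
- move=> p a b Mp /(tangentP n0 _ Mp) ta /(tangentP n0 _ Mp) tb.
  by apply/(tangentP n0 _ Mp); rewrite to_complexB; exact: is_tanB.
- move=> p a b Mp /(tangentP n0 _ Mp) ta /(tangentP n0 _ Mp) tb.
  have [_ _ _ _ aP] := tau_facts n0 Mp.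
  rewrite (metricE n0 t Mp ta tb) (metricE n0 t Mp tb ta) -(hform_adj _ aP _ ta.1 tb.1) ?ReJ //.
  by rewrite -tau_adj aP.
- move=> p a b c Mp /(tangentP n0 _ Mp) ta /(tangentP n0 _ Mp) tb /(tangentP n0 _ Mp) tc'.
  have tab : is_tan (tc p) (tc (a - b)) by rewrite to_complexB; exact: is_tanB.
  rewrite (metricE n0 t Mp tab tc') (metricE n0 t Mp ta tc') (metricE n0 t Mp tb tc').
  by rewrite to_complexB hformBl ReB mulrBr.
- move=> p a b Mp /(tangentP n0 _ Mp) ta /(tangentP n0 _ Mp) tb.
  have [PP _ PQ QP aP] := tau_facts n0 Mp.
  have ja := JE n0 Mp ta; have jb := JE n0 Mp tb.
  have tja := is_tan_J PP aP ta; have tjb := is_tan_J PP aP tb.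
  rewrite (metricE n0 t Mp ta tb) (metric_tcE Mp ja jb tja tjb).
  rewrite !J_mxE hformZl hformZr (hform_Jl _ _ PP ta.2 QP) (hform_Jr _ _ PP ta.2 QP PQ).
  by rewrite mulrA -expr2 sqr_i mulrNN mul1r.
- move=> p a Mp /(tangentP n0 _ Mp) ta; rewrite (metricE n0 t Mp ta ta) => /eqP.
  have [PP QQ PQ QP aP] := tau_facts n0 Mp.
  rewrite mulf_eq0 (gt_eqF (mulr_gt0 _ _)) ?ltr0n //= => /eqP e.
  apply: (can_inj (@to_complexK R n)); rewrite to_complex0.
  by apply: (hform_definite aP _ PP QQ ta e); rewrite -tau_adj aP.
- move=> p a b Mp /(tangentP n0 _ Mp) ta /(tangentP n0 _ Mp) tb.
  have tab : is_tan (tc p) (tc (a - b)) by rewrite to_complexB; exact: is_tanB.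
  apply: (can_inj (@to_complexK R n)); apply: (etrans (JE n0 Mp tab)).
  apply: (etrans (congr1 (J_mx (tc p)) (to_complexB a b))); apply: (etrans (J_mxB _ _ _)).
  apply: esym; apply: (etrans (to_complexB _ _)).
  exact: (congr2 (fun x y => x - y) (JE n0 Mp ta) (JE n0 Mp tb)).
- move=> p a Mp /(tangentP n0 _ Mp) ta; have [PP _ _ _ aP] := tau_facts n0 Mp.
  have ja := JE n0 Mp ta; have tja := is_tan_J PP aP ta.
  apply: (can_inj (@to_complexK R n)); apply: (etrans (JE n0 Mp _)); first by rewrite ja.
  rewrite ja; apply: (etrans (J_mx_sq PP ta.2)); apply: esym; exact: to_complexN.
- move=> p a Mp /(tangentP n0 _ Mp) ta; have [PP _ _ _ aP] := tau_facts n0 Mp.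
  apply/(tangentP n0 _ Mp); rewrite (JE n0 Mp ta); exact: (is_tan_J PP aP ta).
Qed.
End ChernOfCP.

(** * Curvature as a matrix *)

Section SmoothDifference.
Variables (R : realType) (V W : normedModType R).
Implicit Types F G : V -> W.

Lemma derive_add F G p v : smooth F -> smooth G ->
  'D_v (fun p => F p + G p) p = 'D_v F p + 'D_v G p.
Proof. by move=> sF sG; rewrite deriveD //; exact: smooth_derivable. Qed.

Lemma derive_dirB F p u v : smooth F -> 'D_(u - v) F p = 'D_u F p - 'D_v F p.
Proof. by move=> sF; rewrite -scaleN1r derive_dirD // derive_dirZ // scaleN1r. Qed.
End SmoothDifference.

Section CurvatureAlgebra.
Variables (K : comNzRingType) (N : nat).
Implicit Types (P Q X Y Z V W R : 'M[K]_N).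

(** [P V P = 0] for an odd [V], so only one block of the first argument matters. *)
Lemma hform_compress s P Q R R' V : P *m P = P -> odd P V -> P *m Q = 0 -> Q *m P = 0 ->
  (1%:M - P) *m R *m P = (1%:M - P) *m R' *m P -> hform s P Q R V = hform s P Q R' V.
Proof.
move=> PP oV PQ QP e; have PVP := odd_PXP PP oV.
have key R0 S : S *m P = P *m S -> \tr (S *m R0 *m P *m V) = \tr (S *m ((1%:M - P) *m R0 *m P) *m V).
  move=> SP; have -> : S *m ((1%:M - P) *m R0 *m P) *m V =
    S *m R0 *m P *m V - S *m P *m R0 *m P *m V by mx_ring.
  have z : \tr (S *m P *m R0 *m P *m V) = 0.
    rewrite SP -!mulmxA mxtrace_mulC -!mulmxA; rewrite -mulmxA in PVP.
    by rewrite PVP !mulmx0 mxtrace0.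
  by rewrite mxtraceB z subr0.
rewrite !hformE; congr (_ * _ + _ * _); last by rewrite !(key _ Q) ?e // PQ QP.
by have := key R 1%:M; have := key R' 1%:M; rewrite !mul1mx mulmx1 e => -> // ->.
Qed.

Fact curv_expand (k : K) (a b c d e f a' b' c' d' e' f' : 'M[K]_N) :
  a + k *: b + (c + k *: d + k *: (e + k *: f)) - (a' + k *: b' + (c' + k *: d' + k *: (e' + k *: f'))) =
  (a + c - (a' + c')) + k *: (b + d + e - (b' + d' + e')) + (k * k) *: (f - f').
Proof. by apply/matrixP => i j; rewrite !mxE; ring. Qed.

Fact compress_expand2 (k : K) (S P a b : 'M[K]_N) : S *m (a + k *: b) *m P = S *m a *m P + k *: (S *m b *m P).
Proof. by rewrite mulmxDr mulmxDl -scalemxAr -scalemxAl. Qed.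

Fact compress_expand (k l : K) (S P a b c : 'M[K]_N) : S *m (a + k *: b + l *: c) *m P =
  S *m a *m P + k *: (S *m b *m P) + l *: (S *m c *m P).
Proof. by rewrite compress_expand2 mulmxDr mulmxDl -scalemxAr -scalemxAl. Qed.

Fact curv_regroup (T U g0 u v a b c d e f g : 'M[K]_N) :
  T = U + g0 -> U = u + v -> u = a + b -> v = c + d + e -> g0 = f + g ->
  T = (c + g) + (a + d) + (b + (f + e)).
Proof. by move=> -> -> -> -> ->; apply/matrixP => i j; rewrite !mxE; ring. Qed.

Fact curv_cancel (T T' B a a' b b' c c' s g g' : 'M[K]_N) :
  T = a + (b + c) + (s + (g + g')) -> T' = a' + (b' + c') + (s + (g' + g)) ->
  B = (b - b') + (c - c') -> T - T' - B = a - a'.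
Proof. by move=> -> -> ->; apply/matrixP => i j; rewrite !mxE; ring. Qed.

Lemma odd_sub P X Y Z W : X *m Y + P *m Z + (Z *m P + Y *m X) = Z ->
  Y *m X + P *m W + (W *m P + X *m Y) = W -> odd P (Z - W).
Proof. by move=> e1 e2; rewrite /odd -{3}e1 -{3}e2; mx_ring. Qed.

(** Represents the curvature operator up to matrices without the relevant block. *)
Definition curv_mx (k : K) Q X Y Z X' Y' := (X *m Y - Y *m X) *m Z - Z *m (X *m Y - Y *m X) +
  k *: ((X' *m Y' - Y' *m X') *m Z + Q *m (X' *m Y - Y' *m X) *m Z).

Lemma curv_compress k P Q X Y Z X' Y' :
  P *m P = P -> Q *m Q = Q -> P *m Q = 0 -> Q *m P = 0 ->
  odd P X -> odd P Y -> odd P Z -> odd Q X' -> odd Q Y' ->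
  let G A A' B := gam0 P A B + k *: gam1 P Q A' B in
  let D A A' B B' := dgam0 A B Z + k *: dgam1 P Q A A' B' Z in
  (1%:M - P) *m (D X X' Y Y' + G X X' (G Y Y' Z) - (D Y Y' X X' + G Y Y' (G X X' Z))) *m P =
  (1%:M - P) *m curv_mx k Q X Y Z X' Y' *m P.
Proof.
move=> PP QQ PQ QP oX oY oZ oX' oY' G D.
have e0 := curv_order0 PP Z oX oY.
have e1 := curv_order1 PP PQ QP X' Y' oX oY oZ.
have e2 := curv_order2 PP QQ QP Z Y' oX'.
have e3 := curv_order2 PP QQ QP Z X' oY'.
rewrite /G /D !(gam0Dr, gam0Zr, gam1Dr, gam1Zr) curv_expand e0.
have e4 : (1%:M - P) *m (gam1 P Q X' (gam1 P Q Y' Z) - gam1 P Q Y' (gam1 P Q X' Z)) *m P = 0.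
  by rewrite mulmxBr mulmxBl e2 e3 subrr.
by rewrite compress_expand e1 e4 scaler0 addr0 /curv_mx compress_expand2.
Qed.
End CurvatureAlgebra.

Section Curvature.
Variables (R : realType) (n : nat) (n0 : (0 < n)%N) (t : R) (ht : 0 < t).
Local Notation C := R[i].
Local Notation A := (ambient R n).
Local Notation Mat := 'M[C]_(n + n).
Local Notation tc := (@to_complex R n).
Local Notation CPn := (@CP R n).
Local Notation Gam := (Gam t).
Local Notation dGam := (dGam t).
Local Notation nabla0 := (@nabla0 R n t).
Local Notation Jn := (@CP_J R n).
Local Notation gn := (@CP_metric R n t).
Implicit Types (P Q S T V W : Mat) (p v w : A) (X Y Z : A -> A) (f : A -> R).

Lemma smoothB (F G : A -> A) : smooth F -> smooth G -> smooth (fun p => F p - G p).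
Proof.
move=> sF sG; rewrite (_ : (fun p => _) = fun p => F p + (-1) *: G p).
  exact: (smoothD sF (smooth_scale (smooth_cst _ _) sG)).
by apply/funext => p; rewrite scaleN1r.
Qed.

Lemma GamBl P S T V : Gam P (S - T) V = Gam P S V - Gam P T V.
Proof. by rewrite -scaleN1r GamDl GamZl scaleN1r. Qed.

Lemma bracket_ext X Y F G : vfield CPn X -> vfield CPn Y ->
  is_smooth_extension CPn X F -> is_smooth_extension CPn Y G ->
  is_smooth_extension CPn (bracket CPn X Y) (fun q => 'D_(F q) G q - 'D_(G q) F q).
Proof.
move=> [_ tX] [_ tY] [sF FX] [sG GY]; split.
  exact: (smoothB (smooth_derive_field sG sF) (smooth_derive_field sF sG)).
move=> p Mp; rewrite /bracket (mderivE (conj sG GY) (tX p Mp)) (mderivE (conj sF FX) (tY p Mp)).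
by rewrite FX ?GY.
Qed.

Lemma vfield_bracket X Y : vfield CPn X -> vfield CPn Y -> vfield CPn (bracket CPn X Y).
Proof.
move=> vX vY; have [F eF] := vfield_ext vX; have [G eG] := vfield_ext vY.
have eB := bracket_ext vX vY eF eG.
apply: (vfieldP n0 eB) => p Mp; rewrite -(eB.2 p Mp) (eF.2 p Mp) (eG.2 p Mp).
have [a1 o1] := derive_vfield n0 vY eG Mp (vX.2 p Mp).
have [a2 o2] := derive_vfield n0 vX eF Mp (vY.2 p Mp).
split; last by apply: (etrans (congr1 (fun S => tc p *m S + S *m tc p) (to_complexB _ _)));
  apply: (etrans (odd_sub o1 o2)); apply: esym; exact: to_complexB.
apply: (etrans (congr1 (@adj R _ _) (to_complexB _ _))); apply: (etrans (adjB _ _)).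
apply: (etrans (congr2 (fun x y => x - y) a1 a2)); apply: esym; exact: to_complexB.
Qed.

(** Apart from the first line, which yields the curvature, the terms are either those of
    the connection along the derivative of [Y], or symmetric in [X] and [Y]. *)
Lemma nabla0_nabla0 X Y Z F G H p : vfield CPn X -> vfield CPn Y -> vfield CPn Z ->
  is_smooth_extension CPn X F -> is_smooth_extension CPn Y G -> is_smooth_extension CPn Z H ->
  CPn p ->
  let P := tc p in let x := tc (X p) in let y := tc (Y p) in let z := tc (Z p) in
  tc (nabla0 X (nabla0 Y Z) p) =
  (dGam P x y z + Gam P x (Gam P y z)) +
  (tc ('D_('D_(X p) G p) H p) + Gam P (tc ('D_(X p) G p)) z) +
  (tc ('D_(X p) (fun q => 'D_(Y p) H q) p) + (Gam P x (tc ('D_(Y p) H p)) + Gam P y (tc ('D_(X p) H p)))).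
Proof.
move=> vX vY vZ eF eG eH Mp P x y z.
have eN := ext_nabla0 t vY vZ eG eH.
have [[sG GY] [sH HZ]] := (eG, eH).
have sG' := smooth_to_complex sG; have sH' := smooth_to_complex sH; have stc := @msmooth_tc R n.
have sGam := msmooth_Gam t stc sG' sH'.
have e1 : tc ('D_(X p) (fun q => 'D_(G q) H q + of_complex (Gam (tc q) (tc (G q)) (tc (H q)))) p) =
   tc ('D_(X p) (fun q => 'D_(G q) H q) p) +
   tc ('D_(X p) (fun q => of_complex (Gam (tc q) (tc (G q)) (tc (H q)))) p).
  apply: (etrans (congr1 tc
    (derive_add p (X p) (smooth_derive_field sH sG) (smooth_of_complex sGam)))).
  exact: to_complexD.
have e2 : tc ('D_(X p) (fun q => of_complex (Gam (tc q) (tc (G q)) (tc (H q)))) p) =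
   dGam P x y z + Gam P (tc ('D_(X p) G p)) z + Gam P y (tc ('D_(X p) H p)).
  apply: (etrans (esym (mder_to_complex p (X p) (smooth_of_complex sGam)))).
  have -> : (fun q => tc (of_complex (Gam (tc q) (tc (G q)) (tc (H q))))) =
      (fun q => Gam (tc q) (tc (G q)) (tc (H q))) by apply/funext => q; exact: of_complexK.
  apply: (etrans (mder_Gam t p (X p) stc sG' sH')).
  rewrite (mder_tc p (X p)) (mder_to_complex p (X p) sG) (mder_to_complex p (X p) sH).
  by rewrite (GY p Mp) (HZ p Mp).
have e3 : 'D_(X p) (fun q => 'D_(G q) H q) p =
    'D_('D_(X p) G p) H p + 'D_(X p) (fun q => 'D_(Y p) H q) p.
  apply: (etrans (derive_field p (X p) sH sG)).
  exact: (congr1 (fun u => 'D_('D_(X p) G p) H p + 'D_(X p) (fun q => 'D_u H q) p) (GY p Mp)).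
have e4 : tc (nabla0 Y Z p) = tc ('D_(Y p) H p) + Gam P y z := nabla0_tc t vY eH Mp.
apply: (curv_regroup (nabla0_tc t vX eN Mp) e1 (etrans (congr1 tc e3) (to_complexD _ _)) e2).
exact: (etrans (congr1 (Gam P x) e4) (GamDr t _ _ _ _)).
Qed.

Lemma nabla0_curvature X Y Z p : vfield CPn X -> vfield CPn Y -> vfield CPn Z -> CPn p ->
  let P := tc p in let x := tc (X p) in let y := tc (Y p) in let z := tc (Z p) in
  tc (curvature CPn nabla0 X Y Z p) =
  dGam P x y z + Gam P x (Gam P y z) - (dGam P y x z + Gam P y (Gam P x z)).
Proof.
move=> vX vY vZ Mp P x y z.
have [F eF] := vfield_ext vX; have [G eG] := vfield_ext vY; have [H eH] := vfield_ext vZ.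
have sH := eH.1.
have e1 := nabla0_nabla0 vX vY vZ eF eG eH Mp.
have e2 := nabla0_nabla0 vY vX vZ eG eF eH Mp.
have e3 := nabla0_tc t (vfield_bracket vX vY) eH Mp.
have eB : bracket CPn X Y p = 'D_(X p) G p - 'D_(Y p) F p.
  by rewrite -((bracket_ext vX vY eF eG).2 p Mp) (eF.2 p Mp) (eG.2 p Mp).
have e4 : tc ('D_(bracket CPn X Y p) H p) =
    tc ('D_('D_(X p) G p) H p) - tc ('D_('D_(Y p) F p) H p).
  rewrite eB; apply: (etrans (congr1 tc (derive_dirB _ _ _ sH))); exact: to_complexB.
have e5 : Gam P (tc (bracket CPn X Y p)) z = Gam P (tc ('D_(X p) G p)) z - Gam P (tc ('D_(Y p) F p)) z.
  rewrite eB; apply: (etrans (congr1 (fun u => Gam P u z) (to_complexB _ _))); exact: GamBl.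
rewrite /curvature; apply: (etrans (to_complexB _ _)).
apply: (etrans (congr2 (fun a b => a - b) (to_complexB _ _) e3)).
have e2' u : 'D_(Y p) (fun q => 'D_(X p) H q) p = u -> tc (nabla0 Y (nabla0 X Z) p) =
  (dGam P y x z + Gam P y (Gam P x z)) +
  (tc ('D_('D_(Y p) F p) H p) + Gam P (tc ('D_(Y p) F p)) z) +
  (tc u + (Gam P y (tc ('D_(X p) H p)) + Gam P x (tc ('D_(Y p) H p)))).
  by move=> <-; exact: e2.
exact: (curv_cancel e1 (e2' _ (schwarz_field p (X p) (Y p) sH)) (congr2 (fun a b => a + b) e4 e5)).
Qed.

End Curvature.

(** * Curvature in terms of vectors *)

Section VectorForm.
Variables (K : comNzRingType) (N : nat).
Local Notation row := 'M[K]_(1, N).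
Local Notation col := 'M[K]_(N, 1).
Implicit Types (a b : row) (u v w : col).

Definition dot a u : K := (a *m u) 0 0.

Lemma dotDr a u v : dot a (u + v) = dot a u + dot a v.
Proof. by rewrite /dot mulmxDr mxE. Qed.
Lemma dotNr a u : dot a (- u) = - dot a u.
Proof. by rewrite /dot mulmxN mxE. Qed.
Lemma dotZr a k u : dot a (k *: u) = k * dot a u.
Proof. by rewrite /dot -scalemxAr mxE. Qed.

Lemma rank1_mul u a v : u *m a *m v = dot a v *: u.
Proof. by rewrite -mulmxA [a *m v]mx11_scalar mul_mx_scalar. Qed.

Lemma tr_rank1 u a : \tr (u *m a) = dot a u.
Proof. by rewrite mxtrace_mulC /mxtrace big_ord1. Qed.

(** The form of a tangent vector at the projection [e *m e^*]. Rows are kept independent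
    of columns, which makes the computation below polynomial. *)
Definition rank2 v a u b := v *m a + u *m b.
Lemma rank2_mul v a u b w : rank2 v a u b *m w = dot a w *: v + dot b w *: u.
Proof. by rewrite mulmxDl !rank1_mul. Qed.

Lemma curv_mx_mul (k : K) Q x y z x' y' u : curv_mx k Q x y z x' y' *m u =
  (x *m (y *m (z *m u)) - y *m (x *m (z *m u)) - (z *m (x *m (y *m u)) - z *m (y *m (x *m u)))) +
  k *: (x' *m (y' *m (z *m u)) - y' *m (x' *m (z *m u)) +
        (Q *m (x' *m (y *m (z *m u))) - Q *m (y' *m (x *m (z *m u))))).
Proof.
rewrite /curv_mx mulmxDl -scalemxAl mulmxDl !mulNmx.
by rewrite !(mulmxDl, mulmxDr, mulNmx, mulmxN) -!mulmxA.
Qed.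

Variables (k s : K) (ks : k * (2 + s) = s).
Variables (e f xi eta ze nu jxi jeta : col) (e' f' xi' eta' ze' nu' jxi' jeta' : row).
Hypotheses (ee : dot e' e = 1) (ff : dot f' f = 1) (ef : dot e' f = 0) (fe : dot f' e = 0).
Hypotheses (e_xi : dot e' xi = 0) (e_eta : dot e' eta = 0) (e_ze : dot e' ze = 0) (e_nu : dot e' nu = 0).
Hypotheses (xi_e : dot xi' e = 0) (eta_e : dot eta' e = 0) (ze_e : dot ze' e = 0).
Hypotheses (jxi_f : dot jxi' f = 0) (jeta_f : dot jeta' f = 0).
Hypotheses (f_jxi : dot f' jxi = 0) (f_jeta : dot f' jeta = 0).
Hypotheses (jxi_e : dot jxi' e = - dot f' xi) (jeta_e : dot jeta' e = - dot f' eta).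
Hypotheses (jxi_jeta : dot jxi' jeta = dot eta' xi) (jeta_jxi : dot jeta' jxi = dot xi' eta).

Lemma hform_rank2 P Q M : P = e *m e' -> Q = f *m f' ->
  hform s P Q M (rank2 nu e' e nu') = 2 * dot nu' (M *m e) + s * (dot nu' f * dot f' (M *m e)).
Proof.
move=> -> ->; rewrite hformE.
have PV : e *m e' *m rank2 nu e' e nu' = e *m nu'.
  by rewrite -mulmxA /rank2 mulmxDr !mulmxA [e' *m nu]mx11_scalar [e' *m e]mx11_scalar
    -/(dot e' nu) -/(dot e' e) e_nu ee raddf0 mul0mx add0r mul1mx.
have MV S : S *m (e *m e') *m rank2 nu e' e nu' = S *m e *m nu'.
  by rewrite -mulmxA PV mulmxA.
rewrite !MV !tr_rank1; congr (_ + _ * _).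
by rewrite -[f *m f' *m M *m e]mulmxA -[f *m f' *m _]/(_ *m _) rank1_mul dotZr mulrC.
Qed.

Lemma curv_mx_vec (Q : 'M[K]_N) : Q = f *m f' ->
  let x := rank2 xi e' e xi' in let y := rank2 eta e' e eta' in let z := rank2 ze e' e ze' in
  let x' := rank2 f jxi' jxi f' in let y' := rank2 f jeta' jeta f' in
  curv_mx k Q x y z x' y' *m e =
  dot eta' ze *: xi - dot xi' ze *: eta - (dot xi' eta - dot eta' xi) *: ze +
  k *: (dot jeta' ze *: jxi - dot jxi' ze *: jeta + ((dot eta' xi - dot xi' eta) * dot f' ze
         - dot f' xi * dot eta' ze + dot f' eta * dot xi' ze) *: f).
Proof.
move=> eQ x y z x' y'.
have xe : x *m e = xi by rewrite rank2_mul ee xi_e scale1r scale0r addr0.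
have ye : y *m e = eta by rewrite rank2_mul ee eta_e scale1r scale0r addr0.
have zE : z *m e = ze by rewrite rank2_mul ee ze_e scale1r scale0r addr0.
have xw w : dot e' w = 0 -> x *m w = dot xi' w *: e.
  by move=> h; rewrite rank2_mul h scale0r add0r.
have yw w : dot e' w = 0 -> y *m w = dot eta' w *: e.
  by move=> h; rewrite rank2_mul h scale0r add0r.
have xq w : x' *m w = dot jxi' w *: f + dot f' w *: jxi by rewrite rank2_mul.
have yq w : y' *m w = dot jeta' w *: f + dot f' w *: jeta by rewrite rank2_mul.
rewrite curv_mx_mul.
rewrite zE xe ye (xw _ e_ze) (yw _ e_ze) (xw _ e_eta) (yw _ e_xi) !(xq ze) !(yq ze).
rewrite -!scalemxAr !mulmxDr -!scalemxAr xe ye zE !(xq, yq) jxi_e jeta_e fe jxi_f jeta_f ff.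
rewrite jxi_jeta jeta_jxi f_jxi f_jeta eQ !scale0r !addr0 !scale1r !add0r -!scalemxAr !rank1_mul ff.
by apply/colP => i; rewrite !mxE; ring.
Qed.

(** The two lines are exchanged by [xi <-> eta]. All remaining terms carry the factor
    [s - k * (2 + s)]. *)
Lemma curvature_vec (P Q : 'M[K]_N) : P = e *m e' -> Q = f *m f' ->
  let x := rank2 xi e' e xi' in let y := rank2 eta e' e eta' in let z := rank2 ze e' e ze' in
  let x' := rank2 f jxi' jxi f' in let y' := rank2 f jeta' jeta f' in
  hform s P Q (curv_mx k Q x y z x' y') (rank2 nu e' e nu') =
  2 * (dot nu' xi * dot eta' ze + dot nu' ze * dot eta' xi + s * (dot nu' f * dot f' ze * dot eta' xi)
       - k * (dot jxi' ze * dot nu' jeta)) -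
  2 * (dot nu' eta * dot xi' ze + dot nu' ze * dot xi' eta + s * (dot nu' f * dot f' ze * dot xi' eta)
       - k * (dot jeta' ze * dot nu' jxi)).
Proof.
move=> eP eQ x y z x' y'; rewrite (hform_rank2 _ eP eQ) (curv_mx_vec eQ).
rewrite !(dotDr, dotNr, dotZr) f_jxi f_jeta ff.
move: ks (dot nu' f) (dot f' ze) (dot eta' xi) (dot xi' eta) (dot f' xi) (dot eta' ze) (dot f' eta) (dot xi' ze)
  (dot nu' xi) (dot nu' eta) (dot nu' ze) (dot jeta' ze) (dot jxi' ze) (dot nu' jxi) (dot nu' jeta).
move=> ks' nf fz hx xh fx hz fh xz nx nh nz jhz jxz njx njh.
set L := (X in X = _); set R := (X in _ = X).
have -> : L = R + (s - k * (2 + s)) * nf * (fx * hz - fh * xz - fz * (hx - xh)) by rewrite /L /R; ring.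
by rewrite ks' subrr !mul0r addr0.
Qed.

End VectorForm.

Section Quaternionic.
Variables (R : realType) (n : nat).
Local Notation C := R[i].
Local Notation N := (n + n)%N.
Local Notation Mat := 'M[C]_(n + n).
Local Notation Om := (Omega R n).
Local Notation cV := 'M[C]_(n + n, 1).
Implicit Types (P S : Mat) (u v w e : cV).

(** The quaternionic structure of C^2n: antilinear, of square -1. *)
Definition quat := locked_with gam_key (fun v : cV => Om *m (adj v)^T).
Lemma quatE v : quat v = Om *m (adj v)^T. Proof. by rewrite /quat unlock. Qed.

Lemma adj_tr m k (A : 'M[C]_(m, k)) : adj A^T = (adj A)^T.
Proof. by apply/matrixP => i j; rewrite !mxE. Qed.

Lemma adj_quat v : adj (quat v) = - (v^T *m Om).
Proof. by rewrite quatE adjM adj_tr adjK adjOmega mulmxN. Qed.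

Lemma tau_rank1 u w : tau (u *m adj w) = quat w *m adj (quat u).
Proof. by rewrite tauE adj_quat quatE trmx_mul mulmxN !mulmxA. Qed.

Lemma dot_tr (a : 'M[C]_(1, n + n)) u : dot a u = dot u^T a^T.
Proof. by rewrite /dot -trmx_mul [RHS]mxE. Qed.

Lemma dotC u v : dot (adj u) v = (dot (adj v) u)^*.
Proof. by rewrite /dot -[v in LHS]adjK -adjM !mxE. Qed.

Lemma dotNl (a : 'M[C]_(1, n + n)) u : dot (- a) u = - dot a u.
Proof. by rewrite /dot mulNmx mxE. Qed.

Lemma dot_quat_quat u w : dot (adj (quat u)) (quat w) = dot (adj w) u.
Proof.
rewrite adj_quat quatE dotNl /dot.
have -> : u^T *m Om *m (Om *m (adj w)^T) = - (adj w *m u)^T.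
  by rewrite trmx_mul mulmxA -[u^T *m _ *m _]mulmxA Omega2 mulmxN mulmx1 mulNmx.
by rewrite !mxE opprK.
Qed.

(** The symplectic form is alternating. *)
Lemma dot_quatC u w : dot (adj (quat u)) w = - dot (adj (quat w)) u.
Proof.
rewrite !adj_quat !dotNl; congr (- _); rewrite dot_tr trmx_mul trmxK trOmega.
by rewrite /dot mulNmx mulmxN mxE mulmxA.
Qed.

Lemma dot_quat_self u : dot (adj (quat u)) u = 0.
Proof.
have /eqP := dot_quatC u u; rewrite -addr_eq0 -mulr2n mulrn_eq0 /=.
by move/eqP.
Qed.

Section UnitVector.
Variables (e : cV) (e1 : dot (adj e) e = 1).
Local Notation P := (e *m adj e).
Local Notation Q := (quat e *m adj (quat e)).

Lemma tan_vec S : is_tan P S -> dot (adj e) (S *m e) = 0.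
Proof.
move=> [aS oS].
have Pe : P *m e = e by rewrite rank1_mul e1 scale1r.
have := congr1 (fun T => T *m e) oS; rewrite mulmxDl -[S *m P *m e]mulmxA Pe.
rewrite -[P *m S *m e]mulmxA rank1_mul.
move/(congr1 (dot (adj e))); rewrite dotDr dotZr e1 mulr1.
by move/eqP; rewrite -subr_eq0 addrK => /eqP.
Qed.

Lemma tan_rank2 S : is_tan P S -> S = rank2 (S *m e) (adj e) e (adj (S *m e)).
Proof. by move=> [aS oS]; rewrite /rank2 adjM aS -[LHS]oS addrC !mulmxA. Qed.

Lemma tau_rank2 S : is_tan P S -> tau S =
  rank2 (quat e) (adj (quat (S *m e))) (quat (S *m e)) (adj (quat e)).
Proof.
move=> tS; rewrite {1}(tan_rank2 tS); apply: (etrans (tauD _ _)).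
exact: (congr2 (fun a b => a + b) (tau_rank1 _ _) (tau_rank1 _ _)).
Qed.

(** One half of the curvature form: linear in [xi] and [ze], antilinear in [eta] and [nu].
    The other half is obtained by exchanging [xi] and [eta]. *)
Definition mform (s k : C) f (xi eta ze nu : cV) : C :=
  dot (adj nu) xi * dot (adj eta) ze + dot (adj nu) ze * dot (adj eta) xi +
  s * (dot (adj nu) f * dot (adj f) ze * dot (adj eta) xi) -
  k * (dot (adj (quat xi)) ze * dot (adj nu) (quat eta)).

Lemma hform_curvature (s k : C) (x y z v : Mat) : k * (2 + s) = s ->
  is_tan P x -> is_tan P y -> is_tan P z -> is_tan P v ->
  hform s P (tau P) (curv_mx k (tau P) x y z (tau x) (tau y)) v =
  2 * mform s k (quat e) (x *m e) (y *m e) (z *m e) (v *m e) -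
  2 * mform s k (quat e) (y *m e) (x *m e) (z *m e) (v *m e).
Proof.
move=> ks tx ty tz tv.
have ff : dot (adj (quat e)) (quat e) = 1 by rewrite dot_quat_quat.
have fe : dot (adj (quat e)) e = 0 := dot_quat_self e.
have v_e S : is_tan P S -> dot (adj (S *m e)) e = 0.
  by move=> tS; rewrite dotC (tan_vec tS) conjC0.
have jf S : is_tan P S -> dot (adj (quat (S *m e))) (quat e) = 0.
  by move=> tS; rewrite dot_quat_quat (tan_vec tS).
have fj S : is_tan P S -> dot (adj (quat e)) (quat (S *m e)) = 0.
  by move=> tS; rewrite dot_quat_quat (v_e S tS).
have je S : dot (adj (quat (S *m e))) e = - dot (adj (quat e)) (S *m e) := dot_quatC _ _.
have key := curvature_vec ks (adj (v *m e)) e1 ff fe (tan_vec tx) (tan_vec ty) (tan_vec tz) (tan_vec tv)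
  (v_e x tx) (v_e y ty) (v_e z tz) (jf x tx) (jf y ty) (fj x tx) (fj y ty) (je x) (je y)
  (dot_quat_quat _ _) (dot_quat_quat _ _) (erefl P) (tau_rank1 e e).
rewrite /= -(tau_rank2 tx) -(tau_rank2 ty) -(tan_rank2 tx) -(tan_rank2 ty) -(tan_rank2 tz) in key.
by rewrite -(tan_rank2 tv) in key.
Qed.

End UnitVector.
End Quaternionic.

Section CPCurvature.
Variables (R : realType) (n : nat) (n0 : (0 < n)%N) (t : R) (ht : 0 < t).
Local Notation C := R[i].
Local Notation A := (ambient R n).
Local Notation Mat := 'M[C]_(n + n).
Local Notation tc := (@to_complex R n).
Local Notation CPn := (@CP R n).
Local Notation nabla0 := (@nabla0 R n t).
Local Notation Jn := (@CP_J R n).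
Local Notation gn := (@CP_metric R n t).
Local Notation chernn := (chern CPn gn Jn).
Local Notation s := ((t - 2)%:C%C : C).
Implicit Types (X Y Z V : A -> A) (p : A).

Lemma chern_is_chern : is_chern CPn gn Jn chernn.
Proof. by apply: (@xgetPex _ _ [set nabla | is_chern CPn gn Jn nabla]); exists nabla0; exact: nabla0_chern. Qed.

Lemma curvature_chern X Y Z p : vfield CPn X -> vfield CPn Y -> vfield CPn Z -> CPn p ->
  curvature CPn chernn X Y Z p = curvature CPn nabla0 X Y Z p.
Proof.
move=> vX vY vZ Mp; have k := chern_connection chern_is_chern; have k0 := nabla0_connection n0 t.
have E U W : vfield CPn U -> vfield CPn W -> chernn U (chernn W Z) p = nabla0 U (nabla0 W Z) p.
  move=> vU vW; have vN := conn_vfield k vW vZ; have vN0 := conn_vfield k0 vW vZ.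
  rewrite (CP_chernE n0 ht vU vN Mp).
  by apply: (conn_eq_on k0 vU vU vN vN0) => // q Mq; exact: (CP_chernE n0 ht vW vZ Mq).
rewrite /curvature (E X Y vX vY) (E Y X vY vX).
by rewrite (CP_chernE n0 ht (vfield_bracket n0 vX vY) vZ Mp).
Qed.

Lemma curvature_tan X Y Z p : vfield CPn X -> vfield CPn Y -> vfield CPn Z -> CPn p ->
  is_tan (tc p) (tc (curvature CPn nabla0 X Y Z p)).
Proof.
move=> vX vY vZ Mp; have k0 := nabla0_connection n0 t.
have T U W : vfield CPn U -> vfield CPn W -> is_tan (tc p) (tc (nabla0 U W p)).
  by move=> vU vW; exact: (vfield_tan n0 (conn_vfield k0 vU vW) Mp).
have B a b : is_tan (tc p) (tc a) -> is_tan (tc p) (tc b) -> is_tan (tc p) (tc (a - b)).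
  by move=> ta tb; rewrite (_ : tc (a - b) = tc a - tc b); [exact: is_tanB|exact: to_complexB].
apply: (B _ _); last exact: (T _ _ (vfield_bracket n0 vX vY) vZ).
by apply: (B _ _); apply: T => //; exact: (conn_vfield k0).
Qed.

Lemma R4E X Y Z V p e : vfield CPn X -> vfield CPn Y -> vfield CPn Z -> vfield CPn V -> CPn p ->
  dot (adj e) e = 1 -> tc p = e *m adj e ->
  let m := mform s (kap t) (quat e) in
  let xi := tc (X p) *m e in let eta := tc (Y p) *m e in
  let ze := tc (Z p) *m e in let nu := tc (V p) *m e in
  R4 CPn gn Jn X Y Z V p = 4 * n.+1%:R * complex.Re (2 * m xi eta ze nu - 2 * m eta xi ze nu).
Proof.
move=> vX vY vZ vV Mp e1 eP m xi eta ze nu.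
have tX := vfield_tan n0 vX Mp; have tY := vfield_tan n0 vY Mp.
have tZ := vfield_tan n0 vZ Mp; have tV := vfield_tan n0 vV Mp.
have [PP QQ PQ QP aP] := tau_facts n0 Mp.
rewrite /R4 (curvature_chern vX vY vZ Mp).
rewrite (metric_tcE n0 t Mp (nabla0_curvature n0 t vX vY vZ Mp) (erefl _) _ tV); last first.
  by rewrite -(nabla0_curvature n0 t vX vY vZ Mp); exact: curvature_tan.
congr (_ * complex.Re _).
have := curv_compress (kap t) PP QQ PQ QP tX.2 tY.2 tZ.2 (odd_tau tX.2) (odd_tau tY.2).
rewrite /= -!GamE => cc.
apply: (etrans (hform_compress s PP tV.2 PQ QP cc)).
rewrite eP in tX tY tZ tV *.
exact: (hform_curvature e1 (kap_eq ht)).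
Qed.

End CPCurvature.

(** * Curvature on vectors of type (1,0) *)

Section Polarisation.
Variable (R : realType).
Local Notation C := R[i].

Lemma expr_i2 : ('i%C : C) * 'i%C = -1.
Proof. by rewrite -expr2 sqr_i. Qed.

(** Complexified curvature is a sum over 16 choices of real or imaginary parts. The
    coefficient [p] is multiplied by the same power of [i] as the polarisation, so its
    conjugate survives, while [q] and its conjugate are averaged to zero. *)
Lemma sum_i_powers (r : R) (p q : C) :
  \sum_(a : bool) \sum_(b : bool) \sum_(c : bool) \sum_(d : bool)
    'i%C ^+ (a + b + c + d) *
    (r * complex.Re ('i%C ^+ a * 'i%C ^+ b * 'i%C ^+ c * 'i%C ^+ d * p -
                     (- 'i%C) ^+ a * (- 'i%C) ^+ b * 'i%C ^+ c * 'i%C ^+ d * q))%:C%C =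
  (r * 8)%:C%C * p^*.
Proof.
case: p => p1 p2; case: q => q1 q2; rewrite !big_bool /=.
rewrite !addn0 !add0n !addn1 !expr0 !exprS !expr0 !mul1r !mulr1.
apply/eqP; rewrite eq_complex; apply/andP; split; apply/eqP => /=; ring.
Qed.

End Polarisation.

Section T10Curvature.
Variables (R : realType) (n : nat) (n0 : (0 < n)%N) (t : R) (ht : 0 < t).
Local Notation C := R[i].
Local Notation A := (ambient R n).
Local Notation Mat := 'M[C]_(n + n).
Local Notation cV := 'M[C]_(n + n, 1).
Local Notation tc := (@to_complex R n).
Local Notation CPn := (@CP R n).
Local Notation Jn := (@CP_J R n).
Local Notation gn := (@CP_metric R n t).
Local Notation s := ((t - 2)%:C%C : C).
Implicit Types (X Y Z V : A -> A) (p : A) (e : cV).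

Lemma quatZ (c : C) (v : cV) : quat (c *: v) = c^* *: quat v.
Proof. by rewrite !quatE adjZ linearZ /= scalemxAr. Qed.

Lemma dotZl (c : C) (a : 'M[C]_(1, n + n)) (u : cV) : dot (c *: a) u = c * dot a u.
Proof. by rewrite /dot -scalemxAl mxE. Qed.

Lemma mformZ (s0 k : C) (f xi eta ze nu : cV) (c1 c2 c3 c4 : C) :
  mform s0 k f (c1 *: xi) (c2 *: eta) (c3 *: ze) (c4 *: nu) =
  c1 * c2^* * c3 * c4^* * mform s0 k f xi eta ze nu.
Proof.
rewrite /mform !quatZ !adjZ !conjCK !dotZr !dotZl.
move: (dot _ xi) (dot (adj eta) ze) (dot (adj nu) ze) (dot (adj eta) xi) (dot _ f) (dot _ ze) (dot _ ze) (dot _ (quat eta)).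
by move: c2^* c4^* => d2 d4 *; ring.
Qed.

Lemma vfieldN X : vfield CPn X -> vfield CPn (fun q => - X q).
Proof.
move=> vX; rewrite (_ : (fun q => - X q) = fscale (fun=> -1) X).
  by apply: (vfieldZ n0) => //; exists (fun=> -1); split=> //; exact: smooth_cst.
by apply/funext => q; rewrite /fscale scaleN1r.
Qed.

Section AtPoint.
Variables (p : A) (Mp : CPn p) (e : cV) (e1 : dot (adj e) e = 1) (eP : tc p = e *m adj e).

Lemma J_mx_vec S : is_tan (tc p) S -> J_mx (tc p) S *m e = - 'i%C *: (S *m e).
Proof.
rewrite eP => tS; have h := tan_vec e1 tS.
have Pe : e *m adj e *m e = e by rewrite rank1_mul e1 scale1r.
by rewrite J_mxE -scalemxAl mulmxBl -!mulmxA -/(_ *m _) [e *m (adj e *m (S *m e))]mulmxA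
  rank1_mul h scale0r [e *m (adj e *m e)]mulmxA Pe sub0r scalerN scaleNr.
Qed.

Lemma T10_vec (u : cfield A) : T10_field CPn Jn u -> tc (u.2 p) *m e = 'i%C *: (tc (u.1 p) *m e).
Proof.
move=> [v1 v2 /(_ p Mp)[_ _ Ju _]]; have t1 := vfield_tan n0 v1 Mp.
have -> : tc (u.2 p) = - J_mx (tc p) (tc (u.1 p)).
  by rewrite -(JE n0 Mp t1) [Jn _ _]Ju to_complexN opprK.
by rewrite mulNmx J_mx_vec // scaleNr opprK.
Qed.

Lemma cpart_vec (u : cfield A) (b : bool) : T10_field CPn Jn u ->
  vfield CPn (cpart u b) /\ tc (cpart u b p) *m e = 'i%C ^+ b *: (tc (u.1 p) *m e).
Proof.
move=> Tu; case: b => /=; last by case: Tu => v1 _ _; rewrite scale1r.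
by split; [case: Tu|rewrite (T10_vec Tu)].
Qed.

Lemma cpart_conj_vec (u : cfield A) (b : bool) : T10_field CPn Jn u ->
  vfield CPn (cpart (cconj u) b) /\
  tc (cpart (cconj u) b p) *m e = (- 'i%C) ^+ b *: (tc (u.1 p) *m e).
Proof.
move=> Tu; case: b => /=; last by case: Tu => v1 _ _; rewrite scale1r.
split; first by case: Tu => _ v2 _; exact: vfieldN.
by rewrite to_complexN mulNmx (T10_vec Tu) scaleNr.
Qed.

Lemma R4c_mform (x y z w : cfield A) : T10_field CPn Jn x -> T10_field CPn Jn y ->
  T10_field CPn Jn z -> T10_field CPn Jn w ->
  R4c CPn gn Jn x (cconj y) z (cconj w) p = (64 * n.+1%:R)%:C%C *
  (mform s (kap t) (quat e) (tc (x.1 p) *m e) (tc (y.1 p) *m e) (tc (z.1 p) *m e) (tc (w.1 p) *m e))^*.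
Proof.
move=> Tx Ty Tz Tw; rewrite /R4c.
set m := mform _ _ _ _ _ _ _.
set m' := mform s (kap t) (quat e) (tc (y.1 p) *m e) (tc (x.1 p) *m e) (tc (z.1 p) *m e) (tc (w.1 p) *m e).
have key (a b c d : bool) :
    R4 CPn gn Jn (cpart x a) (cpart (cconj y) b) (cpart z c) (cpart (cconj w) d) p =
    4 * n.+1%:R * complex.Re ('i%C ^+ a * 'i%C ^+ b * 'i%C ^+ c * 'i%C ^+ d * (2 * m) -
       (- 'i%C) ^+ a * (- 'i%C) ^+ b * 'i%C ^+ c * 'i%C ^+ d * (2 * m')).
  have [vx ex] := cpart_vec a Tx; have [vy ey] := cpart_conj_vec b Ty.
  have [vz ez] := cpart_vec c Tz; have [vw ew] := cpart_conj_vec d Tw.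
  rewrite (R4E n0 ht vx vy vz vw Mp e1 eP) ex ey ez ew !mformZ -/m -/m'.
  have cN (j : bool) : ((- 'i%C : C) ^+ j)^* = 'i%C ^+ j by rewrite rmorphXn rmorphN /= conj_i opprK.
  have ci (j : bool) : (('i%C : C) ^+ j)^* = (- 'i%C) ^+ j by rewrite rmorphXn /= conj_i.
  rewrite !cN ci; congr (_ * complex.Re (_ - _)); first by rewrite mulrCA.
  by rewrite [RHS]mulrCA [(- 'i%C) ^+ b * _]mulrC.
under eq_bigr => a _ do under eq_bigr => b _ do under eq_bigr => c _ do under eq_bigr => d _ do rewrite key.
apply: (etrans (sum_i_powers _ _ _)).
have -> : (2 * m)^* = 2%:R%:C%C * m^* :> C by rewrite rmorphM rmorph_nat /= (rmorph_nat (real_complex R)).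
by rewrite mulrA -rmorphM; congr (_%:C%C * _); ring.
Qed.

End AtPoint.
End T10Curvature.

(** * The curvature form and its positivity *)

Section PairPositivity.
Variable (F : numClosedFieldType).
Implicit Types (y z k : F).

Definition pair_form k y z := y * y^* + z * z^* - k * (y * z^*) - k * (z * y^*).

(** Diagonalises the quadratic form in [y] and [z]; the eigenvalues are [1 + k] and
    [1 - k]. *)
Lemma pair_formE k y z :
  2 * pair_form k y z = (1 + k) * ((y - z) * (y - z)^*) + (1 - k) * ((y + z) * (y + z)^*).
Proof. by rewrite /pair_form rmorphB rmorphD; ring. Qed.

Lemma pair_form_ge0 k y z : 0 <= 1 + k -> 0 <= 1 - k -> 0 <= pair_form k y z.
Proof.
move=> k1 k2; rewrite -(pmulr_rge0 _ (ltr0n F 2)) pair_formE.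
by rewrite addr_ge0 // mulr_ge0 // mul_conjC_ge0.
Qed.

Lemma pair_form_gt0 k y z : 0 < 1 + k -> 0 < 1 - k -> y != 0 -> 0 < pair_form k y z.
Proof.
move=> k1 k2 y0; rewrite -(pmulr_rgt0 _ (ltr0n F 2)) pair_formE.
have h1 : 0 <= (1 + k) * ((y - z) * (y - z)^*) by rewrite mulr_ge0 ?(ltW k1) // mul_conjC_ge0.
have h2 : 0 <= (1 - k) * ((y + z) * (y + z)^*) by rewrite mulr_ge0 ?(ltW k2) // mul_conjC_ge0.
rewrite lt_def addr_ge0 // andbT paddr_eq0 // !mulf_eq0 (gt_eqF k1) (gt_eqF k2) !conjC_eq0 /= !orbb.
rewrite subr_eq0 addr_eq0; apply: contra y0 => /andP[/eqP -> /eqP zN].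
by rewrite -[_ == 0](mulrn_eq0 _ 2) mulr2n {1}zN addNr.
Qed.

Lemma conj_terms (x y z w p q u v s k : F) :
  (x^* * y^* + z^* * w^* + s * (p^* * q^* * w^*) - k * (u^* * v^*^*))^* =
  x * y + z * w + s^* * (p * q * w) - k^* * (u * v^*).
Proof. by rewrite rmorphB !rmorphD !rmorphM /= !conjCK. Qed.
End PairPositivity.

Section CurvatureForm.
Variables (R : realType) (n : nat) (n0 : (0 < n)%N).
Local Notation C := R[i].
Local Notation Mat := 'M[C]_(n + n).
Local Notation cV := 'M[C]_(n + n, 1).
Local Notation Om := (Omega R n).
Local Notation i0 := (i0 n0).
Local Notation iN := (iN n0).
Implicit Types (U W : Mat) (a b c d u v : cV).

Definition cj m k (X : 'M[C]_(m, k)) := (adj X)^T.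

Lemma cjE m k (X : 'M[C]_(m, k)) i j : cj X i j = (X i j)^*.
Proof. by rewrite !mxE. Qed.

Lemma cjK m k (X : 'M[C]_(m, k)) : cj (cj X) = X.
Proof. by apply/matrixP => i j; rewrite !cjE conjCK. Qed.

Lemma cjM m k l (X : 'M[C]_(m, k)) (Y : 'M[C]_(k, l)) : cj (X *m Y) = cj X *m cj Y.
Proof. by rewrite /cj adjM trmx_mul. Qed.

Lemma adj_cj m k (X : 'M[C]_(m, k)) : adj (cj X) = X^T.
Proof. by apply/matrixP => i j; rewrite !mxE conjCK. Qed.

Lemma quat_cj v : quat v = Om *m cj v. Proof. exact: quatE. Qed.

Lemma cjOm : cj Om = Om.
Proof. by rewrite /cj adjOmega linearN /= trOmega opprK. Qed.

Lemma dot_cj u v : dot (adj (cj u)) (cj v) = (dot (adj u) v)^*.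
Proof.
have e : adj (cj u) = cj (adj u) by rewrite adj_cj /cj adjK.
by rewrite /dot e -cjM cjE.
Qed.

Lemma quat_cjC v : quat (cj v) = cj (quat v).
Proof. by rewrite !quat_cj cjM cjOm cjK. Qed.

Variables (s k : C).
(** The curvature as a sesquilinear form on tensors: if [a], [b], [c], [d] are the
    coordinates of (1,0)-vectors, the value at [a d^*] and [b c^*] is, up to a positive
    constant, the curvature of [a], the conjugate of [b], [c] and the conjugate of [d]. *)
Definition curv_form U W := \tr U * (\tr W)^* + \tr (adj W *m U) + s * (adj W *m U) iN iN -
  k * \tr (Om *m U *m cj (Om *m W)).

Lemma rank1_entry (v : cV) (b : 'M[C]_(1, n + n)) i j : (v *m b) i j = v i 0 * b 0 j.
Proof. by rewrite mxE big_ord1. Qed.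

Lemma curv_form_rank1 a b c d : curv_form (a *m adj d) (b *m adj c) =
  dot (adj d) a * dot (adj b) c + dot (adj d) c * dot (adj b) a +
  s * (c iN 0 * (d iN 0)^* * dot (adj b) a) -
  k * (dot (adj (quat a)) c * (dot (adj (quat b)) d)^*).
Proof.
rewrite /curv_form adjM adjK !tr_rank1 -dotC.
have -> : c *m adj b *m (a *m adj d) = dot (adj b) a *: (c *m adj d).
  by rewrite mulmxA rank1_mul -scalemxAl.
rewrite mxtraceZ tr_rank1 mxE rank1_entry [adj d 0 iN]mxE [d^T _ _]mxE.
have -> : Om *m (a *m adj d) *m cj (Om *m (b *m adj c)) =
    dot (adj d) (quat b) *: (Om *m a *m c^T).
  rewrite !mulmxA cjM -[cj (Om *m b)]/(cj (Om *m b)) cjM cjOm -quat_cj.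
  by rewrite mulmxA rank1_mul -scalemxAl /cj adjK.
rewrite mxtraceZ tr_rank1 (dotC d (quat b)).
have -> : dot c^T (Om *m a) = dot (adj (quat a)) c.
  by rewrite adj_quat [RHS]dotNl [LHS]dot_tr trmxK trmx_mul trOmega mulmxN dotNl.
rewrite [dot (adj b) a * dot (adj d) c]mulrC [dot (adj b) a * (_ * _)]mulrC.
by congr (_ - _ * _); rewrite mulrC.
Qed.

Lemma mform_cj (f a b c d : cV) :
  (mform s k f (cj a) (cj b) (cj c) (cj d))^* =
  dot (adj d) a * dot (adj b) c + dot (adj d) c * dot (adj b) a +
  s^* * (dot (adj d) (cj f) * dot (adj (cj f)) c * dot (adj b) a) -
  k^* * (dot (adj (quat a)) c * (dot (adj (quat b)) d)^*).
Proof.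
rewrite /mform !quat_cjC !dot_cj (dotC (cj d) f) (dotC f (cj c)).
have e (u : cV) : dot (adj f) (cj u) = (dot (adj (cj f)) u)^* by rewrite -{1}[f]cjK dot_cj.
have e' (u : cV) : dot (adj (cj u)) f = (dot (adj u) (cj f))^* by rewrite -{1}[f]cjK dot_cj.
rewrite -(dotC f (cj c)) -(dotC (cj d) f) e e' (dotC d (quat b)).
exact: conj_terms.
Qed.

Definition eps : cV := delta_mx i0 0.

Lemma epsE l j : eps l j = (l == i0)%:R.
Proof. by rewrite mxE ord1 andbT. Qed.

Lemma quat_eps v : dot (adj (quat eps)) v = - v iN 0.
Proof.
rewrite dot_quatC adj_quat dotNl opprK /dot mxE (bigD1 i0) //= big1 ?addr0; last first.
  by move=> l li; rewrite epsE (negPf li) mulr0.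
rewrite epsE eqxx mulr1 mxE (bigD1 iN) //= big1 ?addr0; last first.
  move=> l lN; rewrite Omega_entry; have -> : (i0 == bar l) = false.
    by rewrite eq_sym bar_i0 (negPf lN).
  by rewrite mulr0.
by rewrite Omega_entry eq_sym bar_i0 eqxx mxE sgn_rshift mulrN1.
Qed.

Lemma cj_quat_eps : cj (quat eps) = quat eps.
Proof.
by rewrite -quat_cjC; congr quat; apply/matrixP => i j; rewrite cjE epsE conjC_nat.
Qed.

Lemma mform_curv_form (a b c d : cV) : s^* = s -> k^* = k ->
  (mform s k (quat eps) (cj a) (cj b) (cj c) (cj d))^* = curv_form (a *m adj d) (b *m adj c).
Proof.
move=> rs rk; rewrite mform_cj curv_form_rank1 rs rk cj_quat_eps (dotC d (quat eps)) !quat_eps.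
by rewrite rmorphN mulrNN [_^* * _]mulrC.
Qed.

Lemma mform_unitary (m : Mat) (e a b c d : cV) : adj m *m m = 1%:M -> m *m adj m = 1%:M ->
  tau m = adj m ->
  mform s k (quat (m *m e)) (m *m a) (m *m b) (m *m c) (m *m d) = mform s k (quat e) a b c d.
Proof.
move=> um mu tm.
have dm u v : dot (adj (m *m u)) (m *m v) = dot (adj u) v.
  by rewrite /dot adjM mulmxA -[adj u *m _ *m m]mulmxA um mulmx1.
have qm v : quat (m *m v) = m *m quat v.
  rewrite !quat_cj cjM !mulmxA; congr (_ *m _).
  have : tau (adj m) = m by rewrite tau_adj tm adjK.
  rewrite tauE => /(congr1 (fun S => S *m Om)).
  by rewrite mulNmx -!mulmxA Omega2 !mulmxN mulmx1 opprK.
by rewrite /mform !qm !dm.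
Qed.

Lemma curv_formDl U U' W : curv_form (U + U') W = curv_form U W + curv_form U' W.
Proof.
rewrite /curv_form !mulmxDr !mulmxDl !mxtraceD mxE.
move: (\tr U) (\tr U') (\tr W)^* (\tr _) (\tr _) (_ iN iN) (_ iN iN) (\tr _) (\tr _) => *; ring.
Qed.

Lemma curv_formZl x U W : curv_form (x *: U) W = x * curv_form U W.
Proof.
rewrite /curv_form -!scalemxAr -!scalemxAl !mxtraceZ mxE.
move: (\tr U) (\tr W)^* (\tr _) (_ iN iN) (\tr _) => *; ring.
Qed.

Lemma curv_formDr U W W' : curv_form U (W + W') = curv_form U W + curv_form U W'.
Proof.
rewrite /curv_form adjD !mulmxDr /cj adjD linearD /= !mulmxDl ?mulmxDr !mxtraceD mxE rmorphD /=.
move: (\tr U) (\tr W)^* (\tr W')^* (\tr _) (\tr _) (_ iN iN) (_ iN iN) (\tr _) (\tr _) => *; ring.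
Qed.

Lemma curv_formZr y U W : curv_form U (y *: W) = y^* * curv_form U W.
Proof.
rewrite /curv_form adjZ -!scalemxAr /cj adjZ [(_ *: _)^T]linearZ /= -!scalemxAl -?scalemxAr !mxtraceZ mxE rmorphM /=.
move: y^* (\tr U) (\tr W)^* (\tr _) (_ iN iN) (\tr _) => *; ring.
Qed.

Lemma curv_form_sum (I J : finType) (x : I -> C) (U : I -> Mat) (y : J -> C) (W : J -> Mat) :
  curv_form (\sum_i x i *: U i) (\sum_j y j *: W j) =
  \sum_i \sum_j x i * (y j)^* * curv_form (U i) (W j).
Proof.
have B0l V : curv_form 0 V = 0 by rewrite -(scale0r 0) curv_formZl mul0r.
have B0r V : curv_form V 0 = 0 by rewrite -(scale0r 0) curv_formZr conjC0 mul0r.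
transitivity (\sum_i x i * curv_form (U i) (\sum_j y j *: W j)).
  apply: (big_ind2 (fun V z => curv_form V (\sum_j y j *: W j) = z)) => //.
    by move=> V1 z1 V2 z2 <- <-; exact: curv_formDl.
  by move=> i _; exact: curv_formZl.
apply: eq_bigr => i _.
transitivity (x i * \sum_j (y j)^* * curv_form (U i) (W j)); last first.
  by rewrite mulr_sumr; apply: eq_bigr => j _; rewrite mulrA.
congr (_ * _); apply: (big_ind2 (fun V z => curv_form (U i) V = z)) => //.
  by move=> V1 z1 V2 z2 <- <-; exact: curv_formDr.
by move=> j _; exact: curv_formZr.
Qed.

End CurvatureForm.

Section CurvatureFormPositivity.
Variables (R : realType) (n : nat) (n0 : (0 < n)%N) (s k : R[i]).
Local Notation C := R[i].
Local Notation Mat := 'M[C]_(n + n).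
Local Notation Om := (Omega R n).
Local Notation i0 := (i0 n0).
Local Notation iN := (iN n0).
Local Notation curv_form := (curv_form n0 s k).
Implicit Types (U Y : Mat) (b c d : 'I_(n + n)).

(** The contribution of one entry of [Y = Omega U] to the form. *)
Definition Gterm Y c d :=
  Y c d * (Y c d)^* * (1 + s *+ (d == iN)) - k * (Y c d * (Y d c)^*).

Lemma curv_form_self U :
  curv_form U U = \tr U * (\tr U)^* + \sum_c \sum_d Gterm (Om *m U) c d.
Proof.
rewrite /curv_form -!addrA; congr (_ + _).
have -> : adj U *m U = adj (Om *m U) *m (Om *m U).
  by rewrite adjM adjOmega mulmxN mulNmx mulmxA -[adj U *m _ *m _]mulmxA Omega2 mulmxN mulmx1 mulNmx opprK.
set Y := Om *m U.
have -> : \tr (adj Y *m Y) = \sum_c \sum_d Y c d * (Y c d)^*.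
  rewrite exchange_big; apply: eq_bigr => d _; rewrite mxE; apply: eq_bigr => c _.
  by rewrite !mxE mulrC.
have -> : (adj Y *m Y) iN iN = \sum_c \sum_d Y c d * (Y c d)^* *+ (d == iN).
  rewrite mxE; apply: eq_bigr => c _; rewrite (bigD1 iN) //= big1 ?addr0.
    by rewrite eqxx mulr1n !mxE mulrC.
  by move=> d /negPf ->.
have -> : \tr (Y *m cj Y) = \sum_c \sum_d Y c d * (Y d c)^*.
  by apply: eq_bigr => c _; rewrite mxE; apply: eq_bigr => d _; rewrite cjE.
rewrite !mulr_sumr -sumrN -!big_split /=; apply: eq_bigr => c _.
rewrite !mulr_sumr -sumrN -!big_split /=; apply: eq_bigr => d _.
by rewrite /Gterm mulrDr mulr1 -[s *+ _]mulr_natr -[_ *+ (d == iN)]mulr_natr addrA; congr (_ + _ - _); ring.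
Qed.

(** Symmetrising makes the term in [k] a Hermitian form in each pair of transposed
    entries. *)
Lemma sum_Gterm Y : (\sum_c \sum_d Gterm Y c d) * 2 = \sum_c \sum_d (Gterm Y c d + Gterm Y d c).
Proof.
rewrite mulr_natr mulr2n {2}exchange_big -big_split /=; apply: eq_bigr => c _.
by rewrite -big_split.
Qed.

Section Positivity.
Variables (Y : Mat) (YN : forall d, Y iN d = 0).

Lemma Gterm_pair c d : c != iN -> d != iN -> Gterm Y c d + Gterm Y d c = pair_form k (Y c d) (Y d c).
Proof. by move=> /negPf cN /negPf dN; rewrite /Gterm cN dN !mulr0n !addr0 !mulr1 /pair_form; ring. Qed.

(** Opposite the zero row of [Y] the form only sees the coefficient [1 + s], not [k]. *)
Lemma Gterm_last d : Gterm Y iN d + Gterm Y d iN = Y d iN * (Y d iN)^* * (1 + s).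
Proof. by rewrite /Gterm eqxx mulr1n YN conjC0 !(mul0r, mulr0) subr0 add0r subr0. Qed.

Lemma Gterm_pair_ge0 c d : 0 <= 1 + s -> 0 <= 1 + k -> 0 <= 1 - k ->
  0 <= Gterm Y c d + Gterm Y d c.
Proof.
move=> s1 k1 k2; have [->|cN] := eqVneq c iN.
  by rewrite Gterm_last mulr_ge0 // mul_conjC_ge0.
have [->|dN] := eqVneq d iN.
  by rewrite addrC Gterm_last mulr_ge0 // mul_conjC_ge0.
by rewrite Gterm_pair // pair_form_ge0.
Qed.

Lemma Gterm_pair_gt0 c d : 0 < 1 + s -> 0 < 1 + k -> 0 < 1 - k -> Y c d != 0 ->
  0 < Gterm Y c d + Gterm Y d c.
Proof.
move=> s1 k1 k2 Ycd; have [cE|cN] := eqVneq c iN.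
  by rewrite cE YN eqxx in Ycd.
have [dE|dN] := eqVneq d iN.
  by rewrite dE in Ycd *; rewrite addrC Gterm_last mulr_gt0 // mul_conjC_gt0.
by rewrite Gterm_pair // pair_form_gt0.
Qed.
End Positivity.

Lemma Omega_row_iN U d : (forall b, U i0 b = 0) -> (Om *m U) iN d = 0.
Proof.
move=> U0; rewrite mxE big1 // => c _; rewrite Omega_entry.
have [->|cb] := eqVneq c (bar iN); last by rewrite mul0r.
by have /eqP -> : bar iN == i0; rewrite ?bar_i0 // U0 mulr0.
Qed.

Lemma curv_form_ge0 U : (forall b, U i0 b = 0) -> 0 <= 1 + s -> 0 <= 1 + k -> 0 <= 1 - k ->
  0 <= curv_form U U.
Proof.
move=> U0 s1 k1 k2; have YN d := Omega_row_iN d U0.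
rewrite curv_form_self addr_ge0 ?mul_conjC_ge0 // -(pmulr_lge0 _ (ltr0n C 2)) sum_Gterm.
by apply: sumr_ge0 => c _; apply: sumr_ge0 => d _; exact: Gterm_pair_ge0.
Qed.

Lemma curv_form_gt0 U : (forall b, U i0 b = 0) -> U != 0 -> 0 < 1 + s -> 0 < 1 + k -> 0 < 1 - k ->
  0 < curv_form U U.
Proof.
move=> U0 Un0 s1 k1 k2; have YN d := Omega_row_iN d U0.
have Yn0 : Om *m U != 0.
  apply: contra Un0 => /eqP Y0; rewrite -[U]mul1mx -[1%:M]opprK -Omega2 mulNmx -mulmxA Y0.
  by rewrite mulmx0 oppr0.
have [c [d Ycd]] : exists c d, (Om *m U) c d != 0.
  case: (pickP (fun cd : 'I_(n + n) * 'I_(n + n) => (Om *m U) cd.1 cd.2 != 0)) => [[c d] h|h].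
    by exists c, d.
  case/eqP: Yn0; apply/matrixP => c d; rewrite [RHS]mxE; apply/eqP.
  by have := h (c, d) => /= /negbFE.
rewrite curv_form_self ltr_wpDl ?mul_conjC_ge0 // -(pmulr_lgt0 _ (ltr0n C 2)) sum_Gterm.
have G0 c' d' : 0 <= Gterm (Om *m U) c' d' + Gterm (Om *m U) d' c'.
  by apply: Gterm_pair_ge0 => //; exact: ltW.
rewrite (bigD1 c) //= ltr_wpDr ?sumr_ge0 // => [c' _|]; first by rewrite sumr_ge0.
rewrite (bigD1 d) //= ltr_wpDr ?sumr_ge0 //.
exact: Gterm_pair_gt0.
Qed.

End CurvatureFormPositivity.

(** * Coordinates on vectors of type (1,0) *)

Section CrossTerms.
Variables (K : comNzRingType) (N : nat).
Implicit Types (P S : 'M[K]_N).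

Lemma odd_cross P S : P *m P = P -> odd P S ->
  (1%:M - P) *m S *m P + P *m S *m (1%:M - P) = S.
Proof.
move=> PP oS; have PSP := odd_PXP PP oS.
rewrite !mulmxBl mulmxBr mul1mx mulmx1 PSP !subr0 addrC; exact: oS.
Qed.

Lemma cross_odd P S : P *m P = P -> odd P ((1%:M - P) *m S *m P + P *m S *m (1%:M - P)).
Proof.
move=> PP; have P1 : P *m (1%:M - P) = 0 by rewrite mulmxBr mulmx1 PP subrr.
have P2 : (1%:M - P) *m P = 0 by rewrite mulmxBl mul1mx PP subrr.
move: (1%:M - P) P1 P2 => T P1 P2; rewrite /odd mulmxDr mulmxDl !mulmxA P1 !mul0mx add0r PP.
by rewrite -[T *m S *m P *m P]mulmxA PP -[P *m S *m T *m P]mulmxA P2 mulmx0 addr0 addrC.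
Qed.
End CrossTerms.

Section Frames.
Variables (R : realType) (n : nat) (n0 : (0 < n)%N).
Local Notation C := R[i].
Local Notation A := (ambient R n).
Local Notation Mat := 'M[C]_(n + n).
Local Notation cV := 'M[C]_(n + n, 1).
Local Notation tc := (@to_complex R n).
Local Notation CPn := (@CP R n).
Local Notation Jn := (@CP_J R n).
Local Notation i0 := (i0 n0).
Local Notation iN := (iN n0).
Local Notation eps := (@eps R n n0).
Local Notation scale := (@Defs.cscale R A).
Implicit Types (X Y Z V : A -> A) (p q x y : A) (S : Mat).

Lemma E0_eps : E0 R n0 = eps *m adj eps.
Proof.
by apply/matrixP => i j; rewrite rank1_entry epsE !mxE conjC_nat -mulnb natrM eqxx andbT.
Qed.

Lemma eps_unit : dot (adj eps) eps = 1.
Proof.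
rewrite /dot mxE (bigD1 i0) //= big1 ?addr0 => [|l li].
  by rewrite !mxE !eqxx conjC1 mulr1.
by rewrite [eps l 0]epsE (negPf li) mulr0.
Qed.

Lemma is_tanD S T P : is_tan P S -> is_tan P T -> is_tan P (S + T).
Proof.
move=> [aS oS] [aT oT]; split; first by rewrite adjD aS aT.
by rewrite mulmxDr mulmxDl addrACA oS oT.
Qed.

Lemma is_tanZ (r : R) S P : is_tan P S -> is_tan P (r%:C%C *: S).
Proof.
move=> [aS oS]; split; first by rewrite adjZ conjRC aS.
by rewrite -scalemxAl -scalemxAr -scalerDr oS.
Qed.

Lemma is_tan_rank2 (e xi : cV) : dot (adj e) e = 1 -> dot (adj e) xi = 0 ->
  is_tan (e *m adj e) (rank2 xi (adj e) e (adj xi)).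
Proof.
move=> e1 e_xi; have xi_e : dot (adj xi) e = 0 by rewrite dotC e_xi conjC0.
split; first by rewrite /rank2 adjD !adjM !adjK addrC.
rewrite /rank2 mulmxDr mulmxDl !mulmxA !rank1_mul e_xi e1 xi_e !scale0r !scale1r !mul0mx.
by rewrite add0r addr0 addrC.
Qed.

Section AtPoint.
Variables (p : A) (Mp : CPn p) (m : Mat).
Hypotheses (um : adj m *m m = 1%:M) (mu : m *m adj m = 1%:M).
Hypotheses (pm : tc p = m *m E0 R n0 *m adj m).
Local Notation P := (tc p).
Local Notation e := (m *m eps).

Lemma frame_unit : dot (adj e) e = 1.
Proof. by rewrite /dot adjM mulmxA -[adj eps *m _ *m m]mulmxA um mulmx1 -/(dot _ _) eps_unit. Qed.

Lemma frame_proj : P = e *m adj e.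
Proof. by rewrite pm E0_eps adjM !mulmxA. Qed.

(** The conjugates of the components of [x e] in the frame [m]: the (1,0)-vector with
    real part [x] depends complex linearly on them. *)
Definition alpha := locked_with gam_key (fun x : A => cj (adj m *m (tc x *m e))).
Lemma alphaE0 x : alpha x = cj (adj m *m (tc x *m e)).
Proof. by rewrite /alpha unlock. Qed.

Lemma alphaE x : tc x *m e = m *m cj (alpha x).
Proof. by rewrite alphaE0 cjK; apply: esym; rewrite mulmxA mu mul1mx. Qed.

Lemma alpha_eq x a : tc x *m e = m *m cj a -> alpha x = a.
Proof. by move=> h; rewrite alphaE0 h mulmxA um mul1mx cjK. Qed.

Lemma cjD k l (B D : 'M[C]_(k, l)) : cj (B + D) = cj B + cj D.
Proof. by rewrite /cj adjD [LHS]linearD. Qed.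

Lemma cjZ k l c (B : 'M[C]_(k, l)) : cj (c *: B) = c^* *: cj B.
Proof. by rewrite /cj adjZ [LHS]linearZ. Qed.

Lemma alphaD x y : alpha (x + y) = alpha x + alpha y.
Proof.
apply: alpha_eq; apply: (etrans (congr1 (fun S => S *m e) (to_complexD x y))).
by rewrite mulmxDl !alphaE -mulmxDr cjD.
Qed.

Lemma alpha_scale x y c : tc y *m e = c *: (tc x *m e) -> alpha y = c^* *: alpha x.
Proof. by move=> h; apply: alpha_eq; rewrite h alphaE cjZ conjCK scalemxAr. Qed.

Lemma alphaZ (r : R) x : alpha (r *: x) = r%:C%C *: alpha x.
Proof.
rewrite -[r%:C%C in RHS]conjRC; apply: alpha_scale.
by apply: (etrans (congr1 (fun S => S *m e) (to_complexZ r x))); rewrite scalemxAl.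
Qed.

Lemma alphaN x : alpha (- x) = - alpha x.
Proof. by rewrite -[- x]scaleN1r alphaZ rmorphN1 scaleN1r. Qed.

Lemma alpha_i0 x : is_tan P (tc x) -> alpha x i0 0 = 0.
Proof.
rewrite frame_proj => tx; have := tan_vec frame_unit tx.
rewrite alphaE /dot adjM mulmxA -[adj eps *m _ *m m]mulmxA um mulmx1 mxE (bigD1 i0) //= big1 ?addr0.
  by rewrite !mxE !eqxx conjC1 mul1r => /eqP; rewrite conjC_eq0 => /eqP.
by move=> l li; rewrite mxE [eps^T _ _]mxE epsE (negPf li) conjC0 mul0r.
Qed.

Lemma alpha_inj x y : is_tan P (tc x) -> is_tan P (tc y) -> alpha x = alpha y -> x = y.
Proof.
rewrite frame_proj => tx ty exy; apply: (can_inj (@to_complexK R n)).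
by rewrite (tan_rank2 tx) (tan_rank2 ty) !alphaE exy.
Qed.

Lemma alpha_J x : is_tan P (tc x) ->
  is_tan P (tc (Jn p x)) /\ alpha (Jn p x) = 'i%C *: alpha x.
Proof.
move=> tx; have [PP _ _ _ aP] := tau_facts n0 Mp; have Jx := JE n0 Mp tx; split.
  by rewrite Jx; exact: (is_tan_J PP aP tx).
have -> : 'i%C = (- 'i%C : C)^* by rewrite rmorphN /= conj_i opprK.
apply: alpha_scale; apply: (etrans (congr1 (fun S => S *m e) Jx)).
exact: (J_mx_vec frame_unit frame_proj tx).
Qed.

Definition T10_coord (w : A * A) :=
  [/\ is_tan P (tc w.1), is_tan P (tc w.2) & alpha w.2 = - 'i%C *: alpha w.1].

Lemma is_tanN x : is_tan P (tc x) -> is_tan P (tc (- x)).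
Proof.
move=> /(is_tanZ (-1)); rewrite rmorphN1 scaleN1r => h.
by rewrite (_ : tc (- x) = - tc x); [|exact: to_complexN].
Qed.

Lemma T10_coordP (w : A * A) : T10 CPn Jn p w <-> T10_coord w.
Proof.
split=> [[/(tangentP n0 _ Mp) t1 /(tangentP n0 _ Mp) t2 J1 _]|[t1 t2 a]].
  split=> //; have [_ aJ] := alpha_J t1; rewrite J1 alphaN in aJ.
  by rewrite -[LHS]opprK aJ scaleNr.
have [tJ1 aJ1] := alpha_J t1; have [tJ2 aJ2] := alpha_J t2.
split; [exact/(tangentP n0 _ Mp)|exact/(tangentP n0 _ Mp)| |].
  apply: (alpha_inj tJ1 (is_tanN t2)); apply: (etrans aJ1); apply: esym.
  by apply: (etrans (alphaN _)); rewrite a scaleNr opprK.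
by apply: (alpha_inj tJ2 t1); apply: (etrans aJ2); rewrite a scalerA mulrN expr_i2 opprK scale1r.
Qed.

Lemma T10_coordD (w w' : A * A) : T10_coord w -> T10_coord w' -> T10_coord (w + w').
Proof.
case: w w' => [x y] [x' y'] [/= t1 t2 a1] [/= t1' t2' a2]; split=> /=.
- by rewrite (_ : tc (x + x') = tc x + tc x'); [exact: is_tanD|exact: to_complexD].
- by rewrite (_ : tc (y + y') = tc y + tc y'); [exact: is_tanD|exact: to_complexD].
- by rewrite !alphaD a1 a2 scalerDr.
Qed.

Lemma is_tan_comb (r r' : R) x y : is_tan P (tc x) -> is_tan P (tc y) ->
  is_tan P (tc (r *: x + r' *: y)).
Proof.
move=> tx ty; rewrite (_ : tc (r *: x + r' *: y) = r%:C%C *: tc x + r'%:C%C *: tc y).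
  by apply: is_tanD; exact: is_tanZ.
by rewrite to_complexD !to_complexZ.
Qed.

Lemma alpha_comb (r r' : R) x y : alpha (r *: x + r' *: y) = r%:C%C *: alpha x + r'%:C%C *: alpha y.
Proof. by rewrite alphaD !alphaZ. Qed.

Lemma complex_split (c : C) : c = (complex.Re c)%:C%C + (complex.Im c)%:C%C * 'i%C.
Proof. by case: c => a b; apply/eqP; rewrite eq_complex /= !(mul0r, mulr0, mulr1, addr0, subr0, add0r) !eqxx. Qed.

Lemma T10_coordZ c (w : A * A) : T10_coord w ->
  T10_coord (scale c w) /\ alpha (scale c w).1 = c *: alpha w.1.
Proof.
case: w => [x y] [/= t1 t2 a1].
have e1 : alpha (complex.Re c *: x - complex.Im c *: y) = c *: alpha x.
  rewrite -scaleNr alpha_comb a1 scalerA -scalerDl rmorphN mulrNN; congr (_ *: _).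
  exact/esym/complex_split.
split=> //; split=> /=.
- by rewrite -scaleNr; exact: is_tan_comb.
- exact: is_tan_comb.
rewrite e1 alpha_comb a1 !scalerA -scalerDl; congr (_ *: _).
rewrite [c in RHS]complex_split mulrDr; congr (_ + _); first by rewrite mulrC.
by rewrite mulrCA mulNr expr_i2 opprK mulr1.
Qed.

Lemma T10_coord_inj (w w' : A * A) : T10_coord w -> T10_coord w' -> alpha w.1 = alpha w'.1 -> w = w'.
Proof.
case: w w' => [x y] [x' y'] [/= t1 t2 a1] [/= t1' t2' a2] ex.
have -> : x = x' by exact: alpha_inj.
by have -> : y = y' by apply: alpha_inj => //; rewrite a1 a2 ex.
Qed.

Lemma T10_coord0 : T10_coord 0 /\ alpha (0 : A) = 0.
Proof.
have z : is_tan P (tc 0).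
  by rewrite to_complex0; split; [exact: adj0|rewrite mulmx0 mul0mx addr0].
have a0 : alpha 0 = 0 by rewrite -(scale0r (0 : A)) alphaZ scale0r.
by split=> //; split=> //=; rewrite a0 scaler0.
Qed.

Lemma T10_coord_sum d (c : 'I_d -> C) (w : 'I_d -> A * A) : (forall i, T10_coord (w i)) ->
  T10_coord (\sum_i scale (c i) (w i)) /\
  alpha (\sum_i scale (c i) (w i)).1 = \sum_i c i *: alpha (w i).1.
Proof.
move=> h; apply: (big_ind2 (fun (v : A * A) a => T10_coord v /\ alpha v.1 = a)).
- exact: T10_coord0.
- by move=> v1 a1 v2 a2 [t1 <-] [t2 <-]; split; [exact: T10_coordD|rewrite alphaD].
- by move=> i _; exact: T10_coordZ.
Qed.

(** Orthogonal projection of a constant matrix to the tangent spaces. *)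
Lemma vfield_through x : is_tan P (tc x) -> exists X, vfield CPn X /\ X p = x.
Proof.
move=> [ax ox]; have [PP _ _ _ aP] := tau_facts n0 Mp.
pose X q := of_complex ((1%:M - tc q) *m tc x *m tc q + tc q *m tc x *m (1%:M - tc q)).
exists X; split; last first.
  apply: (can_inj (@to_complexK R n)); rewrite of_complexK.
  exact: (odd_cross PP ox).
have stc := @msmooth_tc R n.
have s1 : msmooth (fun q => 1%:M - tc q : Mat) by apply: msmoothB => //; exact: msmooth_cst.
have sx : msmooth (fun _ : A => tc x) by exact: msmooth_cst.
have sX : smooth X.
  apply: smooth_of_complex; apply: msmoothD; apply: msmoothM => //; exact: msmoothM.
apply: (@vfieldP R n n0 X X); first by split.
move=> q Mq; have [QQ _ _ _ aQ] := tau_facts n0 Mq; rewrite of_complexK; split.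
  by rewrite adjD !adjM adjB adj1 ax aQ !mulmxA addrC.
exact: cross_odd.
Qed.

Lemma T10_field_exists (a : cV) : a i0 0 = 0 ->
  exists u : cfield A, T10_field CPn Jn u /\ alpha (u.1 p) = a.
Proof.
move=> a0; pose xi := m *m cj a.
have e_xi : dot (adj e) xi = 0.
  rewrite /dot adjM mulmxA -[adj eps *m _ *m m]mulmxA um mulmx1 mxE (bigD1 i0) //= big1 ?addr0.
    by rewrite cjE a0 conjC0 mulr0.
  by move=> l li; rewrite mxE [eps^T _ _]mxE epsE (negPf li) conjC0 mul0r.
have xi_e : dot (adj xi) e = 0 by rewrite dotC e_xi conjC0.
pose S := rank2 xi (adj e) e (adj xi).
have Se : S *m e = xi by rewrite rank2_mul frame_unit xi_e scale1r scale0r addr0.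
have tS : is_tan P (tc (of_complex S)).
  by rewrite of_complexK frame_proj; exact: is_tan_rank2 frame_unit e_xi.
have [X [vX Xp]] := vfield_through tS.
exists (X, fun q => - Jn q (X q)); split; last first.
  by apply: alpha_eq; rewrite /= Xp of_complexK Se.
have vJ := vfield_J n0 vX.
split=> /=; [exact: vX|exact: (vfieldN n0)|move=> q Mq].
have tX := vfield_tan n0 vX Mq; have [PP _ _ _ aP] := tau_facts n0 Mq.
have JX := JE n0 Mq tX; have tJ := is_tan_J PP aP tX.
split=> /=; [exact: vX.2|exact: (vfieldN n0 vJ).2|by rewrite opprK|].
have tNJ : is_tan (tc q) (tc (- Jn q (X q))) by exact: (vfield_tan n0 (vfieldN n0 vJ) Mq).
apply: (can_inj (@to_complexK R n)); apply: (etrans (JE n0 Mq tNJ)).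
apply: (etrans (congr1 (J_mx (tc q)) (etrans (to_complexN _) (congr1 -%R JX)))).
by rewrite J_mxN (J_mx_sq PP tX.2) opprK.
Qed.

End AtPoint.
End Frames.

(** * Griffiths and dual-Nakano positivity *)

Section Positivity.
Variables (R : realType) (n : nat) (n0 : (0 < n)%N) (t : R) (ht : 0 < t).
Local Notation C := R[i].
Local Notation A := (ambient R n).
Local Notation Mat := 'M[C]_(n + n).
Local Notation cV := 'M[C]_(n + n, 1).
Local Notation tc := (@to_complex R n).
Local Notation CPn := (@CP R n).
Local Notation Jn := (@CP_J R n).
Local Notation gn := (@CP_metric R n t).
Local Notation i0 := (i0 n0).
Local Notation iN := (iN n0).
Local Notation eps := (@eps R n n0).
Local Notation s := ((t - 2)%:C%C : C).
Local Notation B := (curv_form n0 s (kap t)).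
Local Notation c0 := ((64 * n.+1%:R)%:C%C : C).
Implicit Types (p q x y : A) (u v : cfield A).

Lemma c0_gt0 : 0 < c0.
Proof. by rewrite ltcR mulr_gt0 ?ltr0n. Qed.

Lemma s_1 : 1 + s = (t - 1)%:C%C.
Proof. by rewrite -(rmorph1 (real_complex R)) -rmorphD; congr (_%:C)%C; ring. Qed.

Lemma kap_plus : 1 + kap t = (2 * (t - 1) / t)%:C%C.
Proof.
rewrite /kap -(rmorph1 (real_complex R)) -rmorphD; congr (_%:C)%C; field.
by rewrite gt_eqF.
Qed.

Lemma kap_minus : 1 - kap t = (2 / t)%:C%C.
Proof.
rewrite /kap -(rmorph1 (real_complex R)) -rmorphB; congr (_%:C)%C; field.
by rewrite gt_eqF.
Qed.

Lemma B_ge0 (U : Mat) : 1 <= t -> (forall b, U i0 b = 0) -> 0 <= B U U.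
Proof.
move=> t1 U0; apply: curv_form_ge0; rewrite ?s_1 ?kap_plus ?kap_minus ?lecR //.
- by rewrite subr_ge0.
- by rewrite divr_ge0 ?(ltW ht) // mulr_ge0 ?ler0n // subr_ge0.
- by rewrite divr_ge0 ?(ltW ht) // ler0n.
Qed.

Lemma B_gt0 (U : Mat) : 1 < t -> (forall b, U i0 b = 0) -> U != 0 -> 0 < B U U.
Proof.
move=> t1 U0 Un; apply: curv_form_gt0; rewrite ?s_1 ?kap_plus ?kap_minus ?ltcR //.
- by rewrite subr_gt0.
- by rewrite divr_gt0 // mulr_gt0 ?ltr0n // subr_gt0.
- by rewrite divr_gt0 // ltr0n.
Qed.

Definition unit_col (i : 'I_(n + n)) : cV := delta_mx i 0.

Lemma unit_colE i l j : unit_col i l j = (l == i)%:R.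
Proof. by rewrite mxE ord1 andbT. Qed.

Lemma dot_unit i j : dot (adj (unit_col i)) (unit_col j) = (i == j)%:R.
Proof.
rewrite /dot mxE (bigD1 i) //= big1 ?addr0 => [|l li].
  by rewrite !mxE !eqxx conjC1 mul1r andbT.
by rewrite [adj _ _ _]mxE [_^T _ _]mxE [unit_col i l 0]unit_colE (negPf li) conjC0 mul0r.
Qed.

(** The tensor on which positivity is lost first: all four terms of the form vanish
    except the norm and the one with coefficient [t - 2]. *)
Lemma B_unit i : i != iN -> i != i0 ->
  let U := unit_col i *m adj (unit_col iN) in B U U = (t - 1)%:C%C.
Proof.
move=> iN' i0' /=; rewrite curv_form_rank1 !dot_unit !eqxx unit_colE eqxx [iN == i]eq_sym (negPf iN').
have -> : dot (adj (quat (unit_col i))) (unit_col iN) = 0.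
  rewrite adj_quat dotNl /dot mxE (bigD1 iN) //= big1 ?addr0 => [|l lN]; last first.
    by rewrite unit_colE (negPf lN) mulr0.
  rewrite unit_colE eqxx mulr1 mxE big1 ?oppr0 // => l _; rewrite mxE unit_colE Omega_entry.
  have [->|] := eqVneq l i; last by rewrite mul0r.
  by rewrite eq_sym bar_iN (negPf i0') mulr0n mulr0.
by rewrite !mul0r !mulr0 subr0 add0r conjC1 !mulr1 s_1.
Qed.

Section AtPoint.
Variables (p : A) (Mp : CPn p) (m : Mat).
Hypotheses (um : adj m *m m = 1%:M) (mu : m *m adj m = 1%:M) (tm : tau m = adj m).
Hypotheses (pm : tc p = m *m E0 R n0 *m adj m).
Local Notation al u := (alpha n0 m (u.1 p)).

Lemma R4c_curv_form (x y z w : cfield A) : T10_field CPn Jn x -> T10_field CPn Jn y ->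
  T10_field CPn Jn z -> T10_field CPn Jn w ->
  R4c CPn gn Jn x (cconj y) z (cconj w) p = c0 * B (al x *m adj (al w)) (al y *m adj (al z)).
Proof.
move=> Tx Ty Tz Tw.
rewrite (R4c_mform n0 ht Mp (frame_unit n0 um) (frame_proj pm) Tx Ty Tz Tw); congr (_ * _).
rewrite !(alphaE n0 mu) (mform_unitary _ _ _ _ _ _ _ um mu tm) mform_curv_form //; exact: conjRC.
Qed.

Lemma al_i0 u : T10_field CPn Jn u -> al u i0 0 = 0.
Proof.
move=> [v1 _ _]; apply: (alpha_i0 um mu pm); exact: (vfield_tan n0 v1 Mp).
Qed.

Lemma al_neq0 u : T10_field CPn Jn u -> cval u p != 0 -> al u != 0.
Proof.
move=> [v1 v2 /(_ p Mp)/(T10_coordP Mp um mu pm) Tu]; apply: contra => /eqP a0.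
have [z z0] := T10_coord0 n0 p um mu.
apply/eqP. have h := T10_coord_inj mu pm Tu z. exact: h (etrans a0 (esym z0)).
Qed.

(** Griffiths positivity is positivity on tensors of rank one. *)
Lemma rank1_neq0 (a b : cV) : a != 0 -> b != 0 -> a *m adj b != 0.
Proof.
move=> a0 b0; apply: contra a0 => /eqP e.
have bb : dot (adj b) b != 0.
  apply: contra b0 => /eqP bb; apply/eqP; apply: adj_sum_eq0.
  by rewrite /mxtrace big_ord1.
have := congr1 (fun S => S *m b) e; rewrite rank1_mul mul0mx => /eqP.
by rewrite scaler_eq0 (negPf bb).
Qed.

Lemma griffiths_value u v : T10_field CPn Jn u -> T10_field CPn Jn v ->
  let U := al u *m adj (al v) in
  [/\ R4c CPn gn Jn u (cconj u) v (cconj v) p = c0 * B U U, (forall b, U i0 b = 0) &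
      cval u p != 0 -> cval v p != 0 -> U != 0].
Proof.
move=> Tu Tv U; split; first exact: R4c_curv_form.
  by move=> b; rewrite rank1_entry (al_i0 Tu) mul0r.
by move=> u0 v0; apply: rank1_neq0; exact: al_neq0.
Qed.

Section DualNakano.
Variables (d : nat) (e : 'I_d -> cfield A) (fe : T10_frame_at CPn Jn p e).

(** The zero vector has unique coordinates in the frame. *)
Lemma frame_free (x : 'I_d -> C) : \sum_i x i *: al (e i) = 0 -> forall i, x i = 0.
Proof.
have [Te he] := fe.
have Tc i : T10_coord n0 p m (cval (e i) p).
  by apply/(T10_coordP Mp um mu pm); case: (Te i) => _ _; exact.
have [z z0] := T10_coord0 n0 p um mu.
have [c [_ uc]] := he 0 ((T10_coordP Mp um mu pm 0).2 z).
have uniq (y : 'I_d -> C) : \sum_i y i *: al (e i) = 0 -> c = \row_i y i.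
  move=> y0; apply: uc; have [ty ay] := T10_coord_sum um mu y Tc.
  under eq_bigr => i _ do rewrite mxE.
  apply/esym. have h := T10_coord_inj mu pm ty z. exact: h (etrans (etrans ay y0) (esym z0)).
move=> x0 i; have e1 := uniq _ x0.
have e2 : c = \row_i 0 by apply: uniq; rewrite big1 // => j _; rewrite scale0r.
by have := congr1 (fun r : 'rV_d => r 0 i) (etrans (esym e1) e2); rewrite !mxE.
Qed.

Definition al_mx : 'M[C]_(n + n, d) := \matrix_(c, i) al (e i) c 0.

Lemma al_mx_inj k (X : 'M[C]_(d, k)) : al_mx *m X = 0 -> X = 0.
Proof.
move=> AX; apply/matrixP => i j; rewrite [RHS]mxE; apply: (@frame_free (fun i => X i j)).
apply/colP => c; rewrite summxE [RHS]mxE; have := congr1 (fun S : 'M[C]_(n + n, k) => S c j) AX.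
by rewrite !mxE => h; rewrite -[RHS]h; apply: eq_bigr => l _; rewrite !mxE mulrC.
Qed.

(** The tensor with components [u] in the frame [e]. *)
Definition DNmx (u : 'M[C]_d) : Mat := \sum_(il : 'I_d * 'I_d) u il.1 il.2 *: (al (e il.1) *m adj (al (e il.2))).

Lemma DNmxE (u : 'M[C]_d) : DNmx u = al_mx *m u *m adj al_mx.
Proof.
apply/matrixP => a b; rewrite /DNmx summxE -(pair_bigA _ (fun i l => (u i l *: (al (e i) *m adj (al (e l)))) a b)) /=.
rewrite exchange_big mxE; apply: eq_bigr => l _ /=; rewrite mxE mulr_suml; apply: eq_bigr => i _.
by rewrite mxE rank1_entry !mxE; ring.
Qed.

Lemma DNmx_neq0 (u : 'M[C]_d) : u != 0 -> DNmx u != 0.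
Proof.
apply: contra; rewrite DNmxE -mulmxA => /eqP /al_mx_inj h; apply/eqP.
have := congr1 (@adj R _ _) h; rewrite adjM adjK adj0 => /al_mx_inj h'.
by rewrite -[u]adjK h' adj0.
Qed.

Lemma dual_nakano_value (u : 'M[C]_d) : dual_nakano_form CPn gn Jn p e u = c0 * B (DNmx u) (DNmx u).
Proof.
have [Te _] := fe; rewrite /dual_nakano_form.
rewrite /DNmx curv_form_sum mulr_sumr.
rewrite -(pair_bigA _ (fun i l => c0 * \sum_jk u i l * (u jk.1 jk.2)^* *
   B (al (e i) *m adj (al (e l))) (al (e jk.1) *m adj (al (e jk.2))))) /=.
apply: eq_bigr => i _.
transitivity (\sum_j \sum_l \sum_k
   R4c CPn gn Jn (e i) (cconj (e j)) (e k) (cconj (e l)) p * u i l * (u j k)^*).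
  by apply: eq_bigr => j _; rewrite exchange_big.
rewrite exchange_big; apply: eq_bigr => l _; rewrite mulr_sumr.
rewrite -(pair_bigA _ (fun j k => c0 * (u i l * (u j k)^* *
   B (al (e i) *m adj (al (e l))) (al (e j) *m adj (al (e k)))))) /=.
apply: eq_bigr => j _; apply: eq_bigr => k _; rewrite R4c_curv_form //.
by move: (B _ _) (u i l) (u j k)^* c0 => *; ring.
Qed.

Lemma DNmx_i0 (u : 'M[C]_d) b : DNmx u i0 b = 0.
Proof.
have [Te _] := fe; rewrite /DNmx summxE big1 // => il _.
by rewrite mxE rank1_entry (al_i0 (Te _)) mul0r mulr0.
Qed.

End DualNakano.
Lemma unit_frame : exists e : 'I_(n + n).-1 -> cfield A, T10_frame_at CPn Jn p e /\
  forall i, al (e i) = unit_col (lift i0 i).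
Proof.
have /choice[e he] : forall i : 'I_(n + n).-1, exists u : cfield A,
    T10_field CPn Jn u /\ al u = unit_col (lift i0 i).
  move=> i; apply: (T10_field_exists Mp um pm).
  by rewrite unit_colE (negPf (neq_lift _ _)).
exists e; split; last by move=> i; case: (he i).
have Te i : T10_field CPn Jn (e i) by case: (he i).
have ae i : al (e i) = unit_col (lift i0 i) by case: (he i).
have Tc i : T10_coord n0 p m (cval (e i) p).
  by apply/(T10_coordP Mp um mu pm); case: (Te i) => _ _; exact.
split=> // w /(T10_coordP Mp um mu pm) Tw.
have entry (y : 'I_(n + n).-1 -> C) (j : 'I_(n + n).-1) : (\sum_i y i *: al (e i)) (lift i0 j) 0 = y j.
  rewrite summxE (bigD1 j) //= big1 ?addr0 => [|i ij].
    by rewrite ae mxE unit_colE eqxx mulr1.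
  by rewrite ae mxE unit_colE (inj_eq (@lift_inj _ i0)) eq_sym (negPf ij) mulr0.
have S (y : 'I_(n + n).-1 -> C) := T10_coord_sum um mu y Tc.
exists (\row_i alpha n0 m w.1 (lift i0 i) 0); split.
  under eq_bigr => i _ do rewrite mxE.
  have [T a] := S (fun i => alpha n0 m w.1 (lift i0 i) 0).
  apply: (T10_coord_inj mu pm Tw T); rewrite a; apply/colP => l.
  case: (unliftP i0 l) => [j ->|->]; first exact/esym/entry.
  rewrite (alpha_i0 um mu pm); last by case: Tw.
  by rewrite summxE big1 // => i _; rewrite mxE (al_i0 (Te i)) mulr0.
move=> c wE; apply/rowP => i; rewrite mxE wE.
by have [_ ->] := S (fun i => c 0 i); exact: entry.
Qed.

End AtPoint.

Lemma CP_frame p : CPn p -> exists m : Mat, [/\ adj m *m m = 1%:M, m *m adj m = 1%:M,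
  tau m = adj m & tc p = m *m E0 R n0 *m adj m].
Proof. by move/(CPP n0). Qed.

Lemma griffiths_ge : 1 <= t -> griffiths_semipositive CPn gn Jn.
Proof.
move=> t1 p u v Mp Tu Tv u0 v0; have [m [um mu tm pm]] := CP_frame Mp.
have [-> U0 _] := griffiths_value Mp um mu tm pm Tu Tv.
by rewrite mulr_ge0 ?(ltW c0_gt0) // B_ge0.
Qed.

Lemma griffiths_gt : 1 < t -> griffiths_positive CPn gn Jn.
Proof.
move=> t1 p u v Mp Tu Tv u0 v0; have [m [um mu tm pm]] := CP_frame Mp.
have [-> U0 Un] := griffiths_value Mp um mu tm pm Tu Tv.
by rewrite mulr_gt0 ?c0_gt0 // B_gt0 // Un.
Qed.

Lemma dual_nakano_ge : 1 <= t -> dual_nakano_semipositive CPn gn Jn.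
Proof.
move=> t1 p d e Mp fe u u0; have [m [um mu tm pm]] := CP_frame Mp.
rewrite (dual_nakano_value Mp um mu tm pm fe) mulr_ge0 ?(ltW c0_gt0) // B_ge0 // => b.
exact: (DNmx_i0 Mp um mu pm fe).
Qed.

Lemma dual_nakano_gt : 1 < t -> dual_nakano_positive CPn gn Jn.
Proof.
move=> t1 p d e Mp fe u u0; have [m [um mu tm pm]] := CP_frame Mp.
rewrite (dual_nakano_value Mp um mu tm pm fe) mulr_gt0 ?c0_gt0 // B_gt0 // => [b|].
  exact: (DNmx_i0 Mp um mu pm fe).
exact: (DNmx_neq0 Mp um mu pm fe).
Qed.

Section Sharpness.
Variable (n1 : (1 < n)%N).
Let i1 : 'I_(n + n) := lshift n (Ordinal n1).

Let i1_neq_i0 : i1 != i0.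
Proof. by rewrite eq_lshift. Qed.

Let i1_neq_iN : i1 != iN.
Proof. by rewrite eq_lrshift. Qed.

Lemma CP_base : CPn (of_complex (E0 R n0)).
Proof.
apply/(CPP n0); exists 1%:M; rewrite adj1 tau1 !mulmx1 mul1mx of_complexK.
by [].
Qed.

Lemma griffiths_sharp : exists p u v, [/\ CPn p, T10_field CPn Jn u, T10_field CPn Jn v,
  cval u p != 0 /\ cval v p != 0 & R4c CPn gn Jn u (cconj u) v (cconj v) p = c0 * (t - 1)%:C%C].
Proof.
have Mp := CP_base; have [m [um mu tm pm]] := CP_frame Mp.
have U i : i != i0 -> unit_col i i0 0 = 0 by move=> h; rewrite unit_colE eq_sym (negPf h).
have [u [Tu au]] := T10_field_exists Mp um pm (U _ i1_neq_i0).
have [v [Tv av]] := T10_field_exists Mp um pm (U _ (negbT (iN_neq_i0 n0))).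
have nz (w : cfield A) i : alpha n0 m (w.1 (of_complex (E0 R n0))) = unit_col i -> cval w (of_complex (E0 R n0)) != 0.
  move=> aw; apply/eqP => w0; have [_ z] := T10_coord0 n0 (of_complex (E0 R n0)) um mu.
  have e : w.1 (of_complex (E0 R n0)) = 0 := congr1 fst w0.
  have := congr1 (fun S : cV => S i 0) aw; rewrite e z mxE unit_colE eqxx => /eqP.
  by rewrite eq_sym oner_eq0.
exists (of_complex (E0 R n0)), u, v; split=> //; first by split; [exact: nz au|exact: nz av].
rewrite (R4c_curv_form Mp um mu tm pm Tu Tu Tv Tv) au av; congr (_ * _).
exact: B_unit.
Qed.

Lemma dual_nakano_sharp : exists p d (e : 'I_d -> cfield A) (u : 'M[C]_d),
  [/\ CPn p, T10_frame_at CPn Jn p e, u != 0 &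
      dual_nakano_form CPn gn Jn p e u = c0 * (t - 1)%:C%C].
Proof.
have Mp := CP_base; have [m [um mu tm pm]] := CP_frame Mp.
have [e [fe ae]] := unit_frame Mp um mu pm.
have [j1 e1] : exists j, i1 = lift i0 j.
  by case: (unliftP i0 i1) => [j ->|h]; [exists j|have := i1_neq_i0; rewrite h eqxx].
have [jN eN] : exists j, iN = lift i0 j.
  by case: (unliftP i0 iN) => [j ->|h]; [exists j|have := iN_neq_i0 n0; rewrite h eqxx].
exists (of_complex (E0 R n0)), (n + n).-1, e, (delta_mx j1 jN); split=> //.
  apply/eqP => /matrixP/(_ j1 jN)/eqP; rewrite !mxE !eqxx oner_eq0.
  by [].
rewrite (dual_nakano_value Mp um mu tm pm fe); congr (_ * _).
have -> : DNmx (of_complex (E0 R n0)) m e (delta_mx j1 jN) = unit_col i1 *m adj (unit_col iN).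
  rewrite /DNmx (bigD1 (j1, jN)) //= big1 ?addr0 => [|[i l] il]; last first.
    rewrite mxE; have -> : (i == j1) && (l == jN) = false by apply: negbTE.
    by rewrite scale0r.
  by rewrite mxE !eqxx scale1r !ae -e1 -eN.
exact: B_unit.
Qed.

Theorem CP_positivity :
  (griffiths_semipositive CPn gn Jn <-> 1 <= t) /\
  (dual_nakano_semipositive CPn gn Jn <-> 1 <= t) /\
  (griffiths_positive CPn gn Jn <-> 1 < t) /\
  (dual_nakano_positive CPn gn Jn <-> 1 < t).
Proof.
have [p [u [v [Mp Tu Tv [u0 v0] val]]]] := griffiths_sharp.
have [q [d [e [w [Mq fe w0 valD]]]]] := dual_nakano_sharp.
have pos (z : R) : (0 <= c0 * z%:C%C) = (0 <= z) by rewrite (pmulr_rge0 _ c0_gt0) lecR.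
have spos (z : R) : (0 < c0 * z%:C%C) = (0 < z) by rewrite (pmulr_rgt0 _ c0_gt0) ltcR.
split; last split; last split; split=> [h|].
- by have := h p u v Mp Tu Tv u0 v0; rewrite val pos subr_ge0.
- exact: griffiths_ge.
- by have := h q d e Mq fe w w0; rewrite valD pos subr_ge0.
- exact: dual_nakano_ge.
- by have := h p u v Mp Tu Tv u0 v0; rewrite val spos subr_gt0.
- exact: griffiths_gt.
- by have := h q d e Mq fe w w0; rewrite valD spos subr_gt0.
- exact: dual_nakano_gt.
Qed.

End Sharpness.
End Positivity.

Theorem theorem1p11 (R : realType) (n : nat) (t : R) (hn : (2 <= n)%N) (ht : 0 < t) :
  (griffiths_semipositive (@CP R n) (CP_metric t) (@CP_J R n) <-> 1 <= t) /\
  (dual_nakano_semipositive (@CP R n) (CP_metric t) (@CP_J R n) <-> 1 <= t) /\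
  (griffiths_positive (@CP R n) (CP_metric t) (@CP_J R n) <-> 1 < t) /\
  (dual_nakano_positive (@CP R n) (CP_metric t) (@CP_J R n) <-> 1 < t).
Proof. exact: CP_positivity (ltnW hn) t ht hn. Qed.
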